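(* Fix $k>0$ and let $f(x)=\dfrac{1}{(1+x^2)^{k/2}}$ for $x\in\mathbb{R}$. Then there exists a constant $M_5>0$ such that, for all $\epsilon\in(0,1]$, $$\Sigma(\epsilon)\ \ge\ \frac{M_5}{\epsilon^{\nu'}},\qquad\text{where }\ \nu'=\min\Bigl\{\frac12,\ \frac{2}{k+2}\Bigr\}.$$
   Context: For $\epsilon>0$, $H_\epsilon=-\partial_x^2+x^2+\frac{i}{\epsilon}f(x)$ is the operator on $L^2(\mathbb{R})$ (complex-valued functions) with domain $\mathcal{D}=\{u\in H^2(\mathbb{R}) : x^2u\in L^2(\mathbb{R})\}$, and $\Sigma(\epsilon)=\inf\{\operatorname{Re} z : z\in\sigma(H_\epsilon)\}$ is the lowest real part of its spectrum (which consists of a sequence of eigenvalues, since $H_\epsilon$ has compact resolvent). *)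

(* Defs.v *)
From mathcomp Require Import all_boot all_order all_algebra complex.
From mathcomp Require Import all_classical all_reals all_analysis.

Set Implicit Arguments.
Unset Strict Implicit.
Unset Printing Implicit Defensive.

Import Order.TTheory GRing.Theory Num.Theory.
Import numFieldNormedType.Exports.

Local Open Scope classical_set_scope.
Local Open Scope ring_scope.
Local Open Scope complex_scope.

(** Elements of [L^2(R; C)] are represented by functions [R -> R[i]]; equality
    in [L^2] is equality almost everywhere. *)

Definition L2norm {R : realType} (u : R -> R[i]) : \bar R :=
  'N[@lebesgue_measure R]_2%:E[(fun x => (Normc.normc (u x))%:E)].

Definition L2 {R : realType} : set (R -> R[i]) :=
  [set u | [/\ measurable_fun [set: R] (fun x => complex.Re (u x)),
               measurable_fun [set: R] (fun x => complex.Im (u x)) &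
               (L2norm u < +oo)%E]].

Definition cintegral {R : realType} (g : R -> R[i]) : R[i] :=
  (\int[@lebesgue_measure R]_x complex.Re (g x)) +i*
  (\int[@lebesgue_measure R]_x complex.Im (g x)).

Definition test_function {R : realType} : set (R -> R) :=
  [set phi | (forall (n : nat) (x : R), derivable (phi^`(n))%classic x 1) /\
             exists A : R, forall x : R, A < `|x| -> phi x = 0].

(** [v] is a square-integrable distributional derivative of [u]. *)
Definition L2_weak_derivative {R : realType} (u v : R -> R[i]) : Prop :=
  L2 v /\
  forall phi : R -> R, test_function phi ->
    cintegral (fun x => (phi^`()%classic x)%:C * u x) =
    - cintegral (fun x => (phi x)%:C * v x).

(** A representative of the [L^2] weak derivative, which is unique up to
    equality almost everywhere; the junk value is [0] when there is none. *)
Definition weak_derive {R : realType} (u : R -> R[i]) : R -> R[i] :=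
  xget (cst 0) [set v | L2_weak_derivative u v].

Definition H2 {R : realType} : set (R -> R[i]) :=
  [set u | L2 u /\ exists u1 u2 : R -> R[i],
             L2_weak_derivative u u1 /\ L2_weak_derivative u1 u2].

(** Spectral theory of an unbounded operator [A] on [L^2(R; C)] with domain
    [dom]: [z] is in the resolvent set when [A - z : dom -> L^2] is a bijection
    with bounded inverse. [A] is expected to map [dom] into [L2] and to respect
    equality almost everywhere. *)
Definition resolvent_set {R : realType} (dom : set (R -> R[i]))
    (A : (R -> R[i]) -> R -> R[i]) : set R[i] :=
  [set z |
    [/\ forall g, L2 g -> exists2 u, dom u &
          (fun x => A u x - z * u x) = g %[ae @lebesgue_measure R],
        forall u v, dom u -> dom v ->
          (fun x => A u x - z * u x) = (fun x => A v x - z * v x)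
            %[ae @lebesgue_measure R] ->
          u = v %[ae @lebesgue_measure R] &
        exists C : R, forall u, dom u ->
          (L2norm u <= C%:E * L2norm (fun x => A u x - z * u x)%R)%E]].

Definition spectrum {R : realType} (dom : set (R -> R[i]))
    (A : (R -> R[i]) -> R -> R[i]) : set R[i] :=
  ~` resolvent_set dom A.

Definition domH {R : realType} : set (R -> R[i]) :=
  [set u | H2 u /\ L2 (fun x => (x ^+ 2)%:C * u x)].

Definition opH {R : realType} (f : R -> R) (eps : R) (u : R -> R[i]) :
    R -> R[i] :=
  fun x => - weak_derive (weak_derive u) x + (x ^+ 2)%:C * u x
           + 'i%C / eps%:C * (f x)%:C * u x.

(** Taken in the extended reals, so that no nonemptiness or lower bound of the
    spectrum is presupposed. *)
Definition Sigma {R : realType} (f : R -> R) (eps : R) : \bar R :=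
  ereal_inf [set (complex.Re z)%:E | z in spectrum domH (opH f eps)].

(* Main.v *)
Require Import Defs.
From mathcomp Require Import all_boot all_order all_algebra complex.
From mathcomp Require Import all_classical all_reals all_analysis.
From mathcomp Require Import measurable_realfun.
From mathcomp Require Import ring lra.

(* When [Re z] is below the bound, [psi'' = V psi] with
   [V = x^2 + (i / eps) f - z] has a solution [psi] recessive at [+oo] with
   [psi 0 != 0] and [psi' 0 != 0]: if not, continue [psi] to a ray
   [e^{i th} t], where it still decays: [- Im f / eps] is positive there, and
   [Re (e^{-2 i th} w^* w') + cos (2 th) h |w|^2], which vanishes at both ends of
   the ray, is increasing for a suitable Riccati multiplier [h], because
   [t^2 - Im f / eps + h' - h^2 >= c / eps^nu'].
   As [V] is even, [psi] and [psi (- x)] are then independent; the Green function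
   they form decays exponentially off the diagonal, so that by Schur's test it
   defines a bounded inverse of [H_eps - z]. Du Bois-Reymond's lemma turns weak
   derivatives into absolutely continuous representatives, and a square
   integrable solution of the homogeneous equation vanishes because its
   Wronskians with [psi] and [psi (- x)] do. Hence [z] is in the resolvent set. *)

Set Implicit Arguments.
Unset Strict Implicit.
Unset Printing Implicit Defensive.

Import Order.TTheory GRing.Theory Num.Theory.
Import numFieldNormedType.Exports.

Local Open Scope classical_set_scope.
Local Open Scope ring_scope.
Local Open Scope complex_scope.

(** On the real axis the real part of [V] is [x^2 - Re z], so an energy estimate there sees nothing
    of [f / eps]; rotation converts part of the imaginary term into a positive real one. The gain is
    of order [t^2 / eps] near the origin and [t^{-k} / eps] far away, with constants depending only
    on [k]. The first behaves like a harmonic oscillator, whose ground energy is of order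
    [eps^{-1/2}]; the second, balanced against [t^2], is weakest where both are of order
    [eps^{-2/(k+2)}]. This is the origin of the two exponents in [nu']. The rotated equation is
    reached through a family of linear equations in a real variable, with the angle as a parameter
    in which solutions are differentiated. The two failures [psi 0 = 0] and [psi' 0 = 0] make the
    same boundary term vanish, so one energy argument excludes both; by evenness they are the only
    ways in which the Wronskian of [psi] and its reflection, which is [- 2 psi(0) psi'(0)], can
    vanish. *)

Notation Re := complex.Re.
Notation Im := complex.Im.

(** * Differentiation of real and complex functions *)

Section RealDerivative.
Context {R : realType}.
Implicit Types (f g : R -> R) (x l a b : R).

(** Derivability and the value of the derivative in one statement: the rules below produce some
    expression for the derivative, and [rd_eq] then brings it to the desired form. *)
Definition rd f x l := derivable f x 1 /\ f^`()%classic x = l.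

Lemma rdP f x l : rd f x l <-> is_derive x (1 : R) f l.
Proof.
split=> [[d <-]|h]; first by rewrite derive1E; apply: derivableP.
split; first exact: (@ex_derive _ _ _ _ _ _ _ h).
by rewrite derive1E; exact: (@derive_val _ _ _ _ _ _ _ h).
Qed.

Lemma rd_eq f x l l' : rd f x l -> l = l' -> rd f x l'.
Proof. by move=> h <-. Qed.

Lemma derivable_rd f x : derivable f x 1 -> rd f x (f^`()%classic x).
Proof. by []. Qed.

Lemma rd_cont f x l : rd f x l -> {for x, continuous f}.
Proof. by move=> [/derivable1_diffP/differentiable_continuous]. Qed.

Lemma rd_cst (c : R) x : rd (fun=> c) x 0.
Proof. by apply/rdP; exact: is_derive_cst. Qed.

Lemma rd_id x : rd (fun t => t) x 1.
Proof. by apply/rdP; exact: is_derive_id. Qed.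

Lemma rdD f g x l m : rd f x l -> rd g x m -> rd (fun t => f t + g t) x (l + m).
Proof. by move=> /rdP ? /rdP ?; apply/rdP; exact: is_deriveD. Qed.

Lemma rdN f x l : rd f x l -> rd (fun t => - f t) x (- l).
Proof. by move=> /rdP ?; apply/rdP; exact: is_deriveN. Qed.

Lemma rdB f g x l m : rd f x l -> rd g x m -> rd (fun t => f t - g t) x (l - m).
Proof. by move=> /rdP ? /rdP ?; apply/rdP; exact: is_deriveB. Qed.

Lemma rdM f g x l m : rd f x l -> rd g x m ->
  rd (fun t => f t * g t) x (l * g x + f x * m).
Proof.
move=> /rdP hf /rdP hg; apply: (@rd_eq _ _ (f x *: m + g x *: l)).
  by apply/rdP; exact: is_deriveM.
by rewrite /GRing.scale/= addrC [g x * l]mulrC.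
Qed.

Lemma rd_mull (k x : R) : rd ( *%R k) x k.
Proof. by apply: rd_eq (rdM (rd_cst k x) (rd_id x)) _; rewrite mul0r add0r mulr1. Qed.

Lemma rd_addl (k x : R) : rd (+%R k) x 1.
Proof. by apply: rd_eq (rdD (rd_cst k x) (rd_id x)) _; rewrite add0r. Qed.

Lemma rd_opp (x : R) : rd -%R x (- 1).
Proof. by apply: rdN; exact: rd_id. Qed.

Lemma rdX f n x l : rd f x l -> rd (fun t => f t ^+ n) x (n%:R * f x ^+ n.-1 * l).
Proof.
move=> hf; elim: n => [|n ih].
  by apply: rd_eq (rd_cst 1 x) _; rewrite !mul0r.
have -> : (fun t => f t ^+ n.+1) = (fun t => f t * f t ^+ n).
  by apply/funext => t; rewrite exprS.
apply: rd_eq (rdM hf ih) _ => /=; case: n ih => [|n] _ /=.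
  by rewrite expr0; ring.
by rewrite exprS -[n.+2]addn1 natrD; ring.
Qed.

Lemma rd_comp f g x l m : rd g x m -> rd f (g x) l -> rd (fun t => f (g t)) x (l * m).
Proof. by move=> /rdP hg /rdP hf; apply/rdP; apply: (@is_derive1_comp R f g). Qed.

Lemma rdV f x l : f x != 0 -> rd f x l -> rd (fun t => (f t)^-1) x (- l / f x ^+ 2).
Proof.
move=> fx [hf <-]; split; first exact: derivableV.
by rewrite !derive1E (@deriveV R _ f x 1) // /GRing.scale/= mulNr mulrC mulNr.
Qed.

Lemma rd_expR f x l : rd f x l -> rd (fun t => expR (f t)) x (expR (f x) * l).
Proof. by move=> h; apply: rd_comp h _; apply/rdP; apply: is_derive_expR. Qed.

Lemma rd_ln f x l : 0 < f x -> rd f x l -> rd (fun t => ln (f t)) x ((f x)^-1 * l).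
Proof. by move=> fx h; apply: rd_comp h _; apply/rdP; apply: is_derive1_ln. Qed.

Lemma rd_sin f x l : rd f x l -> rd (fun t => sin (f t)) x (cos (f x) * l).
Proof. by move=> h; apply: rd_comp h _; apply/rdP; apply: is_derive_sin. Qed.

Lemma rd_cos f x l : rd f x l -> rd (fun t => cos (f t)) x (- sin (f x) * l).
Proof. by move=> h; apply: rd_comp h _; apply/rdP; apply: is_derive_cos. Qed.

Lemma rd_atan f x l :
  rd f x l -> rd (fun t => atan (f t)) x ((1 + f x ^+ 2)^-1 * l).
Proof. by move=> h; apply: rd_comp h _; apply/rdP; apply: is_derive1_atan. Qed.

Lemma rd_powR f x l p : 0 < f x -> rd f x l ->
  rd (fun t => f t `^ p) x (p * f x `^ (p - 1) * l).
Proof.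
by move=> fx h; apply: (@rd_comp (fun u => u `^ p)) h _; apply/rdP; apply: is_derive1_powR.
Qed.

Lemma rd_mvt f (df : R -> R) a b : a <= b ->
  (forall x, a <= x <= b -> rd f x (df x)) ->
  exists2 c, a <= c <= b & f b - f a = df c * (b - a).
Proof.
rewrite le_eqVlt => /predU1P[<- _|ab h].
  by exists a; rewrite ?lexx // !subrr mulr0.
have [||c] := @MVT R f df a b ab.
- by move=> x; rewrite in_itv /= => /andP[/ltW ax /ltW xb]; apply/rdP/h; rewrite ax.
- apply: derivable_within_continuous => x.
  by rewrite in_itv /= => /h [].
by rewrite in_itv /= => /andP[/ltW ax /ltW xb] e; exists c; rewrite // ax.
Qed.

Lemma rd_incr f (df : R -> R) a b : a <= b ->
  (forall x, a <= x <= b -> rd f x (df x)) ->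
  (forall x, a <= x <= b -> 0 <= df x) -> f a <= f b.
Proof.
move=> ab h p; have [c /p dc e] := rd_mvt ab h.
by rewrite -subr_ge0 e mulr_ge0 // subr_ge0.
Qed.

Lemma rd_le_incr f g (df dg : R -> R) a b : a <= b ->
  (forall x, a <= x <= b -> rd f x (df x)) ->
  (forall x, a <= x <= b -> rd g x (dg x)) ->
  (forall x, a <= x <= b -> df x <= dg x) -> f b - f a <= g b - g a.
Proof.
move=> ab hf hg h.
have : g a - f a <= g b - f b.
  apply: (@rd_incr (fun t => g t - f t) (fun t => dg t - df t) a b ab).
    by move=> x hx; apply: rdB; [exact: hg|exact: hf].
  by move=> x hx; rewrite subr_ge0 h.
lra.
Qed.

Lemma rd_zero_cst f a b : (forall x, a <= x <= b -> rd f x 0) -> a <= b -> f a = f b.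
Proof.
move=> h ab; have [c _] := rd_mvt ab h.
by rewrite mul0r => /eqP; rewrite subr_eq0 => /eqP.
Qed.

End RealDerivative.

(** * Complex numbers and complex-valued functions of a real variable *)

Section ComplexBasics.
Context {R : realType}.
Implicit Types (z w : R[i]) (F G : R -> R[i]) (x t : R).

Definition nc z : R := Normc.normc z.

Lemma ReD z w : Re (z + w) = Re z + Re w. Proof. by case: z; case: w. Qed.
Lemma ImD z w : Im (z + w) = Im z + Im w. Proof. by case: z; case: w. Qed.
Lemma ReN z : Re (- z) = - Re z. Proof. by case: z. Qed.
Lemma ImN z : Im (- z) = - Im z. Proof. by case: z. Qed.
Lemma ReM z w : Re (z * w) = Re z * Re w - Im z * Im w.
Proof. by case: z; case: w. Qed.
Lemma ImM z w : Im (z * w) = Re z * Im w + Im z * Re w.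
Proof. by case: z; case: w. Qed.
Lemma ReJ z : Re z^* = Re z. Proof. by case: z. Qed.
Lemma ImJ z : Im z^* = - Im z. Proof. by case: z. Qed.

Lemma ReC (x : R) : Re x%:C = x. Proof. by []. Qed.
Lemma ImC (x : R) : Im x%:C = 0. Proof. by []. Qed.
Lemma Rei : Re ('i : R[i]) = 0. Proof. by []. Qed.
Lemma Imi : Im ('i : R[i]) = 1. Proof. by []. Qed.
Lemma Re0 : Re (0 : R[i]) = 0. Proof. by []. Qed.
Lemma Im0 : Im (0 : R[i]) = 0. Proof. by []. Qed.
Lemma Re1 : Re (1 : R[i]) = 1. Proof. by []. Qed.
Lemma Im1 : Im (1 : R[i]) = 0. Proof. by []. Qed.

Lemma ReX2 z : Re (z ^+ 2) = Re z ^+ 2 - Im z ^+ 2.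
Proof. by rewrite expr2 ReM -!expr2. Qed.
Lemma ImX2 z : Im (z ^+ 2) = 2 * Re z * Im z.
Proof. by rewrite expr2 ImM; ring. Qed.

Lemma ReE (a b : R) : Re (a +i* b) = a. Proof. by []. Qed.
Lemma ImE (a b : R) : Im (a +i* b) = b. Proof. by []. Qed.

Definition cE := (ReE, ImE, ReX2, ImX2, ReD, ImD, ReN, ImN, ReM, ImM, ReJ, ImJ, ReC, ImC,
  Rei, Imi, Re0, Im0, Re1, Im1).

Lemma ceq z w : Re z = Re w -> Im z = Im w -> z = w.
Proof. by case: z => a b; case: w => c d /= -> ->. Qed.

Lemma ncE z : nc z = Num.sqrt (Re z ^+ 2 + Im z ^+ 2).
Proof. by case: z. Qed.

Lemma nc_ge0 z : 0 <= nc z.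
Proof. by rewrite ncE sqrtr_ge0. Qed.

Lemma nc_sqr z : nc z ^+ 2 = Re z ^+ 2 + Im z ^+ 2.
Proof. by rewrite ncE sqr_sqrtr // addr_ge0 ?sqr_ge0. Qed.

Lemma nc0 : nc 0 = 0. Proof. exact: Normc.normc0. Qed.
Lemma nc1 : nc 1 = 1. Proof. exact: Normc.normc1. Qed.
Lemma ncM z w : nc (z * w) = nc z * nc w. Proof. exact: Normc.normcM. Qed.
Lemma ncV z : nc z^-1 = (nc z)^-1. Proof. exact: Normc.normcV. Qed.
Lemma ncD z w : nc (z + w) <= nc z + nc w. Proof. exact: le_normcD. Qed.
Lemma ncN z : nc (- z) = nc z. Proof. exact: normcN. Qed.
Lemma ncB z w : nc (z - w) <= nc z + nc w.
Proof. by rewrite -(ncN w) ncD. Qed.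
Lemma nc_eq0 z : (nc z == 0) = (z == 0).
Proof.
by apply/eqP/eqP => [/Normc.eq0_normc|->]; rewrite ?nc0.
Qed.
Lemma nc_gt0 z : (0 < nc z) = (z != 0).
Proof. by rewrite lt_neqAle nc_ge0 andbT eq_sym nc_eq0. Qed.
Lemma ncC x : nc x%:C = `|x|.
Proof. by rewrite ncE /= expr0n addr0 sqrtr_sqr. Qed.
Lemma nci : nc 'i = 1.
Proof. by rewrite ncE /= expr0n add0r expr1n sqrtr1. Qed.
Lemma ncX z n : nc (z ^+ n) = nc z ^+ n.
Proof. by elim: n => [|n ih]; rewrite ?nc1 // !exprS ncM ih. Qed.
Lemma ncJ z : nc z^* = nc z.
Proof. by rewrite !ncE !cE sqrrN. Qed.

Lemma Re_le_nc z : `|Re z| <= nc z.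
Proof. by rewrite ncE -sqrtr_sqr ler_sqrt ?lerDl ?sqr_ge0 // addr_ge0 ?sqr_ge0. Qed.
Lemma Im_le_nc z : `|Im z| <= nc z.
Proof. by rewrite ncE -sqrtr_sqr ler_sqrt ?lerDr ?sqr_ge0 // addr_ge0 ?sqr_ge0. Qed.
Lemma Re_le z : Re z <= nc z.
Proof. exact: le_trans (ler_norm _) (Re_le_nc z). Qed.
Lemma nc_le_ReIm z : nc z <= `|Re z| + `|Im z|.
Proof.
rewrite -(@ler_pXn2r _ 2) // ?nnegrE ?nc_ge0 ?addr_ge0 //.
rewrite nc_sqr -(real_normK (num_real (Re z))) -(real_normK (num_real (Im z))).
by have := normr_ge0 (Re z); have := normr_ge0 (Im z); nra.
Qed.

Lemma ReJM z w : Re (z^* * w) <= nc z * nc w.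
Proof. by rewrite -(ncJ z) -ncM Re_le. Qed.

Lemma mulJ z : z^* * z = (nc z ^+ 2)%:C.
Proof. by rewrite nc_sqr; apply: ceq; rewrite !cE; ring. Qed.

Lemma mulJr z : z * z^* = (nc z ^+ 2)%:C.
Proof. by rewrite mulrC mulJ. Qed.

Lemma realCM (a b : R) : (a * b)%:C = a%:C * b%:C :> R[i].
Proof. by apply: ceq; rewrite !cE; ring. Qed.
Lemma realCD (a b : R) : (a + b)%:C = a%:C + b%:C :> R[i].
Proof. by apply: ceq; rewrite !cE; ring. Qed.
Lemma realCN (a : R) : (- a)%:C = - a%:C :> R[i].
Proof. by apply: ceq; rewrite !cE; ring. Qed.

Definition cd F x z := rd (fun t => Re (F t)) x (Re z) /\ rd (fun t => Im (F t)) x (Im z).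

Lemma cd_eq F x z z' : cd F x z -> z = z' -> cd F x z'.
Proof. by move=> h <-. Qed.

Lemma cd_cst (c : R[i]) x : cd (fun=> c) x 0.
Proof. by split; exact: rd_cst. Qed.

Lemma cdD F G x z w : cd F x z -> cd G x w -> cd (fun t => F t + G t) x (z + w).
Proof.
move=> [a b] [c d]; split; rewrite cE.
  by under eq_fun do rewrite cE; exact: rdD.
by under eq_fun do rewrite cE; exact: rdD.
Qed.

Lemma cdN F x z : cd F x z -> cd (fun t => - F t) x (- z).
Proof.
move=> [a b]; split; rewrite cE.
  by under eq_fun do rewrite cE; exact: rdN.
by under eq_fun do rewrite cE; exact: rdN.
Qed.

Lemma cdB F G x z w : cd F x z -> cd G x w -> cd (fun t => F t - G t) x (z - w).
Proof. by move=> h1 h2; apply: cdD => //; exact: cdN. Qed.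

Lemma cdM F G x z w : cd F x z -> cd G x w ->
  cd (fun t => F t * G t) x (z * G x + F x * w).
Proof.
move=> [a b] [c d]; split.
  under eq_fun do rewrite cE.
  by apply: rd_eq (rdB (rdM a c) (rdM b d)) _; rewrite !cE; ring.
under eq_fun do rewrite cE.
by apply: rd_eq (rdD (rdM a d) (rdM b c)) _; rewrite !cE; ring.
Qed.

Lemma cdZ (c : R[i]) F x z : cd F x z -> cd (fun t => c * F t) x (c * z).
Proof. by move=> h; apply: cd_eq (cdM (cd_cst c x) h) _; rewrite mul0r add0r. Qed.

Lemma cd_real (f : R -> R) x l : rd f x l -> cd (fun t => (f t)%:C) x l%:C.
Proof. by move=> h; split => //=; exact: rd_cst. Qed.

Lemma cdJ F x z : cd F x z -> cd (fun t => (F t)^*) x z^*.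
Proof.
move=> [a b]; split; rewrite cE.
  by under eq_fun do rewrite cE.
by under eq_fun do rewrite cE; exact: rdN.
Qed.

Lemma cd_comp F (g : R -> R) x z m : rd g x m -> cd F (g x) z ->
  cd (fun t => F (g t)) x (z * m%:C).
Proof.
move=> hg [a b]; split.
  by apply: rd_eq (rd_comp hg a) _; rewrite !cE; ring.
by apply: rd_eq (rd_comp hg b) _; rewrite !cE; ring.
Qed.

Lemma cd_nc2 F x z : cd F x z -> rd (fun t => nc (F t) ^+ 2) x (2 * Re ((F x)^* * z)).
Proof.
move=> [a b]; under eq_fun do rewrite nc_sqr.
by apply: rd_eq (rdD (rdX 2 a) (rdX 2 b)) _; rewrite !cE /=; ring.
Qed.

Lemma ReV z : Re z^-1 = Re z / nc z ^+ 2.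
Proof. by rewrite nc_sqr; case: z. Qed.
Lemma ImV z : Im z^-1 = - Im z / nc z ^+ 2.
Proof. by rewrite nc_sqr; case: z => a b /=; rewrite mulNr. Qed.

Lemma invJ z : z^-1 = z^* * ((nc z ^+ 2)^-1)%:C.
Proof. by apply: ceq; rewrite ?ReV ?ImV !cE; ring. Qed.

Lemma cdV F x z : F x != 0 -> cd F x z -> cd (fun t => (F t)^-1) x (- z / F x ^+ 2).
Proof.
move=> Fx h; under eq_fun do rewrite invJ.
have n0 : nc (F x) ^+ 2 != 0 by rewrite expf_neq0 // nc_eq0.
apply: (@cd_eq _ _ _ _ (cdM (cdJ h)
  (cd_real (@rdV _ (fun t => nc (F t) ^+ 2) x _ n0 (cd_nc2 h))))).
have nE : ((nc (F x) ^+ 2)%:C)^-1 = ((nc (F x) ^+ 2)^-1)%:C :> R[i].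
  by rewrite fmorphV.
rewrite -mulJ in nE.
have E : F x ^-2 = ((F x)^*) ^+ 2 * ((nc (F x) ^+ 2)^-1)%:C ^+ 2.
  by rewrite -exprMn -invJ exprVn.
have n0' := n0; move: n0 E; rewrite nc_sqr => n0 E; rewrite E.
have n1 : Re (F x) ^+ 2 + Im (F x) ^+ 2 != 0 by [].
by apply: ceq; rewrite !cE; field.
Qed.

Lemma cd_div F G x z w : G x != 0 -> cd F x z -> cd G x w ->
  cd (fun t => F t / G t) x ((z * G x - F x * w) / G x ^+ 2).
Proof.
by move=> Gx hF hG; apply: cd_eq (cdM hF (cdV Gx hG)) _; field.
Qed.

Lemma cd_contRe F x z : cd F x z -> {for x, continuous (fun t => Re (F t))}.
Proof. by move=> [/rd_cont]. Qed.
Lemma cd_contIm F x z : cd F x z -> {for x, continuous (fun t => Im (F t))}.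
Proof. by move=> [_ /rd_cont]. Qed.

(* Pairing with the unit vector in the direction of the increment reduces the
   complex case to the real one. *)
Lemma cd_mvt F (dF : R -> R[i]) (g dg : R -> R) a b : a <= b ->
  (forall x, a <= x <= b -> cd F x (dF x)) ->
  (forall x, a <= x <= b -> rd g x (dg x)) ->
  (forall x, a <= x <= b -> nc (dF x) <= dg x) ->
  nc (F b - F a) <= g b - g a.
Proof.
move=> ab hF hg h; set c := F b - F a.
have [c0|c0] := eqVneq c 0.
  rewrite c0 nc0 subr_ge0; apply: rd_incr ab hg _ => x /h.
  exact: le_trans (nc_ge0 _).
have n0 : 0 < nc c by rewrite nc_gt0.
have : Re (c^* * F b) - Re (c^* * F a) <= nc c * g b - nc c * g a.
  apply: (@rd_le_incr _ (fun t => Re (c^* * F t)) (fun t => nc c * g t)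
    (fun t => Re (c^* * dF t)) (fun t => nc c * dg t) a b ab).
  - by move=> x /hF /(cdZ c^*) [].
  - by move=> x /hg k; apply: rd_eq (rdM (rd_cst (nc c) x) k) _; rewrite mul0r add0r.
  - by move=> x /h k; apply: le_trans (ReJM _ _) _; rewrite ler_wpM2l ?nc_ge0.
rewrite -mulrBr.
have -> : Re (c^* * F b) - Re (c^* * F a) = nc c * nc c.
  by rewrite -ReN -ReD -mulrN -mulrDr -/c mulJ.
by rewrite ler_pM2l.
Qed.

Lemma cd_zero_cst F a b : a <= b -> (forall x, a <= x <= b -> cd F x 0) -> F a = F b.
Proof.
move=> ab h; apply: ceq.
  by apply: (rd_zero_cst (f := fun t => Re (F t)) _ ab) => x /h [].
by apply: (rd_zero_cst (f := fun t => Im (F t)) _ ab) => x /h [].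
Qed.

End ComplexBasics.

(** Differentiates an explicit expression and leaves the derivative it finds to be compared through
    [rd_eq]. The clauses without a bound variable catch expressions in eta-reduced form. *)
Ltac rder := rewrite /=; repeat first
  [ match goal with
    | |- rd (fun=> ?c) _ _ => eapply rd_cst
    | |- rd ( *%R _) _ _ => eapply rd_mull
    | |- rd (+%R _) _ _ => eapply rd_addl
    | |- rd -%R _ _ => eapply rd_opp
    | |- rd (fun t => t) _ _ => eapply rd_id
    | |- rd (fun t => _ + - _) _ _ => eapply rdB
    | |- rd (fun t => _ + _) _ _ => eapply rdD
    | |- rd (fun t => - _) _ _ => eapply rdN
    | |- rd (fun t => _ * _) _ _ => eapply rdM
    | |- rd (fun t => _ ^+ _) _ _ => eapply rdX
    | |- rd (fun t => expR _) _ _ => eapply rd_expR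
    | |- rd (fun t => sin _) _ _ => eapply rd_sin
    | |- rd (fun t => cos _) _ _ => eapply rd_cos
    | |- rd (fun t => atan _) _ _ => eapply rd_atan
    | |- rd (fun t => ln _) _ _ => eapply rd_ln
    | |- rd (fun t => _ `^ _) _ _ => eapply rd_powR
    | |- rd (fun t => (_)^-1) _ _ => eapply rdV
    end | eassumption ].

(** * Linear differential equations *)

Section LinearODE.
Context {R : realType}.
Implicit Types (F G : R -> R[i]) (f g : R -> R) (x t : R).

Lemma le_of_eq (x y : R) : x = y -> x <= y.
Proof. by move=> ->. Qed.

Lemma antiderivative_right f (M : R) : continuous f -> 0 < M ->
  exists2 G : R -> R, G 0 = 0 & forall x, - M < x -> rd G x (f x).
Proof.
move=> cf M0; pose H x := \int[lebesgue_measure]_(t in `[- M, x]) f t.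
exists (fun x => H x - H 0); first by rewrite subrr.
move=> x Mx.
have [] := @continuous_FTC1_closed R f (- M) x (x + 1).
- by rewrite ltrDl.
- apply: continuous_compact_integrable; first exact: segment_compact.
  exact: continuous_subspaceT.
- exact: Mx.
- exact: cf.
move=> /derivable_rd dH e; rewrite e in dH.
by apply: rd_eq (rdB dH (rd_cst (H 0) x)) _; rewrite subr0.
Qed.

(** The integral from [- M] is a primitive only to the right of [- M]. Primitives for different [M],
    normalised at 0, agree where both are defined, so using [M = |x| + 1] at the point [x] glues
    them into one function. *)
Lemma antiderivative f : continuous f ->
  exists2 F : R -> R, F 0 = 0 & forall x, rd F x (f x).
Proof.
move=> cf.
have /choice [G hG] (M : R) : exists G : R -> R, 0 < M ->
    G 0 = 0 /\ forall x, - M < x -> rd G x (f x).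
  have [M0|M0] := ltP 0 M; last by exists (fun=> 0).
  by have [G G0 hG] := antiderivative_right cf M0; exists G.
have pos x : 0 < `|x| + 1 by rewrite ltr_wpDl.
exists (fun x => G (`|x| + 1) x).
  by have [] := hG _ (pos 0).
move=> x0; set M := `|x0| + 2.
have M0 : 0 < M by rewrite /M ltr_wpDl.
have [GM0 hGM] := hG M M0.
apply/rdP; apply: (@near_eq_is_derive R R R (G M)); last first.
- apply/rdP/hGM.  by have := ler_norm (- x0); rewrite normrN /M; lra.
- near=> x.
have xx : `|x - x0| < 1 by rewrite distrC; near: x; exact: cvgr_dist_lt.
have xM : `|x| + 1 <= M.
  rewrite /M; have := ler_normD (x - x0) x0; rewrite subrK; lra.
have [Gx0 hGx] := hG _ (pos x).
have h y : - (`|x| + 1) < y -> rd (fun t => G M t - G (`|x| + 1) t) y 0.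
  move=> hy; rewrite -(subrr (f y)); apply: rdB; last exact: hGx.
  by apply: hGM; apply: le_lt_trans hy; rewrite lerN2.
have [x_ge0|x_lt0] := leP 0 x.
  have := @rd_zero_cst _ (fun t => G M t - G (`|x| + 1) t) 0 x.
  move=> /(_ _ x_ge0); rewrite GM0 Gx0 subrr => e.
  apply/eqP; rewrite -subr_eq0 -e // => y /andP[y0 _]; apply: h.
  by have := pos x; lra.
have := @rd_zero_cst _ (fun t => G M t - G (`|x| + 1) t) x 0.
move=> /(_ _ (ltW x_lt0)); rewrite GM0 Gx0 subrr => e.
apply/eqP; rewrite -subr_eq0 e // => y /andP[y0 _]; apply: h.
by have := ler_norm (- x); rewrite normrN; lra.
Unshelve. all: by end_near. Qed.

Definition cc F := continuous (fun t => Re (F t)) /\ continuous (fun t => Im (F t)).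

Lemma cd_cc F (dF : R -> R[i]) : (forall x, cd F x (dF x)) -> cc F.
Proof. by move=> h; split => x; [apply: cd_contRe|apply: cd_contIm]; exact: h. Qed.

Lemma ccM F G : cc F -> cc G -> cc (fun t => F t * G t).
Proof.
move=> [a b] [c d]; split.
  under eq_fun do rewrite cE.
  by move=> x; apply: cvgB; apply: cvgM; [exact: a|exact: c|exact: b|exact: d].
under eq_fun do rewrite cE.
by move=> x; apply: cvgD; apply: cvgM; [exact: a|exact: d|exact: b|exact: c].
Qed.

Lemma cc_cst (c : R[i]) : cc (fun=> c).
Proof. by split => x; exact: cvg_cst. Qed.

Lemma antiderivativeC F : cc F ->
  exists2 G : R -> R[i], G 0 = 0 & forall x, cd G x (F x).
Proof.
move=> [/antiderivative [f f0 hf] /antiderivative [g g0 hg]].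
exists (fun t => f t +i* g t) => [|x]; last by split; [exact: hf|exact: hg].
by rewrite f0 g0.
Qed.

Lemma cd_mvt_sym F (dF : R -> R[i]) (g dg : R -> R) : F 0 = 0 ->
  (forall x, cd F x (dF x)) ->
  (forall x, 0 <= x -> rd g x (dg x)) ->
  (forall x, nc (dF x) <= dg `|x|) ->
  forall t, nc (F t) <= g `|t| - g 0.
Proof.
move=> F0 hF hg h t; have [t0|t0] := leP 0 t.
  have := @cd_mvt _ F dF g dg 0 t t0; rewrite F0 subr0 (ger0_norm t0); apply => //.
    by move=> x /andP[x0 _]; exact: hg.
  by move=> x /andP[x0 _]; have := h x; rewrite (ger0_norm x0).
have t1 : 0 <= - t by rewrite oppr_ge0 ltW.
have := @cd_mvt _ (fun s => F (- s)) (fun s => dF (- s) * (-1)%:C) g dg 0 (- t) t1.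
rewrite opprK oppr0 F0 subr0 (ltr0_norm t0); apply => //.
- by move=> x _; apply: (@cd_comp _ F) (hF _); apply: rd_eq (rdN (rd_id x)) _.
- by move=> x /andP[x0 _]; exact: hg.
- move=> x /andP[x0 _]; rewrite ncM ncC normrN normr1 mulr1.
  by have := h (- x); rewrite normrN (ger0_norm x0).
Qed.

(** The intervals of radius [2 c / 2^n] about [u n] are nested, so the supremum of their left ends
    lies in all of them; the rate comes together with the limit. *)
Lemma geometric_limit (u : nat -> R) (c : R) :
  (forall n, `|u n.+1 - u n| <= c / 2 ^+ n) ->
  exists l : R, forall n, `|u n - l| <= 2 * c / 2 ^+ n.
Proof.
move=> h; pose a n := u n - 2 * c / 2 ^+ n; pose b n := u n + 2 * c / 2 ^+ n.
have half n : c / 2 ^+ n = 2 * c / 2 ^+ n.+1.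
  by rewrite exprS invfM; field; rewrite expf_neq0.
have dbl n : 2 * c / 2 ^+ n = 2 * (2 * c / 2 ^+ n.+1) by rewrite -half mulrA.
have aS n : a n <= a n.+1.
  by have := h n; rewrite /a (dbl n) (half n) ler_norml; lra.
have bS n : b n.+1 <= b n.
  by have := h n; rewrite /b (dbl n) (half n) ler_norml; lra.
have c0 : 0 <= c by have := le_trans (normr_ge0 _) (h 0); rewrite expr0 divr1.
have ab n : a n <= b n.
  have : 0 <= 2 * c / 2 ^+ n by rewrite divr_ge0 ?mulr_ge0 ?exprn_ge0.
  by rewrite /a /b; lra.
have amono : {homo a : m n / (m <= n)%N >-> m <= n} by exact/nondecreasing_seqP.
have bmono : {homo b : m n / (m <= n)%N >-> n <= m}
  by exact/nonincreasing_seqP.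
have abmn m n : a m <= b n.
  apply: le_trans (amono _ (maxn m n) (leq_maxl _ _)) _.
  exact: le_trans (ab _) (bmono _ _ (leq_maxr _ _)).
exists (sup (range a)) => n.
have l1 : a n <= sup (range a).
  by apply: ub_le_sup; [exists (b 0) => _ [m _ <-]; exact: abmn|exists n].
have l2 : sup (range a) <= b n.
  by apply: ge_sup; [exists (a 0); exists 0%N|move=> _ [m _ <-]; exact: abmn].
by move: l1 l2; rewrite /a /b ler_norml; lra.
Qed.

Lemma geometric_limitC (u : nat -> R[i]) (c : R) :
  (forall n, nc (u n.+1 - u n) <= c / 2 ^+ n) ->
  exists l : R[i], forall n, nc (u n - l) <= 4 * c / 2 ^+ n.
Proof.
move=> h.
have [l1 h1] : exists l : R, forall n, `|Re (u n) - l| <= 2 * c / 2 ^+ n.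
  apply: geometric_limit => n; rewrite -ReN -ReD; exact: le_trans (Re_le_nc _) (h n).
have [l2 h2] : exists l : R, forall n, `|Im (u n) - l| <= 2 * c / 2 ^+ n.
  apply: geometric_limit => n; rewrite -ImN -ImD; exact: le_trans (Im_le_nc _) (h n).
exists (l1 +i* l2) => n; apply: le_trans (nc_le_ReIm _) _; rewrite !cE.
by have := h1 n; have := h2 n; lra.
Qed.

Lemma exists_pow2_lt (c e : R) : 0 < e -> exists n, c / 2 ^+ n < e.
Proof.
move=> e0; have [n hn] : exists n : nat, c / e < n%:R.
  exists (Num.bound `|c / e|); apply: le_lt_trans (ler_norm _) _.
  by apply: archi_boundP; exact: normr_ge0.
exists n; rewrite ltr_pdivrMr ?exprn_gt0 // mulrC -ltr_pdivrMr //.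
apply: lt_le_trans hn _.
by rewrite -natrX ler_nat ltnW // ltn_expl.
Qed.

Lemma eq_of_pow2_bound (z w : R[i]) (c : R) :
  (forall n, nc (z - w) <= c / 2 ^+ n) -> z = w.
Proof.
move=> h; apply/eqP; rewrite -subr_eq0 -nc_eq0 eq_le nc_ge0 andbT leNgt.
apply/negP => /(exists_pow2_lt c) [n hn].
by have := le_lt_trans (h n) hn; rewrite ltxx.
Qed.

(** Convergence is only locally uniform: since [B] is monotone, its value at [|x0| + 1] serves for a
    whole neighbourhood of [x0]. *)
Lemma uniform_limit_cc (y : nat -> R -> R[i]) w (B : R -> R) :
  {homo B : s t / s <= t} ->
  (forall n, cc (y n)) ->
  (forall n t, nc (y n t - w t) <= B `|t| / 2 ^+ n) -> cc w.
Proof.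
move=> Bmono cy h.
have main (P : R[i] -> R) : (forall z w, `|P z - P w| <= nc (z - w)) ->
    (forall n, continuous (fun t => P (y n t))) -> continuous (fun t => P (w t)).
  move=> Plip cP x0; apply/cvgrPdist_lt => e e0.
  have e3 : 0 < e / 3 by rewrite divr_gt0.
  have [n hn] := exists_pow2_lt (B (`|x0| + 1)) e3.
  have cn : \forall x \near x0, `|P (y n x0) - P (y n x)| < e / 3.
    by move: (cP n x0) => /cvgrPdist_lt; exact.
  near=> x.
  have xx : `|x - x0| < 1 by rewrite distrC; near: x; exact: cvgr_dist_lt.
  have bnd z : `|z| <= `|x0| + 1 -> `|P (y n z) - P (w z)| < e / 3.
    move=> hz; apply: le_lt_trans hn; apply: le_trans (Plip _ _) _.
    by apply: le_trans (h n z) _; rewrite ler_pM2r ?invr_gt0 ?exprn_gt0 // Bmono.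
  have h1 : `|P (y n x0) - P (w x0)| < e / 3 by apply: bnd; rewrite lerDl.
  have h2 : `|P (y n x) - P (w x)| < e / 3.
    by apply: bnd; have := ler_normD (x - x0) x0; rewrite subrK; lra.
  have h3 : `|P (y n x0) - P (y n x)| < e / 3 by near: x; exact: cn.
  by move: h1 h2 h3; rewrite !ltr_norml; lra.
split; apply: main.
- by move=> z z'; rewrite -ReN -ReD Re_le_nc.
- by move=> n; have [] := cy n.
- by move=> z z'; rewrite -ImN -ImD Im_le_nc.
- by move=> n; have [] := cy n.
Unshelve. all: by end_near. Qed.

(* Picard iteration; in the weight [exp (L |t|)] with [L' >= 2 max(1,|q|)] each
   step halves the distance. *)
Lemma linear_ode (q : R -> R[i]) (K : R) (a b : R[i]) : 1 <= K -> cc q ->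
  (forall t, nc (q t) <= t ^+ 2 + K) ->
  exists w w1 : R -> R[i], [/\ w 0 = a, w1 0 = b,
    forall t, cd w t (w1 t) & forall t, cd w1 t (q t * w t)].
Proof.
move=> K1 cq hq.
have /choice [A hA] (F : R -> R[i]) : exists G : R -> R[i], cc F ->
    G 0 = 0 /\ forall x, cd G x (F x).
  have [/antiderivativeC [G G0 hG]|nF] := pselect (cc F); first by exists G.
  by exists F.
pose T (y : (R -> R[i]) * (R -> R[i])) : (R -> R[i]) * (R -> R[i]) :=
  (fun t => a + A y.2 t, fun t => b + A (fun s => q s * y.1 s) t).
pose y n := iter n T (fun=> 0, fun=> 0).
have Tcd u : cc u.1 -> cc u.2 -> [/\ (T u).1 0 = a, (T u).2 0 = b,
    forall t, cd (T u).1 t (u.2 t) & forall t, cd (T u).2 t (q t * u.1 t)].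
  move=> c1 c2; have [A0 hA0] := hA _ c2; have [A1 hA1] := hA _ (ccM cq c1).
  rewrite /T /=; split; rewrite ?A0 ?A1 ?addr0 // => t.
    by apply: cd_eq (cdD (cd_cst a t) (hA0 t)) _; rewrite add0r.
  by apply: cd_eq (cdD (cd_cst b t) (hA1 t)) _; rewrite add0r.
have ycc n : cc (y n).1 /\ cc (y n).2.
  elim: n => [|n [c1 c2]]; first by split; exact: cc_cst.
  by have [_ _ d1 d2] := Tcd _ c1 c2; split; [exact: cd_cc d1|exact: cd_cc d2].
pose L (s : R) := 2 * (s ^+ 3 / 3 + K * s).
pose E s := expR (L s).
have dE s : rd E s (2 * (s ^+ 2 + K) * E s).
  rewrite /E /L; apply: rd_eq; first by rder.
  by rewrite /=; field.
have E0 s : 0 < E s by exact: expR_gt0.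
have EE s : E s <= 1 / 2 * (2 * (s ^+ 2 + K) * E s).
  by have := E0 s; have := sqr_ge0 s => h1 h2; nra.
have step (F : R -> R[i]) dF c : 0 <= c -> F 0 = 0 -> (forall x, cd F x (dF x)) ->
    (forall x, nc (dF x) <= (x ^+ 2 + K) * (c * E `|x|)) ->
    forall t, nc (F t) <= c / 2 * E `|t|.
  move=> c0 F0 hF hb t.
  have := @cd_mvt_sym F dF (fun s => c / 2 * E s)
    (fun s => c / 2 * (2 * (s ^+ 2 + K) * E s)) F0 hF.
  move=> /(_ _ _ t) h; apply: le_trans (h _ _) _.
  - by move=> x _; apply: rd_eq (rdM (rd_cst _ x) (dE x)) _; rewrite mul0r add0r.
  - move=> x; apply: le_trans (hb x) _; rewrite real_normK ?num_real //.
    by apply: le_of_eq; field.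
  - by rewrite gerBl mulr_ge0 ?(ltW (E0 _)) // divr_ge0.
pose C := nc a + nc b.
have C0 : 0 <= C by rewrite addr_ge0 ?nc_ge0.
have sqK x : 1 <= x ^+ 2 + K by have := sqr_ge0 x; lra.
have diff n t : nc ((y n.+1).1 t - (y n).1 t) <= C / 2 ^+ n * E `|t| /\
                nc ((y n.+1).2 t - (y n).2 t) <= C / 2 ^+ n * E `|t|.
  elim: n t => [|n ih] t.
    have [[c1 c2] [A0 hA0]] := (ycc 0%N, hA _ (ycc 0%N).2).
    have [A1 hA1] := hA _ (ccM cq c1).
    have E1 : 1 <= E `|t|.
      rewrite /E -expR0 ler_expR /L mulr_ge0 // addr_ge0 ?mulr_ge0 ?exprn_ge0 //.
      by lra.
    have z1 : A (y 0%N).2 t = 0.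
      apply/eqP; rewrite -nc_eq0 eq_le nc_ge0 andbT.
      apply: le_trans (step _ _ 0 (lexx _) A0 hA0 _ t) _; last by rewrite !mul0r.
      by move=> x; rewrite mul0r mulr0 nc0.
    have z2 : A (fun s => q s * (y 0%N).1 s) t = 0.
      apply/eqP; rewrite -nc_eq0 eq_le nc_ge0 andbT.
      apply: le_trans (step _ _ 0 (lexx _) A1 hA1 _ t) _; last by rewrite !mul0r.
      by move=> x; rewrite mul0r mulr0 mulr0 nc0.
    rewrite {1 3}/y /= !subr0; move: z1 z2; rewrite /y /= => -> ->.
    rewrite !addr0 expr0 divr1; split.
      apply: (@le_trans _ _ (C * 1)); last by rewrite ler_wpM2l.
      by rewrite mulr1 /C lerDl nc_ge0.
    apply: (@le_trans _ _ (C * 1)); last by rewrite ler_wpM2l.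
    by rewrite mulr1 /C lerDr nc_ge0.
  have [[c1 c2] [c3 c4]] := (ycc n, ycc n.+1).
  have [e1 e2 d1 d2] := Tcd _ c1 c2; have [e3 e4 d3 d4] := Tcd _ c3 c4.
  have cn0 : 0 <= C / 2 ^+ n by rewrite divr_ge0 ?exprn_ge0.
  have -> : C / 2 ^+ n.+1 = C / 2 ^+ n / 2 by rewrite exprS; field; rewrite expf_neq0.
  split.
    apply: (step (fun t => (y n.+2).1 t - (y n.+1).1 t)
      (fun t => (y n.+1).2 t - (y n).2 t)) => //.
    - by rewrite e3 e1 subrr.
    - by move=> x; apply: cdB.
    - move=> x; have [_ h] := ih x; apply: le_trans h _.
      by rewrite ler_peMl // mulr_ge0 // ltW.
  apply: (step (fun t => (y n.+2).2 t - (y n.+1).2 t)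
      (fun t => q t * ((y n.+1).1 t - (y n).1 t))) => //.
  - by rewrite e4 e2 subrr.
  - by move=> x; rewrite mulrBr; apply: cdB.
  - move=> x; have [h _] := ih x; rewrite ncM.
    by apply: ler_pM; rewrite ?nc_ge0.
have /choice [w hw] t : exists l : R[i], forall n, nc ((y n).1 t - l) <= 4 * C * E `|t| / 2 ^+ n.
  have [|l hl] := @geometric_limitC (fun n => (y n).1 t) (C * E `|t|).
    by move=> n; have [h _] := diff n t; rewrite mulrAC.
  by exists l => n; have := hl n; rewrite mulrA.
have /choice [w1 hw1] t : exists l : R[i], forall n, nc ((y n).2 t - l) <= 4 * C * E `|t| / 2 ^+ n.
  have [|l hl] := @geometric_limitC (fun n => (y n).2 t) (C * E `|t|).
    by move=> n; have [_ h] := diff n t; rewrite mulrAC.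
  by exists l => n; have := hl n; rewrite mulrA.
have Emono : {homo (fun s => 4 * C * E s) : s t / s <= t}.
  move=> s t st; rewrite ler_wpM2l ?mulr_ge0 //.
  apply: (rd_incr st (df := fun s => 2 * (s ^+ 2 + K) * E s)) => // x _.
  by rewrite mulr_ge0 ?(ltW (E0 _)) // mulr_ge0 //; have := sqK x; lra.
have cw : cc w by apply: (@uniform_limit_cc (fun n => (y n).1) w _ Emono) => // n; have [] := ycc n.
have cw1 : cc w1 by apply: (@uniform_limit_cc (fun n => (y n).2) w1 _ Emono) => // n; have [] := ycc n.
have [e1 e2 d1 d2] := Tcd (w, w1) cw cw1.
have C40 n : 0 <= 4 * C / 2 ^+ n by rewrite divr_ge0 ?exprn_ge0 // mulr_ge0.
(* So far the limit is only known to be continuous. It is differentiable because it coincides with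
   the integral [T (w, w1)], both being limits of the iterates. *)
have wE t : w t = (T (w, w1)).1 t.
  apply: (@eq_of_pow2_bound _ _ (4 * C * E `|t| * 2)) => n.
  have [c1 c2] := ycc n; have [e3 e4 d3 d4] := Tcd _ c1 c2.
  have h1 : nc ((y n.+1).1 t - (T (w, w1)).1 t) <= 4 * C / 2 ^+ n / 2 * E `|t|.
    apply: (step (fun t => (y n.+1).1 t - (T (w, w1)).1 t)
      (fun t => (y n).2 t - w1 t)) => //.
    - by rewrite e3 e1 subrr.
    - by move=> x; apply: cdB; [exact: d3|exact: d1].
    - move=> x; apply: (@le_trans _ _ (4 * C / 2 ^+ n * E `|x|)).
        by have := hw1 x n; rewrite mulrAC.
      by rewrite ler_peMl // mulr_ge0 // ltW.
  have h2 := hw t n.+1.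
  have -> : w t - (T (w, w1)).1 t =
    - ((y n.+1).1 t - w t) + ((y n.+1).1 t - (T (w, w1)).1 t) by ring.
  apply: le_trans (ncD _ _) _; rewrite ncN.
  have : 0 <= 4 * C / 2 ^+ n * E `|t| by rewrite mulr_ge0 // ltW.
  have -> : 4 * C * E `|t| * 2 / 2 ^+ n = 2 * (4 * C / 2 ^+ n * E `|t|) by ring.
  move: h2; have -> : 4 * C * E `|t| / 2 ^+ n.+1 = 1 / 2 * (4 * C / 2 ^+ n * E `|t|).
    by rewrite exprS; field; rewrite expf_neq0.
  have e5 : 4 * C / 2 ^+ n / 2 * E `|t| = 1 / 2 * (4 * C / 2 ^+ n * E `|t|).
    by field; rewrite expf_neq0.
  by rewrite e5 in h1; lra.
have w1E t : w1 t = (T (w, w1)).2 t.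
  apply: (@eq_of_pow2_bound _ _ (4 * C * E `|t| * 2)) => n.
  have [c1 c2] := ycc n; have [e3 e4 d3 d4] := Tcd _ c1 c2.
  have h1 : nc ((y n.+1).2 t - (T (w, w1)).2 t) <= 4 * C / 2 ^+ n / 2 * E `|t|.
    apply: (step (fun t => (y n.+1).2 t - (T (w, w1)).2 t)
      (fun t => q t * ((y n).1 t - w t))) => //.
    - by rewrite e4 e2 subrr.
    - by move=> x; rewrite mulrBr; apply: cdB; [exact: d4|exact: d2].
    - move=> x; rewrite ncM; apply: ler_pM; rewrite ?nc_ge0 //.
      by have := hw x n; rewrite mulrAC.
  have h2 := hw1 t n.+1.
  have -> : w1 t - (T (w, w1)).2 t =
    - ((y n.+1).2 t - w1 t) + ((y n.+1).2 t - (T (w, w1)).2 t) by ring.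
  apply: le_trans (ncD _ _) _; rewrite ncN.
  have : 0 <= 4 * C / 2 ^+ n * E `|t| by rewrite mulr_ge0 // ltW.
  have -> : 4 * C * E `|t| * 2 / 2 ^+ n = 2 * (4 * C / 2 ^+ n * E `|t|) by ring.
  move: h2; have -> : 4 * C * E `|t| / 2 ^+ n.+1 = 1 / 2 * (4 * C / 2 ^+ n * E `|t|).
    by rewrite exprS; field; rewrite expf_neq0.
  have e5 : 4 * C / 2 ^+ n / 2 * E `|t| = 1 / 2 * (4 * C / 2 ^+ n * E `|t|).
    by field; rewrite expf_neq0.
  by rewrite e5 in h1; lra.
exists (T (w, w1)).1, (T (w, w1)).2; split => // t.
  by rewrite -w1E; exact: d1.
by rewrite -wE; exact: d2.
Qed.

Lemma gronwall (N dN : R -> R) (K a b : R) : a <= b ->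
  (forall t, a <= t <= b -> rd N t (dN t)) ->
  (forall t, a <= t <= b -> dN t <= K * N t) ->
  N b <= N a * expR (K * (b - a)).
Proof.
move=> ab hN h.
have : N b * expR (- (K * (b - a))) <= N a * expR (- (K * (a - a))).
  rewrite -lerN2.
  apply: (@rd_incr _ (fun t => - (N t * expR (- (K * (t - a)))))
    (fun t => (K * N t - dN t) * expR (- (K * (t - a)))) a b ab) => t /[dup] ht /hN d.
    by apply: rd_eq; [rder|cbv beta; ring].
  by rewrite mulr_ge0 ?expR_ge0 // subr_ge0 h.
rewrite subrr mulr0 oppr0 expR0 mulr1 expRN.
by rewrite ler_pdivrMr ?expR_gt0.
Qed.

(** Gronwall for [|Y|^2 + |Y1|^2 + d^2], where the term [d^2] absorbs the remainder and makes the
    inequality homogeneous. The conclusion is linear in [d]: [d = 0] yields uniqueness, and [d] of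
    order [h^2] yields differentiability in a parameter. *)
Lemma ode_stability (Y Y1 q r : R -> R[i]) (K d T : R) : 0 <= K -> 0 <= d -> 0 <= T ->
  (forall t, 0 <= t <= T -> cd Y t (Y1 t)) ->
  (forall t, 0 <= t <= T -> cd Y1 t (q t * Y t + r t)) ->
  (forall t, 0 <= t <= T -> nc (q t) <= K) ->
  (forall t, 0 <= t <= T -> nc (r t) <= d) ->
  nc (Y 0) <= d -> nc (Y1 0) <= d ->
  nc (Y T) <= 2 * d * expR ((2 + K) * T) /\ nc (Y1 T) <= 2 * d * expR ((2 + K) * T).
Proof.
move=> K0 d0 T0 hY hY1 hq hr Y0 Y10.
pose N t := nc (Y t) ^+ 2 + nc (Y1 t) ^+ 2 + d ^+ 2.
have hN : N T <= N 0 * expR ((2 + K) * (T - 0)).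
  apply: (@gronwall N (fun t => 2 * Re ((Y t)^* * Y1 t) +
    2 * Re ((Y1 t)^* * (q t * Y t + r t)))) => // t ht.
    apply: rd_eq.
      by apply: rdD; [apply: rdD; apply: cd_nc2; [exact: hY|exact: hY1]|exact: rd_cst].
    by rewrite addr0.
  rewrite mulrDr ReD.
  have h1 := ReJM (Y t) (Y1 t).
  have h2 := le_trans (ReJM (Y1 t) (q t * Y t)) (ler_wpM2l (nc_ge0 _) (_ : _ <= K * nc (Y t))).
  have h3 := le_trans (ReJM (Y1 t) (r t)) (ler_wpM2l (nc_ge0 _) (hr t ht)).
  have {}h2 := h2 _.
  have := nc_ge0 (Y t); have := nc_ge0 (Y1 t); rewrite /N.
  have h4 : nc (q t * Y t) <= K * nc (Y t) by rewrite ncM ler_wpM2r ?nc_ge0 // hq.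
  have {}h2 := h2 h4.
  move: h1 h2 h3; set p := nc (Y t); set p1 := nc (Y1 t) => h1 h2 h3 p10 p0.
  have s1 := sqr_ge0 (p - p1); have s2 := sqr_ge0 (p1 - d).
  have s3 : 0 <= K * (p - p1) ^+ 2 by rewrite mulr_ge0.
  have s4 : 0 <= K * d ^+ 2 by rewrite mulr_ge0 ?sqr_ge0.
  have s5 : 0 <= K * (p1 ^+ 2 + p ^+ 2) by rewrite mulr_ge0 ?addr_ge0 ?sqr_ge0.
  have s6 := sqr_ge0 p; have s7 := sqr_ge0 p1; have s8 := sqr_ge0 d.
  nra.
rewrite subr0 in hN; set e := expR _ in hN *.
have e1 : 1 <= e by rewrite /e -expR0 ler_expR mulr_ge0 // addr_ge0.
have N0 : N 0 <= 3 * d ^+ 2.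
  have := nc_ge0 (Y 0); have := nc_ge0 (Y1 0); rewrite /N; nra.
have NT : N T <= (2 * d * e) ^+ 2.
  apply: le_trans hN _; apply: (@le_trans _ _ (3 * d ^+ 2 * e)).
    by rewrite ler_wpM2r // (le_trans ler01).
  have := sqr_ge0 d; rewrite !exprMn => d2.
  have -> : 2 ^+ 2 * d ^+ 2 * e ^+ 2 = 4 * d ^+ 2 * e * e :> R by ring.
  have : 0 <= d ^+ 2 * e by rewrite mulr_ge0 // (le_trans ler01 e1).
  by nra.
have de0 : 0 <= 2 * d * e by rewrite mulr_ge0 ?mulr_ge0 // (le_trans ler01).
have s6 := sqr_ge0 (nc (Y T)); have s7 := sqr_ge0 (nc (Y1 T)); have s8 := sqr_ge0 d.
by rewrite -!(@ler_pXn2r _ 2 _ _ (2 * d * e)) ?nnegrE ?nc_ge0 //; move: NT; rewrite /N; lra.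
Qed.

End LinearODE.

(** * The equation on rotated rays *)

Section Calculus.
Context {R : realType}.
Implicit Types (F G : R -> R[i]) (f g : R -> R) (x t : R).

Lemma cd_lip F (dF : R -> R[i]) (C l u : R) :
  (forall x, l <= x <= u -> cd F x (dF x)) ->
  (forall x, l <= x <= u -> nc (dF x) <= C) ->
  forall a b, l <= a <= u -> l <= b <= u -> nc (F b - F a) <= C * `|b - a|.
Proof.
move=> hF hC.
have main a b : l <= a -> b <= u -> a <= b -> nc (F b - F a) <= C * `|b - a|.
  move=> la bu ab; have := @cd_mvt _ F dF (fun t => C * t) (fun=> C) a b ab.
  rewrite ger0_norm ?subr_ge0 // mulrBr; apply.
  - by move=> x /andP[ax xb]; apply: hF; rewrite (le_trans la) // (le_trans xb).
  - by move=> x _; exact: rd_mull.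
  - by move=> x /andP[ax xb]; apply: hC; rewrite (le_trans la) // (le_trans xb).
move=> a b /andP[la au] /andP[lb bu].
have [ab|/ltW ba] := leP a b; first exact: main.
by rewrite -ncN opprB distrC; exact: main.
Qed.

(** The Lipschitz estimate for [F s - s F1(a)] between [a] and [b], where its derivative is at most
    [C |b - a|]. *)
Lemma cd_taylor F (F1 F2 : R -> R[i]) (C l u : R) :
  (forall x, l <= x <= u -> cd F x (F1 x)) ->
  (forall x, l <= x <= u -> cd F1 x (F2 x)) ->
  (forall x, l <= x <= u -> nc (F2 x) <= C) ->
  forall a b, l <= a <= u -> l <= b <= u ->
  nc (F b - F a - (b - a)%:C * F1 a) <= C * (b - a) ^+ 2.
Proof.
move=> h1 h2 hC a b /andP[la au] /andP[lb bu].
have lip := cd_lip h2 hC.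
pose m := Num.min a b; pose M := Num.max a b.
have ma : m <= a by rewrite /m ge_min lexx.
have mb : m <= b by rewrite /m ge_min lexx orbT.
have Ma : a <= M by rewrite /M le_max lexx.
have Mb : b <= M by rewrite /M le_max lexx orbT.
have lm : l <= m by rewrite /m le_min la.
have Mu : M <= u by rewrite /M ge_max au.
have C0 : 0 <= C by apply: le_trans (nc_ge0 (F2 a)) (hC a _); rewrite la.
have := @cd_lip (fun s => F s - s%:C * F1 a) (fun s => F1 s - F1 a)
  (C * `|b - a|) m M.
move=> /(_ _ _ a b); rewrite ma mb Ma Mb => h.
have -> : F b - F a - (b - a)%:C * F1 a = F b - b%:C * F1 a - (F a - a%:C * F1 a).
  by rewrite realCD realCN; ring.
rewrite -real_normK ?num_real // expr2 mulrA; apply: h => // x /andP[mx xM].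
  apply: cdB; first by apply: h1; rewrite (le_trans lm) // (le_trans xM).
  by apply: cd_eq; [apply: cdM; [apply: cd_real; exact: rd_id|exact: cd_cst]|rewrite mulr0 addr0 mul1r].
have lx : l <= x <= u by rewrite (le_trans lm) // (le_trans xM).
have la' : l <= a <= u by rewrite la.
apply: le_trans (lip a x la' lx) _; rewrite ler_wpM2l //.
move: mx xM; rewrite /m /M; case: (leP a b) => ab mx xM.
  by rewrite !ger0_norm ?subr_ge0 // lerD2r.
by rewrite !ler0_norm ?subr_le0 ?(ltW ab) // lerN2 lerD2r.
Qed.

Lemma rd_of_quadratic f x l (C d : R) : 0 < d ->
  (forall h, `|h| <= d -> `|f (x + h) - f x - h * l| <= C * h ^+ 2) -> rd f x l.
Proof.
move=> d0 hf.
have cv : h^-1 *: (f (h *: (1 : R) + x) - f x) @[h --> (0 : R)^'] --> l.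
  apply/cvgrPdist_le => e e0.
  have C1 : 0 < `|C| + 1 by rewrite ltr_wpDl.
  near=> h.
  have h0 : h != 0 by near: h; exact: nbhs_dnbhs_neq.
  have hd : `|h| <= d.
    near: h; apply: dnbhs0_le => //.
  have he : `|h| <= e / (`|C| + 1).
    by near: h; apply: dnbhs0_le; rewrite divr_gt0.
  have := hf h hd; rewrite /GRing.scale/= mulr1 [h + x]addrC => k.
  have -> : l - h^-1 * (f (x + h) - f x) = - (h^-1 * (f (x + h) - f x - h * l)).
    by field.
  rewrite normrN normrM normfV ler_pdivrMl ?normr_gt0 //.
  apply: le_trans k _; apply: (@le_trans _ _ (`|C| * `|h| ^+ 2)).
    by rewrite real_normK ?num_real // ler_wpM2r ?sqr_ge0 // ler_norm.
  rewrite expr2 mulrCA ler_wpM2l //.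
  by move: he; rewrite ler_pdivlMr //; have := normr_ge0 h; nra.
split; first by apply/cvg_ex; exists l.
by rewrite derive1E; apply/cvg_lim.
Unshelve. all: by end_near. Qed.

Lemma cd_of_quadratic F x (l : R[i]) (C d : R) : 0 < d ->
  (forall h, `|h| <= d -> nc (F (x + h) - F x - h%:C * l) <= C * h ^+ 2) -> cd F x l.
Proof.
move=> d0 hF; split; apply: (rd_of_quadratic d0) => h /hF; apply: le_trans.
  by have := Re_le_nc (F (x + h) - F x - h%:C * l); rewrite !cE mul0r subr0.
by have := Im_le_nc (F (x + h) - F x - h%:C * l); rewrite !cE mul0r addr0.
Qed.

Definition cis x : R[i] := cos x +i* sin x.

Lemma cis0 : cis 0 = 1.
Proof. by rewrite /cis cos0 sin0. Qed.

Lemma nc_cis x : nc (cis x) = 1.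
Proof. by rewrite ncE /= cos2Dsin2 sqrtr1. Qed.

Lemma cis_neq0 x : cis x != 0.
Proof. by rewrite -nc_eq0 nc_cis oner_eq0. Qed.

Lemma cd_cis f x l : rd f x l -> cd (fun t => cis (f t)) x ('i * cis (f x) * l%:C).
Proof.
move=> h; split.
  by apply: rd_eq (rd_cos h) _; rewrite !cE; ring.
by apply: rd_eq (rd_sin h) _; rewrite !cE; ring.
Qed.

Lemma cos_ge_half x : `|x| <= 1 / 2 -> 1 / 2 <= cos x.
Proof.
wlog x0 : x / 0 <= x => [hw|] hx.
  have [x0|x0] := leP 0 x; first exact: hw.
  by rewrite -cosN; apply: hw; rewrite ?normrN // oppr_ge0 ltW.
have := @rd_le_incr _ (fun t => - t) (fun t => cos t) (fun=> -1) (fun t => - sin t) 0 x x0.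
rewrite cos0 => h; have : - x - - 0 <= cos x - 1.
  apply: h => t _; first exact: rd_opp.
    by apply: rd_eq (rd_cos (rd_id t)) _; rewrite mulr1.
  by rewrite lerN2 sin_le1.
by rewrite ger0_norm // in hx; lra.
Qed.

(* Principal branch of [s ^ (- k / 2)] on the right half-plane. *)
Definition cpw (k : R) (s : R[i]) : R[i] :=
  (expR (- (k / 4) * ln (nc s ^+ 2)))%:C * cis (- (k / 2) * atan (Im s / Re s)).

Lemma cd_cpw k F x (l : R[i]) : 0 < Re (F x) -> cd F x l ->
  cd (fun t => cpw k (F t)) x (- (k / 2)%:C * (l / F x) * cpw k (F x)).
Proof.
move=> h0 hF; have [hr hi] := hF.
have n0 : 0 < nc (F x) ^+ 2.
  rewrite exprn_gt0 // nc_gt0; apply/eqP => e; move: h0; rewrite e /=.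
  by rewrite ltxx.
have r0 : Re (F x) != 0 by rewrite gt_eqF.
rewrite /cpw; apply: cd_eq.
  apply: cdM.
    apply: cd_real; apply: rd_expR; apply: rdM; first exact: rd_cst.
    by apply: (@rd_ln _ (fun t => nc (F t) ^+ 2)) => //; exact: cd_nc2 hF.
  apply: cd_cis; apply: rdM; first exact: rd_cst.
  apply: (@rd_atan _ (fun t => Im (F t) / Re (F t))).
  by apply: rdM; [exact: hi|apply: (@rdV _ (fun t => Re (F t))) r0 hr].
rewrite /= invJ.
set e := expR _; set c := cis _.
rewrite nc_sqr in n0 *.
move: n0 r0; set u := Re (F x); set v := Im (F x) => n0 r0.
have d0 : u ^+ 2 + v ^+ 2 != 0 by rewrite gt_eqF.
have d1 : 1 + (v / u) ^+ 2 != 0.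
  by rewrite gt_eqF // ltr_wpDr // sqr_ge0.
by apply: ceq; rewrite !cE -/u -/v; field; rewrite d0 r0 /=.
Qed.

Lemma nc_cpw k s : nc (cpw k s) = expR (- (k / 4) * ln (nc s ^+ 2)).
Proof. by rewrite ncM nc_cis mulr1 ncC ger0_norm ?expR_ge0. Qed.

Lemma nc_cpw_le1 k s : 0 <= k -> 1 <= Re s -> nc (cpw k s) <= 1.
Proof.
move=> k0 s1; rewrite nc_cpw -expR0 ler_expR mulNr oppr_le0 mulr_ge0 //.
  by rewrite divr_ge0.
have : 1 <= nc s by exact: le_trans s1 (Re_le s).
by move=> h; rewrite ln_ge0 // exprn_ege1.
Qed.

End Calculus.

(** * The potential on rotated rays and its derivatives in radius and angle *)

Section Potential.
Context {R : realType}.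
Variables (k eps : R) (z : R[i]).
Hypotheses (k0 : 0 < k) (eps0 : 0 < eps).
Implicit Types (t th : R).

(* On the ray [x = e^{i th} t], [Sf = 1 + x^2], [Ff = (1 + x^2)^{-k/2}] and
   [Q = e^{2 i th} (x^2 + (i / eps) Ff - z)], so that [w t = psi (e^{i th} t)]
   solves [w'' = Q w] when [psi] solves the equation at [th = 0]. The suffixes
   [_t] and [_th] stand for partial derivatives. *)
Definition Sf t th : R[i] := 1 + (t ^+ 2)%:C * cis (2 * th).
Definition Ff t th : R[i] := cpw k (Sf t th).
Definition Q th t : R[i] :=
  cis (2 * th) * (cis (2 * th) * (t ^+ 2)%:C + 'i / eps%:C * Ff t th - z).

Definition Ff_th t th : R[i] := - ('i * k%:C) * (1 - (Sf t th)^-1) * Ff t th.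
Definition Ff_t t th : R[i] := - k%:C * t%:C * cis (2 * th) / Sf t th * Ff t th.
Definition Q_t th t : R[i] :=
  cis (2 * th) * (cis (2 * th) * (2 * t)%:C + 'i / eps%:C * Ff_t t th).
Definition Q_th th t : R[i] := 'i * (2 * Q th t + t%:C * Q_t th t).
Definition Ff_thth t th : R[i] := - ('i * k%:C) *
  (2 * 'i * (Sf t th - 1) / Sf t th ^+ 2 * Ff t th + (1 - (Sf t th)^-1) * Ff_th t th).
Definition Q_thth th t : R[i] := - 16 * cis (2 * th) ^+ 2 * (t ^+ 2)%:C +
  'i / eps%:C * cis (2 * th) * (- 4 * Ff t th + 4 * 'i * Ff_th t th + Ff_thth t th)
  + 4 * z * cis (2 * th).

Lemma ReSf t th : Re (Sf t th) = 1 + t ^+ 2 * cos (2 * th).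
Proof. by rewrite /Sf /cis !cE; ring. Qed.

Lemma ImSf t th : Im (Sf t th) = t ^+ 2 * sin (2 * th).
Proof. by rewrite /Sf /cis !cE; ring. Qed.

Lemma cos2_ge_half th : `|th| <= 1 / 4 -> 1 / 2 <= cos (2 * th).
Proof.
move=> h; apply: cos_ge_half; rewrite normrM ger0_norm //; lra.
Qed.

Lemma ReSf_ge1 t th : `|th| <= 1 / 4 -> 1 <= Re (Sf t th).
Proof.
move=> /cos2_ge_half h; rewrite ReSf lerDl mulr_ge0 ?sqr_ge0 //; lra.
Qed.

Lemma Sf_neq0 t th : `|th| <= 1 / 4 -> Sf t th != 0.
Proof.
by move=> /(ReSf_ge1 t) h; apply/eqP => e; move: h; rewrite e /= lt_geF.
Qed.

Lemma nc_Sf_ge1 t th : `|th| <= 1 / 4 -> 1 <= nc (Sf t th).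
Proof. by move=> /(ReSf_ge1 t) h; exact: le_trans h (Re_le _). Qed.

Lemma nc_Sf1_le t th : `|th| <= 1 / 4 -> nc (Sf t th - 1) <= nc (Sf t th).
Proof.
move=> /(ReSf_ge1 t) h; rewrite -(@ler_pXn2r _ 2) ?nnegrE ?nc_ge0 // !nc_sqr !cE.
by move: h; rewrite !cE; nra.
Qed.

Lemma nc_1BSfV t th : `|th| <= 1 / 4 -> nc (1 - (Sf t th)^-1) <= 1.
Proof.
move=> h; have S0 := Sf_neq0 t h.
have -> : 1 - (Sf t th)^-1 = (Sf t th - 1) / Sf t th by field.
by rewrite ncM ncV ler_pdivrMr ?mul1r ?nc_Sf1_le // nc_gt0.
Qed.

Lemma nc_Ff t th : `|th| <= 1 / 4 -> nc (Ff t th) <= 1.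
Proof. by move=> h; apply: nc_cpw_le1; [exact: ltW|exact: ReSf_ge1]. Qed.

Lemma cd_Sf_t t th : cd (fun s => Sf s th) t ((2 * t)%:C * cis (2 * th)).
Proof.
rewrite /Sf; apply: cd_eq.
  apply: cdD; first exact: cd_cst.
  by apply: cdM; [apply: cd_real; apply: rdX; exact: rd_id|exact: cd_cst].
by rewrite /= mulr1 expr1 add0r mulr0 addr0.
Qed.

Lemma cd_cis2 th : cd (fun s => cis (2 * s)) th (2 * 'i * cis (2 * th)).
Proof.
by apply: cd_eq; [apply: cd_cis; exact: rd_mull|apply: ceq; rewrite !cE /=; ring].
Qed.

Lemma cd_Sf_th t th : cd (fun s => Sf t s) th (2 * 'i * (Sf t th - 1)).
Proof.
rewrite /Sf; apply: cd_eq.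
  apply: cdD; first exact: cd_cst.
  by apply: cdM; [exact: cd_cst|exact: cd_cis2].
by rewrite mul0r !add0r; ring.
Qed.

Lemma cd_Ff_t t th : `|th| <= 1 / 4 -> cd (fun s => Ff s th) t (Ff_t t th).
Proof.
move=> h; have S0 := Sf_neq0 t h; apply: cd_eq.
  by apply: (@cd_cpw _ k (fun s => Sf s th)) (cd_Sf_t t th); apply: lt_le_trans (ReSf_ge1 t h).
rewrite /Ff_t -/(Ff t th) (realCM 2 t) (_ : (k / 2)%:C = k%:C / 2).
  by field.
by apply: ceq; rewrite !cE /=; field.
Qed.

Lemma cd_Ff_th t th : `|th| <= 1 / 4 -> cd (fun s => Ff t s) th (Ff_th t th).
Proof.
move=> h; have S0 := Sf_neq0 t h; apply: cd_eq.
  by apply: (@cd_cpw _ k (fun s => Sf t s)) (cd_Sf_th t th); apply: lt_le_trans (ReSf_ge1 t h).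
rewrite /Ff_th -/(Ff t th) (_ : (k / 2)%:C = k%:C / 2).
  by field.
by apply: ceq; rewrite !cE /=; field.
Qed.

Lemma cd_Q_t t th : `|th| <= 1 / 4 -> cd (fun s => Q th s) t (Q_t th t).
Proof.
move=> h; rewrite /Q; apply: cd_eq.
  apply: cdZ; apply: cdB; last exact: cd_cst.
  apply: cdD; apply: cdZ; last exact: cd_Ff_t.
  by apply: cd_real; apply: rdX; exact: rd_id.
by rewrite /Q_t /= expr1 mulr1 subr0.
Qed.

(** The Cauchy-Riemann equation in polar form: [Ff] depends on [t] and [th] only through
    [e^{i th} t]. For [Q] the additional factor [e^{2 i th}] contributes the term [2 i Q] in
    [Q_th]. *)
Lemma tFf_t t th : `|th| <= 1 / 4 -> 'i * t%:C * Ff_t t th = Ff_th t th.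
Proof.
move=> h; have S0 := Sf_neq0 t h; rewrite /Ff_t /Ff_th.
have e : t%:C * t%:C * cis (2 * th) = Sf t th - 1 by rewrite /Sf -realCM -expr2; ring.
have -> : 1 - (Sf t th)^-1 = (Sf t th - 1) / Sf t th by field.
by rewrite -e; field.
Qed.

Lemma cd_Q_th t th : `|th| <= 1 / 4 -> cd (fun s => Q s t) th (Q_th th t).
Proof.
move=> h; rewrite /Q; apply: cd_eq.
  apply: cdM; first exact: cd_cis2.
  apply: cdB; last exact: cd_cst.
  apply: cdD; last by apply: cdZ; exact: cd_Ff_th.
  by apply: cdM; [exact: cd_cis2|exact: cd_cst].
rewrite /Q_th /Q_t /Q -(tFf_t t h) !realCM; ring.
Qed.

(** A form free of radial derivatives, which can be differentiated in the angle once more and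
    bounded term by term. *)
Lemma Q_thE t th : `|th| <= 1 / 4 -> Q_th th t = 4 * 'i * cis (2 * th) ^+ 2 * (t ^+ 2)%:C
  + 'i / eps%:C * cis (2 * th) * (2 * 'i * Ff t th + Ff_th t th) - 2 * 'i * z * cis (2 * th).
Proof. by move=> h; rewrite /Q_th /Q_t /Q -(tFf_t t h) !realCM; ring. Qed.

Lemma near_cd (F G : R -> R[i]) (x : R) l : (\forall y \near x, F y = G y) -> cd F x l -> cd G x l.
Proof.
by move=> h [/rdP a /rdP b]; split; apply/rdP; [apply: near_eq_is_derive a|
  apply: near_eq_is_derive b]; near=> y; rewrite (near h y).
Unshelve. all: by end_near. Qed.

Lemma cd_Ff_thth t th : `|th| <= 1 / 4 -> cd (fun s => Ff_th t s) th (Ff_thth t th).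
Proof.
move=> h; have S0 := Sf_neq0 t h; rewrite /Ff_th; apply: cd_eq.
  apply: cdM; last exact: cd_Ff_th.
  apply: cdZ; apply: cdB; first exact: cd_cst.
  by apply: (@cdV _ (fun s => Sf t s)) => //; exact: cd_Sf_th.
rewrite /Ff_thth /Ff_th; by field.
Qed.

(** [Q_thE] holds only for [|th| <= 1 / 4]; the strict inequality makes it available at all nearby
    angles, as differentiating it requires. *)
Lemma cd_Q_thth t th : `|th| < 1 / 4 -> cd (fun s => Q_th s t) th (Q_thth th t).
Proof.
move=> h; have h' := ltW h; have d0 : 0 < 1 / 4 - `|th| by rewrite subr_gt0.
apply: (@near_cd (fun th => 4 * 'i * cis (2 * th) ^+ 2 * (t ^+ 2)%:C
  + 'i / eps%:C * cis (2 * th) * (2 * 'i * Ff t th + Ff_th t th) - 2 * 'i * z * cis (2 * th))).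
  near=> s; rewrite Q_thE //.
  have hs : `|th - s| < 1 / 4 - `|th| by near: s; exact: cvgr_dist_lt.
  by have := ler_normD (s - th) th; rewrite subrK distrC; lra.
apply: cd_eq.
  apply: cdB; last by apply: cdZ; exact: cd_cis2.
  apply: cdD.
    apply: cdM; last exact: cd_cst.
    by apply: cdZ; rewrite /GRing.exp /=; apply: cdM; exact: cd_cis2.
  apply: cdM; first by apply: cdZ; exact: cd_cis2.
  apply: cdD; first by apply: cdZ; exact: cd_Ff_th.
  exact: cd_Ff_thth.
have i2 : 'i ^+ 2 = -1 :> R[i] by rewrite sqr_i.
rewrite /Q_thth; ring: i2.
Unshelve. all: by end_near. Qed.

Lemma nc_Ff_th t th : `|th| <= 1 / 4 -> nc (Ff_th t th) <= k.
Proof.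
move=> h; have h1 := nc_Ff t h; have h2 := nc_1BSfV t h; rewrite /Ff_th.
move: h1 h2; move: (Ff t th) (1 - (Sf t th)^-1) => F G h1 h2.
rewrite !ncM ncN ncM nci mul1r ncC (gtr0_norm k0).
have p1 := nc_ge0 F; have p2 := nc_ge0 G.
rewrite -mulrA ler_piMr ?(ltW k0) //; nra.
Qed.

Lemma nc2 : nc (2 : R[i]) = 2.
Proof. by rewrite (_ : 2 = 2%:C) ?ncC ?ger0_norm //; apply: ceq; rewrite !cE /=; ring. Qed.

Lemma nc_Ff_thth t th : `|th| <= 1 / 4 -> nc (Ff_thth t th) <= k * (2 + k).
Proof.
move=> h; rewrite /Ff_thth.
have h1 := nc_Ff t h; have h3 := nc_Sf1_le t h; have h4 := nc_Sf_ge1 t h.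
have h7 := nc_Ff_th t h; have h8 := nc_1BSfV t h.
move: h1 h3 h4 h7 h8; move: (Ff t th) (Ff_th t th) (Sf t th - 1) (1 - (Sf t th)^-1).
move: (Sf t th) => S F F1 S1 S2 h1 h3 h4 h7 h8.
rewrite ncM ncN ncM nci mul1r ncC (gtr0_norm k0) ler_pM2l //.
apply: le_trans (ncD _ _) _; apply: lerD.
  rewrite !ncM nc2 nci mulr1 ncV ncX.
  have p1 := nc_ge0 F.
  have h5 : nc S1 / nc S ^+ 2 <= 1.
    by rewrite ler_pdivrMr ?mul1r ?exprn_gt0 //; nra.
  have h6 : 0 <= nc S1 / nc S ^+ 2 by rewrite divr_ge0 ?exprn_ge0 ?nc_ge0.
  rewrite -mulrA -mulrA ler_piMr // mulrA; nra.
rewrite ncM; have p1 := nc_ge0 F1; have p2 := nc_ge0 S2.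
nra.
Qed.

Lemma nc_Q t th : `|th| <= 1 / 4 -> nc (Q th t) <= t ^+ 2 + (1 / eps + nc z + 1).
Proof.
move=> h; rewrite /Q ncM nc_cis mul1r.
apply: le_trans (ncB _ _) _; have h1 := nc_Ff t h; move: (Ff t th) h1 => F h1.
have := ncD (cis (2 * th) * (t ^+ 2)%:C) ('i / eps%:C * F).
rewrite !ncM nc_cis ncV nci !ncC !mul1r (gtr0_norm eps0) ger0_norm ?sqr_ge0 //.
have e1 : 0 <= eps^-1 by rewrite invr_ge0 ltW.
have := nc_ge0 F; nra.
Qed.

Lemma nc_Q_th t th : `|th| <= 1 / 4 ->
  nc (Q_th th t) <= 4 * t ^+ 2 + (2 + k) / eps + 2 * nc z.
Proof.
move=> h; rewrite Q_thE //; have h1 := nc_Ff t h; have h7 := nc_Ff_th t h.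
move: (Ff t th) (Ff_th t th) h1 h7 => F F1 h1 h7.
have n4 : nc (4 : R[i]) = 4.
  by rewrite (_ : 4 = 4%:C) ?ncC ?ger0_norm //; apply: ceq; rewrite !cE /=; ring.
apply: le_trans (ncB _ _) _; apply: lerD; last by rewrite !ncM nc_cis nc2 nci !mulr1.
apply: le_trans (ncD _ _) _; apply: lerD.
  by rewrite !ncM !nc_cis n4 nci ncC !mulr1 ger0_norm ?sqr_ge0.
rewrite !ncM nc_cis ncV nci ncC (gtr0_norm eps0) mul1r mulr1 mulrC ler_pM2r ?invr_gt0 //.
apply: le_trans (ncD _ _) _; rewrite !ncM nc2 nci mulr1; lra.
Qed.

Lemma nc_Q_thth t th : `|th| <= 1 / 4 ->
  nc (Q_thth th t) <= 16 * t ^+ 2 + (4 + 4 * k + k * (2 + k)) / eps + 4 * nc z.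
Proof.
move=> h; rewrite /Q_thth; have h1 := nc_Ff t h; have h7 := nc_Ff_th t h.
have h8 := nc_Ff_thth t h.
move: (Ff t th) (Ff_th t th) (Ff_thth t th) h1 h7 h8 => F F1 F2 h1 h7 h8.
have n4 : nc (4 : R[i]) = 4.
  by rewrite (_ : 4 = 4%:C) ?ncC ?ger0_norm //; apply: ceq; rewrite !cE /=; ring.
have n16 : nc (16 : R[i]) = 16.
  by rewrite (_ : 16 = 16%:C) ?ncC ?ger0_norm //; apply: ceq; rewrite !cE /=; ring.
apply: le_trans (ncD _ _) _; apply: lerD; last by rewrite !ncM nc_cis n4 !mulr1.
apply: le_trans (ncD _ _) _; apply: lerD.
  by rewrite !ncM ncN !nc_cis n16 ncC !mulr1 ger0_norm ?sqr_ge0.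
rewrite !ncM nc_cis ncV nci ncC (gtr0_norm eps0) mul1r mulr1 mulrC ler_pM2r ?invr_gt0 //.
apply: le_trans (ncD _ _) _; apply: lerD => //.
by apply: le_trans (ncD _ _) _; rewrite !ncM ncN n4 nci mulr1; lra.
Qed.

(** The slope at 0 carries the factor [e^{i th}] because [w t] stands for [psi (e^{i th} t)]. Each
    angle is solved on its own; the solutions are related to each other only through their
    derivative in the angle, established next. *)
Lemma ray_solution (a b : R[i]) : exists w w1 : R -> R -> R[i],
  forall th, `|th| <= 1 / 4 ->
  [/\ w th 0 = a, w1 th 0 = cis th * b,
      forall t, cd (w th) t (w1 th t) & forall t, cd (w1 th) t (Q th t * w th t)].
Proof.
have /choice [w hw] th : exists w : (R -> R[i]) * (R -> R[i]), `|th| <= 1 / 4 ->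
    [/\ w.1 0 = a, w.2 0 = cis th * b,
      forall t, cd w.1 t (w.2 t) & forall t, cd w.2 t (Q th t * w.1 t)].
  have [h|h] := leP `|th| (1 / 4); last by exists (fun=> 0, fun=> 0).
  have [||t|u [u1 hu]] := @linear_ode _ (Q th) (1 / eps + nc z + 1) a (cis th * b).
  - by have := nc_ge0 z; have : 0 < 1 / eps; [rewrite divr_gt0|lra].
  - by apply: cd_cc => t; exact: cd_Q_t.
  - exact: nc_Q.
  by exists (u, u1).
by exists (fun th => (w th).1), (fun th => (w th).2).
Qed.

(* The difference quotients in the angle solve the same equation up to a
   remainder that is quadratically small, by the Cauchy-Riemann equation
   [Q_th]; no analyticity of solutions is invoked. *)
Lemma ray_solution_angle (a b : R[i]) (w w1 : R -> R -> R[i]) :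
  (forall th, `|th| <= 1 / 4 ->
  [/\ w th 0 = a, w1 th 0 = cis th * b,
      forall t, cd (w th) t (w1 th t) & forall t, cd (w1 th) t (Q th t * w th t)]) ->
  forall th T : R, `|th| <= 1 / 8 -> 0 <= T ->
  cd (fun s => w s T) th ('i * T%:C * w1 th T) /\ cd (fun s => w1 s T) th ('i * (w1 th T + T%:C * Q th T * w th T)).
Proof.
move=> sol th T hth T0.
pose K := T ^+ 2 + (1 / eps + nc z + 1).
have z0 := nc_ge0 z; have e0 : 0 < 1 / eps by rewrite divr_gt0.
have T20 := sqr_ge0 T.
have K0 : 0 <= K by rewrite /K; lra.
have sqT t : 0 <= t <= T -> t ^+ 2 <= T ^+ 2.
  by move=> /andP[t0 tT]; rewrite ler_pXn2r ?nnegrE.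
have QK s t : `|s| <= 1 / 4 -> 0 <= t <= T -> nc (Q s t) <= K.
  by move=> hs ht; apply: le_trans (nc_Q t hs) _; rewrite /K lerD2r sqT.
pose E := expR ((2 + K) * T).
have E0 : 0 < E by exact: expR_gt0.
pose B := 2 * (nc a + nc b) * E.
have B0 : 0 <= B.
  by rewrite /B !mulr_ge0 ?(ltW E0) // addr_ge0 ?nc_ge0.
have a0 := nc_ge0 a; have b0 := nc_ge0 b.
have wB s t : `|s| <= 1 / 4 -> 0 <= t <= T -> nc (w s t) <= B.
  move=> hs /andP[t0 tT]; have [i1 i2 d1 d2] := sol s hs.
  have d0 : 0 <= nc a + nc b by rewrite addr_ge0.
  have [] := @ode_stability _ (w s) (w1 s) (Q s) (fun=> 0) K (nc a + nc b) t K0 d0 t0.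
  - by move=> u _; exact: d1.
  - by move=> u _; rewrite addr0; exact: d2.
  - by move=> u /andP[u0 ut]; apply: QK => //; rewrite u0 (le_trans ut).
  - by move=> u _; rewrite nc0.
  - by rewrite i1 lerDl.
  - by rewrite i2 ncM nc_cis mul1r lerDr.
  move=> h _; apply: le_trans h _; rewrite /B ler_wpM2l ?mulr_ge0 //.
  by rewrite ler_expR ler_wpM2l // addr_ge0.
pose C1 := 4 * T ^+ 2 + (2 + k) / eps + 2 * nc z.
pose C2 := 16 * T ^+ 2 + (4 + 4 * k + k * (2 + k)) / eps + 4 * nc z.
have hC1 s t : `|s| <= 1 / 4 -> 0 <= t <= T -> nc (Q_th s t) <= C1.
  by move=> hs /sqT ht; apply: le_trans (nc_Q_th t hs) _; rewrite /C1; lra.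
have hC2 s t : `|s| <= 1 / 4 -> 0 <= t <= T -> nc (Q_thth s t) <= C2.
  by move=> hs /sqT ht; apply: le_trans (nc_Q_thth t hs) _; rewrite /C2; lra.
have th4 : `|th| <= 1 / 4 by lra.
have T00 : 0 <= (0 : R) <= T by rewrite lexx.
have C10 : 0 <= C1 by exact: le_trans (nc_ge0 _) (hC1 th 0 th4 T00).
have C20 : 0 <= C2 by exact: le_trans (nc_ge0 _) (hC2 th 0 th4 T00).
(* [3 / 16 = 1 / 8 + 1 / 16] is the range of [th + h] for [|h| <= 1 / 16]; it stays strictly inside
   [1 / 4], where the second derivative of [Q] is available. *)
have dom (s : R) : - (3 / 16) <= s <= 3 / 16 -> `|s| < 1 / 4.
  by move=> /andP[h1 h2]; apply: (@le_lt_trans _ _ (3 / 16)); [rewrite ler_norml h1|lra].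
have thd : - (3 / 16) <= th <= 3 / 16 by move: hth; rewrite ler_norml; lra.
have thhd (h : R) : `|h| <= 1 / 16 -> - (3 / 16) <= th + h <= 3 / 16.
  by move: hth; rewrite !ler_norml; lra.
have lipQ h t : `|h| <= 1 / 16 -> 0 <= t <= T -> nc (Q (th + h) t - Q th t) <= C1 * `|h|.
  move=> hh ht.
  have := @cd_lip _ (fun s => Q s t) (fun s => Q_th s t) C1 (- (3 / 16)) (3 / 16).
  move=> /(_ _ _ th (th + h) thd (thhd _ hh)); rewrite [th + h]addrC addrK; apply.
    by move=> s /dom/ltW; exact: cd_Q_th.
  by move=> s /dom/ltW hs; exact: hC1.
have tayQ h t : `|h| <= 1 / 16 -> 0 <= t <= T ->
    nc (Q (th + h) t - Q th t - h%:C * Q_th th t) <= C2 * h ^+ 2.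
  move=> hh ht.
  have := @cd_taylor _ (fun s => Q s t) (fun s => Q_th s t) (fun s => Q_thth s t)
    C2 (- (3 / 16)) (3 / 16).
  move=> /(_ _ _ _ th (th + h) thd (thhd _ hh)); rewrite [th + h]addrC addrK; apply.
  - by move=> s /dom/ltW; exact: cd_Q_th.
  - by move=> s /dom; exact: cd_Q_thth.
  - by move=> s /dom/ltW hs; exact: hC2.
have dcis x : cd cis x ('i * cis x).
  by apply: cd_eq (cd_cis (rd_id x)) _; rewrite mulr1.
have lipc h : nc (cis (th + h) - cis th) <= `|h|.
  have := @cd_lip _ cis (fun s => 'i * cis s) 1 (th - `|h|) (th + `|h|).
  have := ler_norm h; have := ler_norm (- h); rewrite normrN => h1 h2.
  move=> /(_ _ _ th (th + h)); rewrite mul1r [th + h]addrC addrK; apply => //.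
  - by move=> x _; rewrite ncM nci nc_cis mulr1.
  - by have := normr_ge0 h; lra.
  - by lra.
have tayc h : nc (cis (th + h) - cis th - h%:C * ('i * cis th)) <= h ^+ 2.
  have := @cd_taylor _ cis (fun s => 'i * cis s) (fun s => 'i * ('i * cis s)) 1
    (th - `|h|) (th + `|h|).
  have := ler_norm h; have := ler_norm (- h); rewrite normrN => h1 h2.
  move=> /(_ _ _ _ th (th + h)); rewrite mul1r [th + h]addrC addrK; apply => //.
  - by move=> x _; exact: cdZ.
  - by move=> x _; rewrite !ncM nci nc_cis !mulr1.
  - by have := normr_ge0 h; lra.
  - by lra.
have [i1 i2 d1 d2] := sol th th4.
pose D1 := 2 * (C1 * B + nc b) * E.
have D10 : 0 <= D1 by rewrite /D1 !mulr_ge0 ?(ltW E0) // addr_ge0 // mulr_ge0.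
(* Lipschitz dependence on the angle comes before differentiability: it makes the product
   [h Q_th (w (th + h) - w th)] of second order in [h]. *)
have hD1 h t : `|h| <= 1 / 16 -> 0 <= t <= T -> nc (w (th + h) t - w th t) <= D1 * `|h|.
  move=> hh /andP[t0 tT]; have h4 := ltW (dom _ (thhd _ hh)).
  have [j1 j2 e1 e2] := sol _ h4.
  have dd : 0 <= (C1 * B + nc b) * `|h| by rewrite mulr_ge0 // addr_ge0 // mulr_ge0.
  have [] := @ode_stability _ (fun t => w (th + h) t - w th t)
    (fun t => w1 (th + h) t - w1 th t) (Q th)
    (fun t => (Q (th + h) t - Q th t) * w (th + h) t) K _ t K0 dd t0.
  - by move=> u _; apply: cdB; [exact: e1|exact: d1].
  - by move=> u _; apply: cd_eq (cdB (e2 u) (d2 u)) _; ring.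
  - by move=> u /andP[u0 ut]; apply: QK => //; rewrite u0 (le_trans ut).
  - move=> u /andP[u0 ut]; have hu' : 0 <= u <= T by rewrite u0 (le_trans ut).
    rewrite ncM mulrDl; have := lipQ h u hh hu'; have := wB _ u h4 hu'.
    have := nc_ge0 (w (th + h) u); have := nc_ge0 (Q (th + h) u - Q th u).
    have : 0 <= nc b * `|h| by rewrite mulr_ge0.
    move=> q1 q2 q3 q4 q5; apply: (@le_trans _ _ (C1 * `|h| * B)).
      by apply: ler_pM.
    by rewrite mulrAC; lra.
  - by rewrite j1 i1 subrr nc0.
  - rewrite j2 i2 -mulrBl ncM mulrDl; have := lipc h.
    have : 0 <= C1 * B * `|h| by rewrite mulr_ge0 // mulr_ge0.
    move=> q1 q2; have : nc (cis (th + h) - cis th) * nc b <= `|h| * nc b by rewrite ler_wpM2r.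
    lra.
  move=> q _; apply: le_trans q _.
  have -> : D1 * `|h| = 2 * ((C1 * B + nc b) * `|h|) * E by rewrite /D1; ring.
  apply: ler_wpM2l; first exact: mulr_ge0.
  by rewrite ler_expR ler_wpM2l // addr_ge0.
(* The candidate derivative solves the linearised equation exactly: [(i t w1)' = i (w1 + t Q w)],
   and the derivative of the latter is [Q (i t w1) + Q_th w] because [Q_th = i (2 Q + t Q_t)]. Hence
   the error of the first-order expansion solves the original equation up to a remainder of order
   [h^2]. *)
have key h : `|h| <= 1 / 16 ->
    nc (w (th + h) T - w th T - h%:C * ('i * T%:C * w1 th T))
      <= 2 * (C2 * B + C1 * D1 + nc b) * E * h ^+ 2 /\
    nc (w1 (th + h) T - w1 th T - h%:C * ('i * (w1 th T + T%:C * Q th T * w th T)))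
      <= 2 * (C2 * B + C1 * D1 + nc b) * E * h ^+ 2.
  move=> hh; have h4 := ltW (dom _ (thhd _ hh)).
  have [j1 j2 e1 e2] := sol _ h4.
  have dd : 0 <= (C2 * B + C1 * D1 + nc b) * h ^+ 2.
    by rewrite mulr_ge0 ?sqr_ge0 // !addr_ge0 // mulr_ge0.
  have -> : 2 * (C2 * B + C1 * D1 + nc b) * E * h ^+ 2 =
     2 * ((C2 * B + C1 * D1 + nc b) * h ^+ 2) * E by ring.
  apply: (@ode_stability _ (fun t => w (th + h) t - w th t - h%:C * ('i * t%:C * w1 th t))
    (fun t => w1 (th + h) t - w1 th t - h%:C * ('i * (w1 th t + t%:C * Q th t * w th t)))
    (Q th) (fun t => (Q (th + h) t - Q th t - h%:C * Q_th th t) * w (th + h) t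
      + h%:C * Q_th th t * (w (th + h) t - w th t)) K _ T K0 dd T0).
  - move=> u _; apply: cd_eq.
      apply: cdB; first by apply: cdB; [exact: e1|exact: d1].
      apply: cdZ; apply: cdM; last exact: d2.
      by apply: cdZ; apply: cd_real; exact: rd_id.
    by cbv beta; ring.
  - move=> u _; apply: cd_eq.
      apply: cdB; first by apply: cdB; [exact: e2|exact: d2].
      apply: cdZ; apply: cdZ; apply: cdD; first exact: d2.
      apply: cdM; last exact: d1.
      by apply: cdM; [apply: cd_real; exact: rd_id|exact: cd_Q_t].
    by cbv beta; rewrite /Q_th; ring.
  - by move=> u hu; exact: QK.
  - move=> u hu; have q3 : 0 <= nc b * h ^+ 2 by rewrite mulr_ge0 ?sqr_ge0.
    apply: (@le_trans _ _ (C2 * h ^+ 2 * B + `|h| * C1 * (D1 * `|h|))); last first.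
      have -> : `|h| * C1 * (D1 * `|h|) = C1 * D1 * h ^+ 2.
        by rewrite -[h ^+ 2]real_normK ?num_real //; ring.
      have -> : (C2 * B + C1 * D1 + nc b) * h ^+ 2 =
        C2 * h ^+ 2 * B + C1 * D1 * h ^+ 2 + nc b * h ^+ 2 by ring.
      by rewrite lerDl.
    apply: le_trans (ncD _ _) _; apply: lerD.
      by rewrite ncM; apply: ler_pM; rewrite ?nc_ge0 //; [exact: tayQ|exact: wB].
    rewrite ncM; apply: ler_pM; rewrite ?nc_ge0 //; last exact: hD1.
    by rewrite ncM ncC ler_wpM2l // hC1.
  - by rewrite j1 i1 mulr0 mul0r mulr0 subrr subr0 nc0.
  - rewrite j2 i2 mul0r mul0r addr0.
    have -> : cis (th + h) * b - cis th * b - h%:C * ('i * (cis th * b)) =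
      (cis (th + h) - cis th - h%:C * ('i * cis th)) * b by ring.
    rewrite ncM mulrDl; have := tayc h; have := nc_ge0 b.
    have : 0 <= (C2 * B + C1 * D1) * h ^+ 2.
      by rewrite mulr_ge0 ?sqr_ge0 // addr_ge0 // mulr_ge0.
    move=> q1 b1 q2.
    have := ler_wpM2r b1 q2; lra.
have d16 : 0 < 1 / 16 :> R by rewrite divr_gt0.
pose C := 2 * (C2 * B + C1 * D1 + nc b) * E.
by split; apply: (@cd_of_quadratic _ _ _ _ C _ d16) => h /key [].
Qed.

End Potential.

(** * Growing and recessive solutions *)

Section DecayingSolution.
Context {R : realType}.
Implicit Types (F G : R -> R[i]) (f g : R -> R) (x t s : R).

Lemma wronskian_cst (q u u1 v v1 : R -> R[i]) :
  (forall t, cd u t (u1 t)) -> (forall t, cd u1 t (q t * u t)) ->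
  (forall t, cd v t (v1 t)) -> (forall t, cd v1 t (q t * v t)) ->
  forall s t, u s * v1 s - u1 s * v s = u t * v1 t - u1 t * v t.
Proof.
move=> hu hu1 hv hv1.
have d t : cd (fun t => u t * v1 t - u1 t * v t) t 0.
  by apply: cd_eq (cdB (cdM (hu t) (hv1 t)) (cdM (hu1 t) (hv t))) _; ring.
move=> s t; have [st|ts] := leP s t.
  by apply: (@cd_zero_cst _ (fun t => u t * v1 t - u1 t * v t) s t).
by apply/esym; apply: (@cd_zero_cst _ (fun t => u t * v1 t - u1 t * v t) t s) => //; exact: ltW.
Qed.

(** Cramer's rule in the fundamental system with unit data at 0, whose Wronskian is 1 everywhere. *)
Lemma linear_ode_at (q : R -> R[i]) (K x0 : R) (a b : R[i]) : 1 <= K -> cc q ->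
  (forall t, nc (q t) <= t ^+ 2 + K) ->
  exists w w1 : R -> R[i], [/\ w x0 = a, w1 x0 = b,
    forall t, cd w t (w1 t) & forall t, cd w1 t (q t * w t)].
Proof.
move=> K1 cq hq.
have [c [c1 [c0 c10 dc dc1]]] := linear_ode 1 0 K1 cq hq.
have [s [s1 [s0 s10 ds ds1]]] := linear_ode 0 1 K1 cq hq.
have W : c x0 * s1 x0 - c1 x0 * s x0 = 1.
  by rewrite (wronskian_cst dc dc1 ds ds1 x0 0) c0 c10 s0 s10; ring.
pose A := a * s1 x0 - b * s x0; pose B := b * c x0 - a * c1 x0.
exists (fun t => A * c t + B * s t), (fun t => A * c1 t + B * s1 t); split.
- by rewrite -[RHS]mulr1 -W /A /B; ring.
- by rewrite -[RHS]mulr1 -W /A /B; ring.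
- by move=> t; apply: cdD; exact: cdZ.
- move=> t; apply: cd_eq; first by apply: cdD; apply: cdZ; [exact: dc1|exact: ds1].
  by ring.
Qed.

(** A Cauchy criterion with rate. Every value of [f - G] lies below every value of [f + G], so the
    supremum of [f - G] separates them and is within [G t] of [f t]. *)
Lemma dominated_limit f (G : R -> R) (X : R) :
  (forall t, X <= t -> 0 <= G t) ->
  (forall s t, X <= s -> s <= t -> `|f t - f s| <= G s - G t) ->
  exists l : R, forall t, X <= t -> `|f t - l| <= G t.
Proof.
move=> G0 h.
pose S := [set f t - G t | t in [set t | X <= t]].
have ab s t : X <= s -> X <= t -> f s - G s <= f t + G t.
  move=> Xs Xt; have := G0 _ Xs; have := G0 _ Xt.
  have [st|/ltW ts] := leP s t.
    by have := h _ _ Xs st; rewrite ler_norml; lra.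
  by have := h _ _ Xt ts; rewrite ler_norml; lra.
exists (sup S) => t Xt.
have l1 : f t - G t <= sup S.
  by apply: ub_le_sup; [exists (f X + G X) => _ [s Xs <-]; apply: ab|exists t].
have l2 : sup S <= f t + G t.
  by apply: ge_sup; [exists (f X - G X), X => //=|move=> _ [s Xs <-]; apply: ab].
by rewrite ler_norml; lra.
Qed.

Lemma dominated_limitC F (G : R -> R) (X : R) :
  (forall t, X <= t -> 0 <= G t) ->
  (forall s t, X <= s -> s <= t -> nc (F t - F s) <= G s - G t) ->
  exists l : R[i], forall t, X <= t -> nc (F t - l) <= 2 * G t.
Proof.
move=> G0 h.
have [|l1 h1] := @dominated_limit (fun t => Re (F t)) G X G0.
  by move=> s t Xs st; rewrite -ReN -ReD; apply: le_trans (Re_le_nc _) (h _ _ Xs st).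
have [|l2 h2] := @dominated_limit (fun t => Im (F t)) G X G0.
  by move=> s t Xs st; rewrite -ImN -ImD; apply: le_trans (Im_le_nc _) (h _ _ Xs st).
exists (l1 +i* l2) => t Xt; apply: le_trans (nc_le_ReIm _) _; rewrite !cE.
by have := h1 t Xt; have := h2 t Xt; lra.
Qed.

(** * A growing solution on a half-line and reduction of order *)

Section Growing.
Variables (V : R -> R[i]) (K r X : R).
Hypotheses (K1 : 1 <= K) (hV : forall t, nc (V t) <= t ^+ 2 + K)
  (ReV : forall t, Re (V t) = t ^+ 2 - r) (X1 : 1 <= X)
  (Xr : forall t, X <= t -> 1 / 2 + t ^+ 2 / 4 <= t ^+ 2 - r).
Variables (phi phi1 : R -> R[i]).
Hypotheses (phiX : phi X = 1) (phi1X : phi1 X = (X / 2)%:C)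
  (dphi : forall t, cd phi t (phi1 t)) (dphi1 : forall t, cd phi1 t (V t * phi t)).

Let p t := nc (phi t) ^+ 2.
Let dp t := 2 * Re ((phi t)^* * phi1 t).

Lemma rd_growing t : rd p t (dp t).
Proof. exact: cd_nc2. Qed.

(** [t / 2] is a subsolution of the Riccati equation, since [(t / 2)' + (t / 2)^2 = 1 / 2 + t^2 / 4]
    is at most [Re V] by [Xr]. The slope [X / 2] makes [D] vanish at [X], and its derivative is
    [|phi1 - (t / 2) phi|^2] plus a nonnegative multiple of [|phi|^2]. *)
Lemma growing_logderivative t : X <= t -> t * p t <= dp t.
Proof.
move=> Xt; rewrite -subr_ge0.
have -> : dp t - t * p t = 2 * (Re ((phi t)^* * phi1 t) - t / 2 * p t).
  by rewrite /dp; field.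
apply: mulr_ge0 => //.
pose D t := Re ((phi t)^* * phi1 t) - t / 2 * p t.
have DX : D X = 0.
  by rewrite /D /p phiX phi1X nc1 !cE; ring.
rewrite -/(D t) -DX.
apply: (@rd_incr _ D (fun t => nc (phi1 t) ^+ 2 + Re (V t) * p t
  - (1 / 2 * p t + t / 2 * dp t))) => // s /andP[Xs st].
  apply: rdB.
    have [h _] := cdM (cdJ (dphi s)) (dphi1 s); apply: rd_eq h _.
    by rewrite /p !nc_sqr !cE; ring.
  apply: rd_eq; first by apply: rdM; [apply: rdM; [exact: rd_id|exact: rd_cst]|exact: rd_growing].
  by rewrite mulr0 addr0 mul1r.
rewrite ReV /p /dp !nc_sqr !cE; have := Xr Xs.
set a := Re (phi s); set b := Im (phi s); set a1 := Re (phi1 s); set b1 := Im (phi1 s).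
move=> h.
have e1 := sqr_ge0 (a1 - s / 2 * a); have e2 := sqr_ge0 (b1 - s / 2 * b).
have e3 : 0 <= (s ^+ 2 - r - (1 / 2 + s ^+ 2 / 4)) * (a ^+ 2 + b ^+ 2).
  by apply: mulr_ge0; [rewrite subr_ge0|rewrite addr_ge0 ?sqr_ge0].
nra.
Qed.

Lemma growing_ratio2 s t : X <= s -> s <= t -> p s * expR ((t ^+ 2 - s ^+ 2) / 2) <= p t.
Proof.
move=> Xs st.
have : p s * expR (- (s ^+ 2 / 2)) <= p t * expR (- (t ^+ 2 / 2)).
  apply: (@rd_incr _ (fun u => p u * expR (- (u ^+ 2 / 2)))
    (fun u => (dp u - u * p u) * expR (- (u ^+ 2 / 2)))) => // u /andP[su ut].
    have dpu := rd_growing u.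
    by apply: rd_eq; [rder|cbv beta; rewrite /=; field].
  rewrite mulr_ge0 ?expR_ge0 // subr_ge0; apply: growing_logderivative.
  exact: le_trans su.
move=> h; have := ler_wpM2r (expR_ge0 (t ^+ 2 / 2)) h.
have e1 : expR (- (s ^+ 2 / 2)) * expR (t ^+ 2 / 2) = expR ((t ^+ 2 - s ^+ 2) / 2).
  by rewrite -expRD; congr expR; field.
have e2 : expR (- (t ^+ 2 / 2)) * expR (t ^+ 2 / 2) = 1 by rewrite -expRD addNr expR0.
by rewrite -(mulrA (p s)) e1 -(mulrA (p t)) e2 mulr1.
Qed.

Lemma growing_gt0 t : X <= t -> 0 < p t.
Proof.
move=> Xt; apply: lt_le_trans (growing_ratio2 (lexx X) Xt).
by rewrite /p phiX nc1 expr1n mul1r expR_gt0.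
Qed.

Lemma growing_neq0 t : X <= t -> phi t != 0.
Proof.
by move=> /growing_gt0; rewrite /p => h; apply/eqP => e; move: h; rewrite e nc0 expr0n ltxx.
Qed.

Lemma growing_ratio s t : X <= s -> s <= t ->
  nc (phi s) * expR ((t ^+ 2 - s ^+ 2) / 4) <= nc (phi t).
Proof.
move=> Xs st; rewrite -(@ler_pXn2r _ 2) ?nnegrE ?nc_ge0 ?mulr_ge0 ?nc_ge0 ?expR_ge0 //.
rewrite exprMn -expRM_natl; apply: le_trans (growing_ratio2 Xs st).
by rewrite (_ : 2%:R * _ = (t ^+ 2 - s ^+ 2) / 2) //; field.
Qed.

(** For [y = |phi1| / |phi|], the equation and the bound on the logarithmic derivative give
    [(y^2)' <= 2 (1 + K) s^2 y - s y^2], and completing the square bounds this by [(1 + K)^2 s^3],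
    which is integrated from [X]. *)
Lemma growing_derivative t : X <= t -> nc (phi1 t) <= (1 + K) * t ^+ 2 * nc (phi t).
Proof.
move=> Xt.
have main : nc (phi1 t) ^+ 2 / p t <= (1 + K) ^+ 2 * t ^+ 4.
  have : nc (phi1 t) ^+ 2 / p t - nc (phi1 X) ^+ 2 / p X <=
      (1 + K) ^+ 2 * t ^+ 4 / 4 - (1 + K) ^+ 2 * X ^+ 4 / 4.
    apply: (@rd_le_incr _ (fun t => nc (phi1 t) ^+ 2 / p t)
      (fun t => (1 + K) ^+ 2 * t ^+ 4 / 4)
      (fun t => (2 * Re ((phi1 t)^* * (V t * phi t)) * p t - nc (phi1 t) ^+ 2 * dp t) / p t ^+ 2)
      (fun t => (1 + K) ^+ 2 * t ^+ 3)) => // s /andP[Xs st]; have ps := growing_gt0 Xs.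
    - have ps0 : p s != 0 by rewrite gt_eqF.
      have d1 := cd_nc2 (dphi1 s); have d2 := rdV ps0 (rd_growing s).
      by apply: rd_eq (rdM d1 d2) _; field.
    - by apply: rd_eq; [rder|cbv beta; rewrite /=; field].
    - have h1 := growing_logderivative Xs.
      rewrite ler_pdivrMr; last by rewrite exprn_gt0.
      have h2 : Re ((phi1 s)^* * (V s * phi s)) <= nc (phi1 s) * nc (V s) * nc (phi s).
        by apply: le_trans (ReJM _ _) _; rewrite ncM mulrA.
      have s1 : 1 <= s by exact: le_trans Xs.
      have h3 : nc (V s) <= (1 + K) * s ^+ 2.
        apply: le_trans (hV s) _; have s2 : 1 <= s ^+ 2 by rewrite exprn_ege1.
        by have := K1; nra.
      move: h2 h1 ps; rewrite /p; have := nc_ge0 (phi s); have := nc_ge0 (phi1 s).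
      have := nc_ge0 (V s); set a := nc (phi1 s); set b := nc (phi s); set v := nc (V s).
      move=> v0 a0 b0 h2 h1 ps.
      have h4 : 2 * Re ((phi1 s)^* * (V s * phi s)) * b ^+ 2 - a ^+ 2 * dp s <=
        2 * (a * ((1 + K) * s ^+ 2) * b) * b ^+ 2 - a ^+ 2 * (s * b ^+ 2).
        apply: lerB; last by rewrite ler_wpM2l ?sqr_ge0.
        rewrite ler_wpM2r ?sqr_ge0 // ler_wpM2l //; apply: le_trans h2 _.
        by rewrite ler_wpM2r // ler_wpM2l.
      apply: le_trans h4 _; rewrite -subr_ge0.
      have -> : (1 + K) ^+ 2 * s ^+ 3 * (b ^+ 2) ^+ 2 - (2 * (a * ((1 + K) * s ^+ 2) * b) * b ^+ 2 -
        a ^+ 2 * (s * b ^+ 2)) = s * b ^+ 2 * ((1 + K) * s * b - a) ^+ 2 by ring.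
      by rewrite mulr_ge0 ?sqr_ge0 // mulr_ge0 ?sqr_ge0 // (le_trans _ s1).
  have -> : p X = 1 by rewrite /p phiX nc1 expr1n.
  rewrite phi1X ncC real_normK ?num_real // divr1.
  have t1 : 1 <= t by exact: le_trans Xt.
  have e1 : 1 <= (1 + K) ^+ 2 by have := K1; nra.
  have e2 : X ^+ 2 <= t ^+ 2 by rewrite ler_pXn2r ?nnegrE //; have := X1; lra.
  have e3 : t ^+ 2 <= t ^+ 4 by rewrite (exprM t 2 2) ler_eXnr // exprn_ege1.
  have e4 : t ^+ 4 <= (1 + K) ^+ 2 * t ^+ 4.
    by rewrite ler_peMl // exprn_ge0 // (le_trans _ t1).
  have e5 : 0 <= (1 + K) ^+ 2 * X ^+ 4 by rewrite mulr_ge0 ?sqr_ge0 ?exprn_ge0 // (le_trans _ X1).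
  rewrite exprMn; have := sqr_ge0 X; lra.
have K0 : 0 <= 1 + K by have := K1; lra.
have t0 : 0 <= t by apply: le_trans Xt; have := X1; lra.
rewrite -(@ler_pXn2r _ 2) ?nnegrE ?nc_ge0 ?mulr_ge0 ?nc_ge0 //.
rewrite ler_pdivrMr ?growing_gt0 // in main; apply: le_trans main _.
by rewrite /p; apply: le_of_eq; ring.
Qed.

(** Reduction of order. For a second solution [chi] with Wronskian 1 the quotient [chi / phi] has
    derivative [phi^{-2}]; it converges to some [L], and [psi = chi - L phi] is recessive. The rate
    is [G = 1 / (t |phi|^2)], because the bound on the logarithmic derivative gives
    [- G' >= |phi|^{-2}]. *)
Lemma recessive_solution (cV : cc V) : exists psi psi1 : R -> R[i],
  [/\ forall t, cd psi t (psi1 t), forall t, cd psi1 t (V t * psi t),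
      forall t, phi t * psi1 t - phi1 t * psi t = 1,
      forall t, X <= t -> nc (psi t) <= 2 / (t * nc (phi t)) &
      forall t, X <= t -> nc (psi1 t) <= (3 + 2 * K) * t / nc (phi t)].
Proof.
have [chi [chi1 [cX c1X dc dc1]]] := linear_ode_at X 0 1 K1 cV hV.
have W t : phi t * chi1 t - phi1 t * chi t = 1.
  by rewrite (wronskian_cst dphi dphi1 dc dc1 t X) phiX cX c1X; ring.
have pgt0 t : X <= t -> 0 < nc (phi t) by move=> /growing_neq0; rewrite nc_gt0.
have tgt0 t : X <= t -> 0 < t by move=> h; apply: lt_le_trans (le_trans X1 h).
pose G t := (t * p t)^-1.
have dG t : X <= t -> rd G t (- (p t + t * dp t) / (t * p t) ^+ 2).
  move=> Xt; have tp0 : t * p t != 0 by rewrite mulf_neq0 ?gt_eqF ?growing_gt0 ?tgt0.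
  apply: (@rdV _ (fun t => t * p t)) => //.
  by apply: rd_eq (rdM (rd_id t) (rd_growing t)) _; rewrite mul1r.
have [|s t Xs st|L hL] := @dominated_limitC (fun t => chi t / phi t) G X.
- by move=> t Xt; rewrite invr_ge0 mulr_ge0 ?ltW ?growing_gt0 ?tgt0.
- have := @cd_mvt _ (fun t => chi t / phi t) (fun t => (phi t ^+ 2)^-1)
    (fun t => - G t) (fun t => (p t + t * dp t) / (t * p t) ^+ 2) s t st.
  rewrite opprK [- G t + _]addrC => h.
  apply: h => u /andP[su ut]; have Xu := le_trans Xs su; have u0 := growing_neq0 Xu.
  + have e : chi1 u * phi u - chi u * phi1 u = 1 by rewrite -(W u); ring.
    by apply: cd_eq (cd_div u0 (dc u) (dphi u)) _; rewrite e mul1r.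
  + by apply: rd_eq (rdN (dG _ Xu)) _; rewrite mulNr opprK.
  + rewrite ncV ncX -/(p u).
    have h1 := growing_logderivative Xu; have p0 := growing_gt0 Xu; have t0 := tgt0 _ Xu.
    rewrite ler_pdivlMr; last by rewrite exprn_gt0 // mulr_gt0.
    have -> : (p u)^-1 * (u * p u) ^+ 2 = u * (u * p u) by field; rewrite gt_eqF.
    have : u * (u * p u) <= u * dp u by rewrite ler_pM2l.
    lra.
exists (fun t => chi t - L * phi t), (fun t => chi1 t - L * phi1 t).
have hpsi t : X <= t -> chi t - L * phi t = (chi t / phi t - L) * phi t.
  by move=> /growing_neq0 h; field.
have hpsi1 t : X <= t -> chi1 t - L * phi1 t = (phi t)^-1 + phi1 t * (chi t / phi t - L).
  move=> Xt; have h := growing_neq0 Xt.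
  by rewrite -[X in _ = X + _]mul1r -{1}(W t); field.
have b1 t : X <= t -> nc (chi t / phi t - L) <= 2 / (t * nc (phi t) ^+ 2) by exact: hL.
split.
- by move=> t; apply: cdB => //; exact: cdZ.
- by move=> t; apply: cd_eq; [apply: cdB; [exact: dc1|apply: cdZ; exact: dphi1]|ring].
- by move=> t; rewrite -(W t); ring.
- move=> t Xt; rewrite hpsi // ncM; have h1 := b1 t Xt; have h2 := pgt0 t Xt; have h3 := tgt0 t Xt.
  apply: le_trans (ler_wpM2r (ltW h2) h1) _; apply: le_of_eq.
  by field; rewrite !gt_eqF.
- move=> t Xt; rewrite hpsi1 //; have h1 := b1 t Xt; have h2 := pgt0 t Xt; have h3 := tgt0 t Xt.
  apply: le_trans (ncD _ _) _; rewrite ncV ncM.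
  apply: (@le_trans _ _ ((nc (phi t))^-1 + (1 + K) * t ^+ 2 * nc (phi t) * (2 / (t * nc (phi t) ^+ 2)))).
    by rewrite lerD2l; apply: ler_pM; rewrite ?nc_ge0 // growing_derivative.
  have -> : (nc (phi t))^-1 + (1 + K) * t ^+ 2 * nc (phi t) * (2 / (t * nc (phi t) ^+ 2)) =
    (1 + 2 * (1 + K) * t) / nc (phi t) by field; rewrite !gt_eqF.
  rewrite ler_pM2r ?invr_gt0 //; have := le_trans X1 Xt; lra.
Qed.

End Growing.

Lemma growing_recessive_pair (V : R -> R[i]) (K r : R) : 1 <= K -> cc V ->
  (forall t, nc (V t) <= t ^+ 2 + K) -> (forall t, Re (V t) = t ^+ 2 - r) ->
  exists (X C : R) (phi phi1 psi psi1 : R -> R[i]), [/\ 1 <= X /\ 0 < C,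
    [/\ forall t, cd phi t (phi1 t), forall t, cd phi1 t (V t * phi t),
       forall t, cd psi t (psi1 t) & forall t, cd psi1 t (V t * psi t)],
    forall t, phi t * psi1 t - phi1 t * psi t = 1,
    nc (phi X) = 1 /\ (forall s t, X <= s -> s <= t ->
       nc (phi s) * expR ((t ^+ 2 - s ^+ 2) / 4) <= nc (phi t)) &
    forall t, X <= t -> [/\ 0 < nc (phi t), nc (phi1 t) <= C * t ^+ 2 * nc (phi t),
      nc (psi t) <= C / (t * nc (phi t)) & nc (psi1 t) <= C * t / nc (phi t)]].
Proof.
move=> K1 cV hV ReV.
(* Beyond [X >= 1] one has [t <= t^2], and [3 X / 4] exceeds [1 / 2 + |r|]. *)
pose X : R := 1 + 2 * (`|r| + 1).
have X1 : 1 <= X by rewrite /X; have := normr_ge0 r; lra.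
have Xr t : X <= t -> 1 / 2 + t ^+ 2 / 4 <= t ^+ 2 - r.
  move=> Xt; have : t <= t ^+ 2 by rewrite expr2 ler_peMr // ?(le_trans _ Xt) //; lra.
  by have := ler_norm r; have := normr_ge0 r; move: Xt; rewrite /X; lra.
have [phi [phi1 [pX p1X dp dp1]]] := linear_ode_at X 1 (X / 2)%:C K1 cV hV.
have [psi [psi1 [ds ds1 W b b1]]] := recessive_solution K1 hV ReV X1 Xr pX p1X dp dp1 cV.
exists X, (3 + 2 * K), phi, phi1, psi, psi1; split => //.
- by split => //; lra.
- split; first by rewrite pX nc1.
  by move=> s t Xs st; eapply growing_ratio; eassumption.
move=> t Xt; have p0 : 0 < nc (phi t).
  by rewrite nc_gt0; eapply growing_neq0; eassumption.
have t0 : 0 < t by apply: lt_le_trans (le_trans X1 Xt).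
split => //.
- have h : nc (phi1 t) <= (1 + K) * t ^+ 2 * nc (phi t).
    by eapply growing_derivative; eassumption.
  apply: le_trans h _.
  by rewrite -!mulrA ler_wpM2r ?mulr_ge0 ?sqr_ge0 ?nc_ge0 //; lra.
- apply: le_trans (b t Xt) _; rewrite ler_pM2r ?invr_gt0 ?mulr_gt0 //; lra.
- exact: b1.
Qed.

End DecayingSolution.

(** * Lower bound for the rotated potential *)

Section ScaledPotential.
Context {R : realType}.
Implicit Types (x y t s : R).

Lemma sin_le_id y : 0 <= y -> sin y <= y.
Proof.
move=> y0; have : sin y - sin 0 <= y - 0.
  apply: (@rd_le_incr _ sin (fun t => t) cos (fun=> 1) 0 y) => // t _.
  - by apply: rd_eq (rd_sin (rd_id t)) _; rewrite mulr1.
  - exact: rd_id.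
by rewrite sin0 !subr0.
Qed.

Lemma sin_ge_half y : 0 <= y -> y <= 1 / 2 -> y / 2 <= sin y.
Proof.
move=> y0 y1; have : y / 2 - 0 / 2 <= sin y - sin 0.
  apply: (@rd_le_incr _ (fun t => t / 2) sin (fun=> 1 / 2) cos 0 y) => // t.
  - by move=> _; apply: rd_eq (rdM (rd_id t) (rd_cst _ t)) _; rewrite mulr0 addr0.
  - by move=> _; apply: rd_eq (rd_sin (rd_id t)) _; rewrite mulr1.
  - move=> /andP[t0 ty]; apply: cos_ge_half; rewrite ger0_norm //; lra.
by rewrite sin0 mul0r !subr0.
Qed.

Lemma atan_le_id y : 0 <= y -> atan y <= y.
Proof.
move=> y0; have : atan y - atan 0 <= y - 0.
  apply: (@rd_le_incr _ atan (fun t => t) (fun t => (1 + t ^+ 2)^-1) (fun=> 1) 0 y) => // t _.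
  - by apply: rd_eq (rd_atan (rd_id t)) _; rewrite mulr1.
  - exact: rd_id.
  - by have := sqr_ge0 t => h; rewrite invf_le1; lra.
by rewrite atan0 !subr0.
Qed.

Lemma atan_ge_half y : 0 <= y -> y <= 1 -> y / 2 <= atan y.
Proof.
move=> y0 y1; have : y / 2 - 0 / 2 <= atan y - atan 0.
  apply: (@rd_le_incr _ (fun t => t / 2) atan (fun=> 1 / 2) (fun t => (1 + t ^+ 2)^-1) 0 y) => // t.
  - by move=> _; apply: rd_eq (rdM (rd_id t) (rd_cst _ t)) _; rewrite mulr0 addr0.
  - by move=> _; apply: rd_eq (rd_atan (rd_id t)) _; rewrite mulr1.
  - move=> /andP[t0 ty]; have := sqr_ge0 t => h; have t1 : t ^+ 2 <= 1 by nra.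
    by rewrite div1r lef_pV2 ?posrE //; lra.
by rewrite atan0 mul0r !subr0.
Qed.

(* [qf k t = (1 + t^2)^{-k/2}]. *)
Definition qf (k t : R) := expR (- (k / 2) * ln (1 + t ^+ 2)).

(** The argument of [Sf] is [atan x] with [x] between [th t^2 / (1 + t^2)] and [4 th]. The
    restriction [th <= 1 / (4 k)] keeps [(k / 2) atan x] below [1 / 2], where the sine is at least
    half its argument. The factor [1 / 8] collects the exponent [k / 2], this loss and a similar one
    for the arctangent; [|Sf| <= 1 + t^2] gives [qf]. *)
Lemma ImFf_lower (k th t : R) : 0 < k -> 0 < th -> th <= 1 / 8 -> th <= 1 / (4 * k) ->
  k * th / 8 * (t ^+ 2 / (1 + t ^+ 2)) * qf k t <= - Im (Ff k t th).
Proof.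
move=> k0 th0 th1 th2.
have kth : k * th <= 1 / 4 by move: th2; rewrite ler_pdivlMr; [lra|rewrite mulr_gt0].
have t20 := sqr_ge0 t.
have th4 : `|th| <= 1 / 4 by rewrite gtr0_norm //; lra.
have c2 := cos2_ge_half th4; have c21 := cos_le1 (2 * th).
have s2lo : th <= sin (2 * th) by have := @sin_ge_half (2 * th); lra.
have s2hi : sin (2 * th) <= 2 * th by apply: sin_le_id; lra.
have s0 : 0 < 1 + t ^+ 2 by lra.
have s1 : 0 < 1 + t ^+ 2 * cos (2 * th) by nra.
set x := Im (Sf t th) / Re (Sf t th).
have xE : x = t ^+ 2 * sin (2 * th) / (1 + t ^+ 2 * cos (2 * th)).
  by rewrite /x ReSf ImSf.
have xlo : th * (t ^+ 2 / (1 + t ^+ 2)) <= x.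
  rewrite xE mulrA; apply: (@le_trans _ _ (t ^+ 2 * sin (2 * th) / (1 + t ^+ 2))).
    by rewrite ler_pM2r ?invr_gt0 // mulrC ler_wpM2l.
  apply: ler_wpM2l; first by rewrite mulr_ge0 //; lra.
  by rewrite lef_pV2 ?posrE // lerD2l ler_piMr.
have xhi : x <= 4 * th.
  rewrite xE ler_pdivrMr //; have : t ^+ 2 * sin (2 * th) <= t ^+ 2 * (2 * th).
    by rewrite ler_wpM2l.
  have : 0 <= th * t ^+ 2 * (cos (2 * th) - 1 / 2).
    by rewrite mulr_ge0 ?subr_ge0 // mulr_ge0 // ltW.
  nra.
have x0 : 0 <= x by apply: le_trans xlo; rewrite mulr_ge0 ?divr_ge0 // ltW.
have alo := atan_ge_half x0 (_ : x <= 1); have ahi := atan_le_id x0.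
have {}alo : x / 2 <= atan x by apply: alo; lra.
have -> : - Im (Ff k t th) = expR (- (k / 4) * ln (nc (Sf t th) ^+ 2)) * sin (k / 2 * atan x).
  by rewrite /Ff /cpw -/x [- (k / 2) * atan x]mulNr /cis !cE sinN; ring.
rewrite mulrC; apply: ler_pM.
- exact: expR_ge0.
- apply: mulr_ge0; first by rewrite divr_ge0 // mulr_ge0 // ltW.
  by rewrite divr_ge0 // ltW.
- have nS1 : 1 <= nc (Sf t th) := nc_Sf_ge1 t th4.
  have nS2 : nc (Sf t th) <= 1 + t ^+ 2.
    by apply: le_trans (ncD _ _) _; rewrite nc1 ncM nc_cis ncC mulr1 ger0_norm.
  rewrite /qf ler_expR lnXn; last by lra.
  have : ln (nc (Sf t th)) <= ln (1 + t ^+ 2) by rewrite ler_ln ?posrE //; lra.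
  move: (ln (nc (Sf t th))) (ln (1 + t ^+ 2)) => a b ab.
  by rewrite -mulr_natl; have := ler_wpM2l (ltW k0) ab; lra.
- have y0 : 0 <= k / 2 * atan x by apply: mulr_ge0; lra.
  have y1 : k / 2 * atan x <= 1 / 2.
    have : k * atan x <= k * (4 * th) by rewrite ler_pM2l //; lra.
    lra.
  have h1 := sin_ge_half y0 y1.
  have h2 : k * (th * (t ^+ 2 / (1 + t ^+ 2))) <= k * (2 * atan x).
    by rewrite ler_pM2l //; apply: le_trans xlo _; lra.
  apply: le_trans h1; move: h2; move: (t ^+ 2 / (1 + t ^+ 2)) => u h2; lra.
Qed.

(** In terms of [s = 1 + t^2], the increasing [s] and the decreasing [s^{-k/2} / eps] cross at
    [s = eps^{-2/(k+2)}], their common value. On either side of the crossing one of the two is at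
    least that value; the comparison is made on logarithms. *)
Lemma potential_balance (k eps t : R) : 0 < k -> 0 < eps -> eps <= 1 ->
  eps `^ (- (2 / (k + 2))) <= (1 + t ^+ 2) + qf k t / eps.
Proof.
move=> k0 e0 e1; have s0 : 0 < 1 + t ^+ 2 by have := sqr_ge0 t; lra.
have -> : eps `^ (- (2 / (k + 2))) = expR (- (2 / (k + 2)) * ln eps).
  by rewrite /powR gt_eqF.
rewrite -{1}(lnK (s0 : 1 + t ^+ 2 \is Num.pos)) -{2}(lnK (e0 : eps \is Num.pos)).
rewrite -expRN /qf -expRD.
set l := ln eps; set s := ln (1 + t ^+ 2); set a := 2 / (k + 2).
have [h|/ltW h] := leP (- a * l) s.
  by apply: ler_wpDr; rewrite ?expR_ge0 // ler_expR.
apply: ler_wpDl; rewrite ?expR_ge0 // ler_expR.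
have : k / 2 * s <= k / 2 * (- a * l) by rewrite ler_wpM2l // divr_ge0 // ltW.
have -> : k / 2 * (- a * l) = - l + a * l by rewrite /a; field; lra.
lra.
Qed.

(* [h] is the multiplier in the energy of [rotated_energy_zero]: near [0], where
   the potential degenerates, the gain comes from [dh], and away from [0] from
   [t^2] and from the sign of [Im Ff] on the ray. *)
Lemma scaled_potential_bound (k : R) : 0 < k ->
  exists th M : R, [/\ 0 < th, th <= 1 / 8, 0 < M &
  forall eps, 0 < eps -> eps <= 1 ->
  exists (h dh : R -> R) (H : R), [/\ h 0 = 0, forall t, rd h t (dh t),
    forall t, 0 <= t -> 0 <= h t <= H * t &
    forall t, 0 <= t -> M / eps `^ (Num.min (1 / 2) (2 / (k + 2))) <=
      cos (2 * th) * (dh t - h t ^+ 2 + t ^+ 2) - Im (Ff k t th) / eps]].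
Proof.
move=> k0.
pose th := Num.min (1 / 8) (1 / (4 * k)).
have th0 : 0 < th by rewrite lt_min !divr_gt0 // mulr_gt0.
have th1 : th <= 1 / 8 by rewrite ge_min lexx.
have th2 : th <= 1 / (4 * k) by rewrite ge_min lexx orbT.
have th4 : `|th| <= 1 / 4 by rewrite gtr0_norm //; lra.
have kth : k * th <= 1 / 4 by move: th2; rewrite ler_pdivlMr; [lra|rewrite mulr_gt0].
have c2 := cos2_ge_half th4; have c21 := cos_le1 (2 * th).
(* The cutoff [g = s^{-J}] must decay at least as fast as [qf k t / s], which is [s^{-k/2-1}], so
   that [h^2] and the negative part of [dh] are dominated at every [t] by the gain from [Im Ff]. *)
pose J := (Num.bound (k / 2 + 1)).+1.
have hJ : k / 2 + 1 <= J%:R.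
  apply: ltW; apply: lt_le_trans (_ : (Num.bound (k / 2 + 1))%:R <= _).
    by apply: archi_boundP; lra.
  by rewrite ler_nat.
have J1 : 1 <= J%:R :> R by rewrite ler1n.
pose c1 := k * th / 8.
have c10 : 0 < c1 by rewrite /c1 divr_gt0 // mulr_gt0.
(* Small enough that, with [A] the lower bound for [- Im Ff / eps], [h^2] costs at most [A / 2] and
   the negative part of [dh] at most [A / 4]. *)
pose kap := c1 / (8 * J%:R).
have J80 : 0 < 8 * J%:R :> R by lra.
have kap0 : 0 < kap by rewrite divr_gt0.
have kapJ : kap * (8 * J%:R) = c1 by rewrite /kap divfK // gt_eqF.
have kap1 : kap <= c1 / 8 by nra.
have c11 : c1 <= 1 by rewrite /c1; lra.
have kap2 : kap ^+ 2 <= c1 / 2 by nra.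
(* For [t^2 <= tau] the factor [1 - 2 J t^2 / s] in [dh] is at least [1 / 2]. *)
pose tau : R := (4 * J%:R)^-1.
have J40 : 0 < 4 * J%:R :> R by lra.
have tau0 : 0 < tau by rewrite invr_gt0.
have tauJ : tau * (4 * J%:R) = 1 by rewrite /tau mulVf // gt_eqF.
have tau1 : tau <= 1 / 4 by nra.
pose M1 := kap / (4 * 2 ^+ J).
have p2 : 0 < 4 * 2 ^+ J :> R by rewrite mulr_gt0 // exprn_gt0.
have M10 : 0 < M1 by rewrite divr_gt0.
pose M2 := Num.min (tau / 4) (c1 * tau / 8).
have M20 : 0 < M2 by rewrite lt_min !divr_gt0 // mulr_gt0.
exists th, (Num.min M1 M2); split => //; first by rewrite lt_min M10.
move=> eps e0 e1.
pose e2 := eps `^ (1 / 2).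
have e2sq : e2 ^+ 2 = eps by rewrite /e2 -powR_mulrn ?powR_ge0 // -powRrM div1r mulVf // powRr1 // ltW.
have e20 : 0 < e2 by rewrite powR_gt0.
have e21 : e2 <= 1 by nra.
have e2e : e2^-1 <= eps^-1 by rewrite lef_pV2 ?posrE //; nra.
(* [rho] is the value of [dh] at 0. The order [eps^{-1/2}] is the largest for which [h^2], about
   [rho^2 t^2] near 0, stays below the rotated potential, about [t^2 / eps]. *)
pose rho := kap / e2.
have rho0 : 0 < rho by rewrite divr_gt0.
have rho2 : rho ^+ 2 = kap ^+ 2 / eps by rewrite /rho expr_div_n e2sq.
pose s t : R := 1 + t ^+ 2.
have s1 t : 1 <= s t by rewrite /s lerDl sqr_ge0.
have s0 t : 0 < s t by exact: lt_le_trans (s1 t).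
pose g t := (s t ^+ J)^-1.
have g0 t : 0 < g t by rewrite invr_gt0 exprn_gt0.
have g1 t : g t <= 1 by rewrite invf_le1 ?exprn_gt0 // exprn_ege1.
have gq t : g t <= qf k t / s t.
  rewrite /g /qf -/(s t) -{1 3}(lnK (s0 t : s t \is Num.pos)) -expRM_natl -!expRN -expRD ler_expR.
  have l0 : 0 <= ln (s t) by rewrite ln_ge0.
  have := ler_wpM2r l0 hJ; lra.
have q0 t : 0 < qf k t by exact: expR_gt0.
pose h t := rho * t * g t.
pose dh t := rho * g t * (1 - 2 * J%:R * t ^+ 2 / s t).
have hd t : rd h t (dh t).
  have st0 : s t ^+ J != 0 by rewrite gt_eqF // exprn_gt0.
  have ds : rd s t (2 * t) by apply: rd_eq; [rewrite /s; rder|cbv beta; rewrite /=; ring].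
  apply: rd_eq.
    by apply: rdM; [exact: rd_mull|apply: (@rdV _ (fun t => s t ^+ J)) st0 (rdX J ds)].
  rewrite /dh /g /J /= -/(s t) exprS; field.
  by rewrite expf_neq0 ?gt_eqF.
exists h, dh, rho; split => //.
- by rewrite /h mulr0 mul0r.
- move=> t t0; have rt : 0 <= rho * t by rewrite mulr_ge0 // ltW.
  by rewrite /h mulr_ge0 ?(ltW (g0 t)) //= ler_piMr.
move=> t t0.
have t20 := sqr_ge0 t.
set m := - Im (Ff k t th).
have mlo : c1 * (t ^+ 2 / s t) * qf k t <= m by exact: ImFf_lower.
have -> : cos (2 * th) * (dh t - h t ^+ 2 + t ^+ 2) - Im (Ff k t th) / eps =
   cos (2 * th) * (dh t - h t ^+ 2 + t ^+ 2) + m / eps by rewrite /m; ring.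
have ei0 : 0 < eps^-1 by rewrite invr_gt0.
pose A := c1 * (t ^+ 2 / s t) * qf k t / eps.
have A0 : 0 <= A by rewrite /A !mulr_ge0 ?invr_ge0 // ltW.
have mA : A <= m / eps by rewrite ler_pM2r.
have h2 : h t ^+ 2 <= A / 2.
  have -> : h t ^+ 2 = rho ^+ 2 * t ^+ 2 * g t ^+ 2 by rewrite /h; ring.
  rewrite rho2.
  have e : kap ^+ 2 / eps * t ^+ 2 * g t ^+ 2 <= c1 / 2 / eps * t ^+ 2 * (qf k t / s t).
    apply: ler_pM.
    - by rewrite mulr_ge0 // divr_ge0 ?sqr_ge0 // ltW.
    - exact: sqr_ge0.
    - by rewrite ler_wpM2r // ler_pM2r.
    - by apply: le_trans (gq t); rewrite expr2 ler_piMr // ltW.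
  by apply: le_trans e _; apply: le_of_eq; rewrite /A; ring.
have nu1 : eps `^ Num.min (1 / 2) (2 / (k + 2)) >= eps `^ (1 / 2).
  by apply: ger_powR; rewrite ?e0 // ge_min lexx.
have nu2 : eps `^ Num.min (1 / 2) (2 / (k + 2)) >= eps `^ (2 / (k + 2)).
  by apply: ger_powR; rewrite ?e0 // ge_min lexx orbT.
have pw u : 0 < eps `^ u by exact: powR_gt0.
have Mm0 : 0 < Num.min M1 M2 by rewrite lt_min M10.
have Mm1 : Num.min M1 M2 <= M1 by rewrite ge_min lexx.
have Mm2 : Num.min M1 M2 <= M2 by rewrite ge_min lexx orbT.
(* Up to [tau], [dh] alone exceeds a multiple of [eps^{-1/2}]. Beyond it [t^2 / s >= tau / 2], so
   [t^2] and [A] dominate the two terms of [potential_balance] up to constants, which gives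
   [eps^{-2/(k+2)}]. *)
have [ht|ht] := leP (t ^+ 2) tau.
  have dh1 : rho * (2 ^+ J)^-1 / 2 <= dh t.
    have gl : (2 ^+ J)^-1 <= g t.
      rewrite lef_pV2 ?posrE ?exprn_gt0 // ler_pXn2r ?nnegrE ?(ltW (s0 t)) //.
      by rewrite /s; lra.
    have fl : 2^-1 <= 1 - 2 * J%:R * t ^+ 2 / s t.
      have : 2 * J%:R * t ^+ 2 / s t <= 2 * J%:R * t ^+ 2.
        by rewrite ler_pdivrMr // ler_peMr // mulr_ge0 // mulr_ge0.
      have : 2 * J%:R * t ^+ 2 <= 2 * J%:R * tau by rewrite ler_wpM2l // mulr_ge0.
      lra.
    rewrite /dh; apply: ler_pM => //.
      by rewrite mulr_ge0 ?invr_ge0 ?exprn_ge0 // (ltW rho0).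
    by rewrite ler_pM2l.
  have e3 : Num.min M1 M2 / eps `^ Num.min (1 / 2) (2 / (k + 2)) <= M1 / e2.
    by apply: ler_pM; rewrite ?invr_ge0 ?(ltW (pw _)) ?(ltW Mm0) // lef_pV2 ?posrE.
  apply: le_trans e3 _.
  have e4 : M1 / e2 = 1 / 2 * (rho * (2 ^+ J)^-1 / 2).
    by rewrite /M1 /rho; field; rewrite ?expf_neq0 // gt_eqF.
  rewrite e4.
  have : 0 <= cos (2 * th) * (dh t + t ^+ 2 - rho * (2 ^+ J)^-1 / 2).
    by rewrite mulr_ge0 //; lra.
  have : 0 <= (cos (2 * th) - 1 / 2) * (rho * (2 ^+ J)^-1 / 2).
    by rewrite mulr_ge0 ?subr_ge0 // !mulr_ge0 ?invr_ge0 ?exprn_ge0 // ltW.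
  have : 0 <= (1 - cos (2 * th)) * h t ^+ 2 by rewrite mulr_ge0 ?subr_ge0 ?sqr_ge0.
  nra.
have dh2 : - (A / 4) <= dh t.
  have : rho * g t * (2 * J%:R * t ^+ 2 / s t) <= A / 4.
    have e : rho * g t * (2 * J%:R * t ^+ 2 / s t) <= kap / eps * (qf k t / s t) * (2 * J%:R * t ^+ 2).
      have J2 : 0 <= 2 * J%:R * t ^+ 2 by apply: mulr_ge0 => //; lra.
      apply: ler_pM.
      - by rewrite mulr_ge0 // ltW.
      - by rewrite mulr_ge0 // invr_ge0 ltW.
      - apply: ler_pM; rewrite ?(ltW rho0) ?(ltW (g0 t)) //.
        by rewrite /rho ler_pM2l.
      - by rewrite ler_pdivrMr // ler_peMr.
    apply: le_trans e _; apply: le_of_eq; rewrite /A -kapJ; field.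
    by rewrite !gt_eqF.
  have : 0 <= rho * g t by rewrite mulr_ge0 // ltW.
  rewrite /dh; lra.
have main : 1 / 2 * t ^+ 2 + A / 4 <= cos (2 * th) * (dh t - h t ^+ 2 + t ^+ 2) + m / eps.
  have : 0 <= cos (2 * th) * (dh t + A / 4) by rewrite mulr_ge0 //; lra.
  have : 0 <= (1 - cos (2 * th)) * (h t ^+ 2 + A / 4) by rewrite mulr_ge0 ?subr_ge0 ?addr_ge0 ?sqr_ge0 //; lra.
  have : 0 <= (cos (2 * th) - 1 / 2) * t ^+ 2 by rewrite mulr_ge0 ?subr_ge0.
  nra.
apply: le_trans main.
have bal := potential_balance t k0 e0 e1; rewrite powRN -/(s t) in bal.
have ts : tau / 2 * s t <= t ^+ 2 by rewrite /s; nra.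
have ts2 : tau / 2 <= t ^+ 2 / s t by rewrite ler_pdivlMr.
have M2a : M2 <= tau / 4 by rewrite ge_min lexx.
have M2b : M2 <= c1 * tau / 8 by rewrite ge_min lexx orbT.
have e3 : Num.min M1 M2 / eps `^ Num.min (1 / 2) (2 / (k + 2)) <= M2 / eps `^ (2 / (k + 2)).
  by apply: ler_pM; rewrite ?invr_ge0 ?(ltW (pw _)) ?(ltW Mm0) // lef_pV2 ?posrE.
apply: le_trans e3 _; apply: le_trans (ler_wpM2l (ltW M20) bal) _.
rewrite mulrDr; apply: lerD.
  by have := ler_wpM2r (ltW (s0 t)) M2a; lra.
have qe0 : 0 < qf k t / eps by rewrite divr_gt0.
have e5 : c1 * (tau / 2) * (qf k t / eps) <= c1 * (t ^+ 2 / s t) * (qf k t / eps).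
  by rewrite ler_pM2r // ler_pM2l.
have := ler_wpM2r (ltW qe0) M2b; rewrite /A; lra.
Qed.

End ScaledPotential.

(** * The recessive solution does not vanish at the origin *)

Section Nonvanishing.
Context {R : realType}.
Implicit Types (x y t s T : R).

Lemma rd_near0 (f : R -> R) (l x e : R) : 0 < e ->
  (forall t, `|x - t| < e -> f t = 0) -> rd f x l -> l = 0.
Proof.
move=> e0 h [_ <-].
have g : is_derive x (1 : R) f 0.
  apply: (@near_eq_is_derive R R R (fun=> 0)).
  by near=> t; apply/esym/h; near: t; exact: cvgr_dist_lt.
by have [_ ->] := (rdP f x 0).2 g.
Unshelve. all: by end_near. Qed.

Lemma expR_ge_sqr x : 0 <= x -> x ^+ 2 / 2 <= expR x.
Proof.
move=> x0; have e1 t : 0 <= t -> t <= expR t.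
  by move=> t0; have := expR_ge1Dx t; lra.
have : x ^+ 2 / 2 - 0 ^+ 2 / 2 <= expR x - expR 0.
  apply: (@rd_le_incr _ (fun t => t ^+ 2 / 2) expR (fun t => t) expR 0 x) => // t.
  - by move=> _; apply: rd_eq; [rder|cbv beta; rewrite /=; field].
  - by move=> _; apply: rd_eq (rd_expR (rd_id t)) _; rewrite mulr1.
  - by move=> /andP[t0 _]; exact: e1.
by rewrite expR0 expr0n /= mul0r subr0; lra.
Qed.

Lemma sqr_expRN_le T : 1 <= T -> T ^+ 2 * expR (- (T ^+ 2 / 4)) <= 32 / T.
Proof.
move=> T1; have T0 : 0 < T by lra.
rewrite expRN ler_pdivrMr ?expR_gt0 // mulrAC ler_pdivlMr //.
have h : (T ^+ 2 / 4) ^+ 2 / 2 <= expR (T ^+ 2 / 4).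
  by apply: expR_ge_sqr; rewrite divr_ge0 ?sqr_ge0.
have T2 : T <= T ^+ 2 by nra.
have : T ^+ 2 * T <= T ^+ 4.
  by rewrite (exprM T 2 2) (expr2 (T ^+ 2)) ler_wpM2l ?sqr_ge0.
have -> : T ^+ 4 = 32 * ((T ^+ 2 / 4) ^+ 2 / 2) by field.
lra.
Qed.

Variables (k eps : R) (z : R[i]).
Hypotheses (k0 : 0 < k) (eps0 : 0 < eps).

(* Rotating the half-line by a small angle costs at most [exp (T^2 / 4)] at
   radius [T], less than the decay of [psi] on the real axis. *)
Lemma rotated_decay (psi psi1 phi : R -> R[i]) (X C th : R) :
  1 <= X -> 0 < C -> 0 < th -> th <= 1 / 8 ->
  (forall t, cd psi t (psi1 t)) -> (forall t, cd psi1 t (Q k eps z 0 t * psi t)) ->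
  nc (phi X) = 1 ->
  (forall s t, X <= s -> s <= t -> nc (phi s) * expR ((t ^+ 2 - s ^+ 2) / 4) <= nc (phi t)) ->
  (forall t, X <= t -> nc (psi t) <= C / (t * nc (phi t))) ->
  (forall t, X <= t -> nc (psi1 t) <= C * t / nc (phi t)) ->
  exists (w w1 : R -> R[i]) (D : R), [/\ w 0 = psi 0, w1 0 = cis th * psi1 0,
    forall t, cd w t (w1 t), forall t, cd w1 t (Q k eps z th t * w t) &
    forall T, X <= T -> T ^+ 2 * nc (w T) ^+ 2 + nc (w1 T) ^+ 2 <= D / T].
Proof.
move=> X1 C0 th0 th1 hpsi hpsi1 phiX phig bpsi bpsi1.
have [w [w1 sol]] := ray_solution z k0 eps0 (psi 0) (psi1 0).
have z0 := nc_ge0 z.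
have ei : 0 < 1 / eps by rewrite divr_gt0.
pose K := 1 / eps + nc z + 1.
have K0 : 0 <= K by rewrite /K; lra.
pose D := 2 * C ^+ 2 * expR (X ^+ 2 / 2 + K / 8) * 32.
have th4 : `|th| <= 1 / 4 by rewrite gtr0_norm //; lra.
have [i1 i2 d1 d2] := sol th th4.
exists (w th), (w1 th), D; split => // T XT.
have T1 : 1 <= T by lra.
have T0 : 0 < T by lra.
have o4 : `|0 : R| <= 1 / 4 by rewrite normr0; lra.
have [j1 j2 e1 e2] := sol 0 o4; rewrite cis0 mul1r in j2.
(* Stability with zero remainder is uniqueness: at angle 0 the ray solution is [psi] itself. *)
have w0E : nc (w 0 T - psi T) <= 0 /\ nc (w1 0 T - psi1 T) <= 0.
  have := @ode_stability _ (fun t => w 0 t - psi t) (fun t => w1 0 t - psi1 t)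
    (Q k eps z 0) (fun=> 0) (T ^+ 2 + K) 0 T.
  rewrite mulr0 mul0r; apply => //.
  - by rewrite addr_ge0 ?sqr_ge0.
  - exact: ltW.
  - by move=> t _; exact: cdB.
  - by move=> t _; apply: cd_eq (cdB (e2 t) (hpsi1 t)) _; ring.
  - move=> t /andP[t0 tT]; apply: le_trans (nc_Q z k0 eps0 t o4) _.
    by rewrite /K lerD2r ler_pXn2r ?nnegrE // ltW.
  - by move=> t _; rewrite nc0.
  - by rewrite j1 subrr nc0.
  - by rewrite j2 subrr nc0.
have {w0E} [wE w1E] : w 0 T = psi T /\ w1 0 T = psi1 T.
  case: w0E => h1 h2; split; apply/eqP; rewrite -subr_eq0 -nc_eq0 eq_le nc_ge0 andbT //.
(* The radius is fixed and the angle is the evolution variable. The weight [T^2] balances the factor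
   [T] that couples [w] and [w1]. The term [i w1] in the angular derivative of [w1] only contributes
   the imaginary quantity [i |w1|^2], so the growth rate is [T^2 + |Q|], at most [2 T^2 + K]. *)
pose N s := T ^+ 2 * nc (w s T) ^+ 2 + nc (w1 s T) ^+ 2.
have hN : N th <= N 0 * expR ((2 * T ^+ 2 + K) * (th - 0)).
  apply: (@gronwall _ N (fun s => T ^+ 2 * (2 * Re ((w s T)^* * ('i * T%:C * w1 s T))) +
    2 * Re ((w1 s T)^* * ('i * (w1 s T + T%:C * Q k eps z s T * w s T))))).
  - exact: ltW.
  - move=> s /andP[s0 sth].
    have s8 : `|s| <= 1 / 8 by rewrite ger0_norm //; lra.
    have [a1 a2] := ray_solution_angle k0 eps0 sol s8 (ltW T0).
    apply: rd_eq; first by apply: rdD; [apply: rdM; [exact: rd_cst|exact: cd_nc2 a1]|exact: cd_nc2 a2].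
    by rewrite mul0r add0r.
  - move=> s /andP[s0 sth].
    have s4 : `|s| <= 1 / 4 by rewrite ger0_norm //; lra.
    have hQ := nc_Q z k0 eps0 T s4; rewrite -/K in hQ.
    have r1 : Re ((w s T)^* * ('i * T%:C * w1 s T)) <= T * (nc (w s T) * nc (w1 s T)).
      by apply: le_trans (ReJM _ _) _; rewrite !ncM nci ncC gtr0_norm // mul1r mulrCA.
    have r2 : Re ((w1 s T)^* * ('i * (w1 s T + T%:C * Q k eps z s T * w s T))) <=
        T * nc (Q k eps z s T) * (nc (w s T) * nc (w1 s T)).
      have -> : Re ((w1 s T)^* * ('i * (w1 s T + T%:C * Q k eps z s T * w s T))) =
          Re ((w1 s T)^* * ('i * T%:C * Q k eps z s T * w s T)).
        have -> : (w1 s T)^* * ('i * (w1 s T + T%:C * Q k eps z s T * w s T)) =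
          'i * ((w1 s T)^* * w1 s T) + (w1 s T)^* * ('i * T%:C * Q k eps z s T * w s T) by ring.
        have r0 (x : R) : Re ('i * x%:C) = 0 by rewrite !cE; ring.
        by rewrite mulJ ReD r0 add0r.
      apply: le_trans (ReJM _ _) _; rewrite !ncM nci ncC gtr0_norm // mul1r.
      by apply: le_of_eq; ring.
    rewrite /N; set a := nc (w s T); set b := nc (w1 s T); set q := nc (Q k eps z s T) in hQ r2.
    have a0 : 0 <= a := nc_ge0 _; have b0 : 0 <= b := nc_ge0 _.
    rewrite -/a -/b in r1 r2.
    have ab : 2 * (T * (a * b)) <= T ^+ 2 * a ^+ 2 + b ^+ 2.
      by have := sqr_ge0 (T * a - b); nra.
    have q0 : 0 <= q := nc_ge0 _.
    have m1 : (T ^+ 2 + q) * (2 * (T * (a * b))) <= (2 * T ^+ 2 + K) * (T ^+ 2 * a ^+ 2 + b ^+ 2).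
      apply: ler_pM => //; rewrite ?addr_ge0 ?sqr_ge0 ?mulr_ge0 //; lra.
    apply: le_trans m1; have := ler_wpM2l (sqr_ge0 T) r1; nra.
apply: le_trans hN _.
have N0 : N 0 <= 2 * C ^+ 2 * T ^+ 2 * expR (- ((T ^+ 2 - X ^+ 2) / 2)).
  rewrite /N wE w1E; have h1 := bpsi T XT; have h2 := bpsi1 T XT.
  have h3 := phig X T (lexx X) XT; rewrite phiX mul1r in h3.
  have p0 : 0 < nc (phi T) by apply: lt_le_trans h3; exact: expR_gt0.
  have h4 : (nc (phi T))^-1 <= expR (- ((T ^+ 2 - X ^+ 2) / 4)).
    by rewrite expRN lef_pV2 ?posrE ?expR_gt0.
  set e := expR _ in h4.
  have e0 : 0 <= e by exact: expR_ge0.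
  have -> : expR (- ((T ^+ 2 - X ^+ 2) / 2)) = e ^+ 2.
    by rewrite /e -expRM_natl; congr expR; field.
  have g1 : T * nc (psi T) <= C * e.
    apply: (@le_trans _ _ (C * (nc (phi T))^-1)); last by rewrite ler_pM2l.
    apply: le_trans (ler_wpM2l (ltW T0) h1) _; apply: le_of_eq; field.
    by rewrite !gt_eqF.
  have g2 : nc (psi1 T) <= C * T * e.
    by apply: le_trans h2 _; rewrite ler_wpM2l // mulr_ge0 ?ltW.
  have g3 : (T * nc (psi T)) ^+ 2 <= (C * e) ^+ 2.
    by rewrite ler_pXn2r ?nnegrE ?mulr_ge0 ?nc_ge0 // ltW.
  have g4 : nc (psi1 T) ^+ 2 <= (C * T * e) ^+ 2.
    by rewrite ler_pXn2r ?nnegrE ?mulr_ge0 ?nc_ge0 // ltW.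
  rewrite -exprMn; apply: le_trans (lerD g3 g4) _.
  have : 1 <= T ^+ 2 by rewrite exprn_ege1.
  have : 0 <= C ^+ 2 * e ^+ 2 by rewrite mulr_ge0 ?sqr_ge0.
  rewrite !exprMn; nra.
apply: le_trans (ler_wpM2r (expR_ge0 _) N0) _.
have h5 : expR (- ((T ^+ 2 - X ^+ 2) / 2)) * expR ((2 * T ^+ 2 + K) * (th - 0)) <=
    expR (X ^+ 2 / 2 + K / 8) * expR (- (T ^+ 2 / 4)).
  rewrite -!expRD ler_expR subr0.
  have : (2 * T ^+ 2 + K) * th <= (2 * T ^+ 2 + K) * (1 / 8).
    by rewrite ler_wpM2l // addr_ge0 // mulr_ge0 // sqr_ge0.
  lra.
have h6 := sqr_expRN_le T1.
rewrite /D; move: h5 h6; move: (expR (- ((T ^+ 2 - X ^+ 2) / 2))) => E1.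
move: (expR ((2 * T ^+ 2 + K) * (th - 0))) (expR_ge0 (X ^+ 2 / 2 + K / 8)) => E2.
move: (expR (X ^+ 2 / 2 + K / 8)) (expR (- (T ^+ 2 / 4))) => E3 E4 E30 h5 h6.
have C20 : 0 <= 2 * C ^+ 2 by rewrite mulr_ge0 ?sqr_ge0.
have -> : 2 * C ^+ 2 * T ^+ 2 * E1 * E2 = 2 * C ^+ 2 * T ^+ 2 * (E1 * E2) by ring.
have -> : 2 * C ^+ 2 * E3 * 32 / T = 2 * C ^+ 2 * E3 * (32 / T) by ring.
have CT : 0 <= 2 * C ^+ 2 * T ^+ 2 by rewrite mulr_ge0 ?sqr_ge0.
apply: le_trans (ler_wpM2l CT h5) _.
have -> : 2 * C ^+ 2 * T ^+ 2 * (E3 * E4) = 2 * C ^+ 2 * E3 * (T ^+ 2 * E4) by ring.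
by rewrite ler_wpM2l // mulr_ge0.
Qed.

(* [Re (e^{-2 i th} w^* w') + cos (2 th) h |w|^2] is nondecreasing and vanishes
   at both ends. *)
Lemma rotated_energy_zero (w w1 : R -> R[i]) (th eta H X D : R) (h dh : R -> R) :
  0 < eta -> 0 < th -> th <= 1 / 8 -> 1 <= X -> 0 <= H -> 0 <= D ->
  h 0 = 0 -> (forall t, rd h t (dh t)) -> (forall t, 0 <= t -> 0 <= h t <= H * t) ->
  (forall t, 0 <= t -> Re z + eta <=
     cos (2 * th) * (dh t - h t ^+ 2 + t ^+ 2) - Im (Ff k t th) / eps) ->
  (forall t, cd w t (w1 t)) -> (forall t, cd w1 t (Q k eps z th t * w t)) ->
  (forall T, X <= T -> T ^+ 2 * nc (w T) ^+ 2 + nc (w1 T) ^+ 2 <= D / T) ->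
  (w 0)^* * w1 0 = 0 ->
  w 0 = 0 /\ w1 0 = 0.
Proof.
move=> eta0 th0 th1 X1 H0 D0 h0 hd hH hP dw dw1 decay bc.
have th4 : `|th| <= 1 / 4 by rewrite gtr0_norm //; lra.
have c2 := cos2_ge_half th4; have c21 := cos_le1 (2 * th).
set c := cos (2 * th) in c2 c21 hP.
pose B t := Re ((cis (2 * th))^* * ((w t)^* * w1 t)) + c * (h t * nc (w t) ^+ 2).
pose dB t := c * nc (w1 t) ^+ 2 + (c * t ^+ 2 - Im (Ff k t th) / eps - Re z) * nc (w t) ^+ 2
  + c * (dh t * nc (w t) ^+ 2 + h t * (2 * Re ((w t)^* * w1 t))).
have ReVi (u : R[i]) : Re ('i / eps%:C * u) = - Im u / eps.
  have -> : 'i / eps%:C = (0 +i* eps^-1) :> R[i].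
    rewrite -fmorphV; apply: ceq; rewrite !cE; ring.
  by rewrite !cE; ring.
have cs := cos2Dsin2 (2 * th).
have cQ t : Re ((cis (2 * th))^* * Q k eps z th t) = c * t ^+ 2 - Im (Ff k t th) / eps - Re z.
  rewrite /Q mulrA mulJ nc_cis expr1n mul1r ReD ReD ReVi ReN.
  by rewrite /cis !cE /c; ring.
have hB t : rd B t (dB t).
  have [e _] := cdZ (cis (2 * th))^* (cdM (cdJ (dw t)) (dw1 t)).
  apply: rd_eq (rdD e (rdM (rd_cst c t) (rdM (hd t) (cd_nc2 (dw t))))) _.
  rewrite /dB mul0r add0r; congr (_ + _).
  have -> : (cis (2 * th))^* * ((w1 t)^* * w1 t + (w t)^* * (Q k eps z th t * w t)) =
    (cis (2 * th))^* * ((w1 t)^* * w1 t) + (cis (2 * th))^* * Q k eps z th t * ((w t)^* * w t) by ring.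
  have ReMC (u : R[i]) (x : R) : Re (u * x%:C) = Re u * x by rewrite !cE; ring.
  by rewrite !mulJ ReD !ReMC cQ ReJ.
(* Completing the square: discarding [c |w1 + h w|^2] costs [c h^2 |w|^2], and what is left is the
   expression bounded below in [hP]. *)
have dBlo t : 0 <= t -> eta * nc (w t) ^+ 2 <= dB t.
  move=> t0; have p := hP t t0; rewrite /dB.
  have sq : 0 <= nc (w1 t) ^+ 2 + 2 * h t * Re ((w t)^* * w1 t) + h t ^+ 2 * nc (w t) ^+ 2.
    rewrite !nc_sqr !cE.
    have := sqr_ge0 (Re (w1 t) + h t * Re (w t)); have := sqr_ge0 (Im (w1 t) + h t * Im (w t)).
    by nra.
  have m1 : 0 <= c * (nc (w1 t) ^+ 2 + 2 * h t * Re ((w t)^* * w1 t) + h t ^+ 2 * nc (w t) ^+ 2).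
    by rewrite mulr_ge0 //; lra.
  have m2 := ler_wpM2r (sqr_ge0 (nc (w t))) p.
  nra.
have dB0 t : 0 <= t -> 0 <= dB t.
  by move=> /dBlo; apply: le_trans; rewrite mulr_ge0 ?sqr_ge0 // ltW.
have B0 : B 0 = 0 by rewrite /B bc h0 mulr0 mul0r mulr0 addr0.
have Bmono s t : 0 <= s -> s <= t -> B s <= B t.
  move=> s0 st; apply: (@rd_incr _ B dB) => // u /andP[su _]; apply: dB0.
  exact: le_trans su.
have BT T : X <= T -> B T <= (1 + H) * D / T.
  move=> XT; have T1 : 1 <= T by lra.
  have T0 : 0 < T by lra.
  have dT := decay T XT; have /andP[hT0 hT] := hH T (ltW T0).
  have e1 : Re ((cis (2 * th))^* * ((w T)^* * w1 T)) <= nc (w T) * nc (w1 T).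
    by apply: le_trans (Re_le _) _; rewrite !ncM !ncJ nc_cis mul1r.
  set a := nc (w T) in dT e1 *; set b := nc (w1 T) in dT e1 *.
  have a0 : 0 <= a := nc_ge0 _; have b0 : 0 <= b := nc_ge0 _.
  have T2 : T <= T ^+ 2 by rewrite expr2 ler_peMr // ltW.
  have e2 : a * b <= T ^+ 2 * a ^+ 2 + b ^+ 2.
    have : 0 <= (T ^+ 2 - 1) * a ^+ 2 by rewrite mulr_ge0 ?sqr_ge0 //; lra.
    by have := sqr_ge0 (a - b); have := sqr_ge0 a; have := sqr_ge0 b; nra.
  have e3 : c * (h T * a ^+ 2) <= H * (T ^+ 2 * a ^+ 2).
    have g1 : h T * a ^+ 2 <= H * T ^+ 2 * a ^+ 2.
      by rewrite ler_wpM2r ?sqr_ge0 //; apply: le_trans hT _; rewrite ler_wpM2l.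
    have g0 : 0 <= h T * a ^+ 2 by rewrite mulr_ge0 ?sqr_ge0.
    by have := ler_wpM2r g0 c21; rewrite mul1r; lra.
  have e4 : H * (T ^+ 2 * a ^+ 2) <= H * (D / T).
    by rewrite ler_wpM2l //; have := sqr_ge0 b; lra.
  rewrite /B -/a; have -> : (1 + H) * D / T = D / T + H * (D / T) by field; rewrite gt_eqF.
  by lra.
have Bz t : 0 <= t -> B t = 0.
  move=> t0; apply/eqP; rewrite eq_le -{2}B0 Bmono // andbT leNgt; apply/negP => Bt.
  pose T := Num.max (Num.max X t) ((1 + H) * D / B t + 1).
  have XT : X <= T by rewrite /T !le_max lexx.
  have tT : t <= T by rewrite /T !le_max lexx orbT.
  have bT : (1 + H) * D / B t + 1 <= T by rewrite /T !le_max lexx !orbT.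
  have T0 : 0 < T by lra.
  have := le_trans (Bmono t T t0 tT) (BT T XT).
  rewrite ler_pdivlMr // mulrC -ler_pdivlMr //; lra.
have wz t : 0 < t -> w t = 0.
  move=> t0; have d0 : dB t = 0.
    apply: (rd_near0 t0 _ (hB t)) => s; rewrite ltr_norml => hs; apply: Bz; lra.
  have := dBlo t (ltW t0); rewrite d0 => e.
  apply/eqP; rewrite -nc_eq0 -sqrf_eq0 eq_le sqr_ge0 andbT.
  by rewrite -(pmulr_rle0 _ eta0).
have w1z : w1 1 = 0.
  have [r1 r2] := dw 1; apply: ceq.
    apply: (rd_near0 ltr01 _ r1) => s; rewrite ltr_norml => hs; rewrite wz //; lra.
  apply: (rd_near0 ltr01 _ r2) => s; rewrite ltr_norml => hs; rewrite wz //; lra.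
have cQc : cc (Q k eps z th).
  by apply: cd_cc => t; exact: cd_Q_t.
have z0 := nc_ge0 z; have ei : 0 < 1 / eps by rewrite divr_gt0.
(* The data of this auxiliary solution are chosen so that its Wronskian with [w] equals
   [|w 0|^2 + |w1 0|^2] at 0; at 1 the Wronskian is 0, because [w] and [w1] vanish there. *)
have [||v [v1 [v0 v10 dv dv1]]] := @linear_ode _ (Q k eps z th) (1 / eps + nc z + 1)
  (- (w1 0)^*) (w 0)^* _ cQc.
- by lra.
- by move=> t; exact: nc_Q.
have W := wronskian_cst dw dw1 dv dv1 0 1.
rewrite v0 v10 w1z (wz 1 ltr01) !mul0r subr0 mulrN opprK !mulJr -realCD in W.
move: W => [/eqP]; rewrite paddr_eq0 ?sqr_ge0 // !sqrf_eq0 !nc_eq0.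
by move=> /andP[/eqP -> /eqP ->].
Qed.

End Nonvanishing.

(** * Green function estimates *)

Section GreenKernel.
Context {R : realType}.
Implicit Types (x y t s T : R).

(* Up to a constant, a majorant of [(1 + |x|)^2] times the Green function; its
   rate of decay reflects that recessive solutions behave like [e^{-x^2/2}]. *)
Definition Ek x y : R :=
  (1 + `|x|) * expR (- (1 / 16) * ((1 + `|x| + `|y|) * `|x - y|)).

Lemma Ek_ge0 x y : 0 <= Ek x y.
Proof. by rewrite mulr_ge0 ?expR_ge0 // addr_ge0. Qed.

Lemma EkN x y : Ek (- x) (- y) = Ek x y.
Proof. by rewrite /Ek !normrN -opprD normrN. Qed.

(** With [S = |x| + |y|] and [D = |x - y| <= S], lowering the rate from [1 / 8] to [1 / 16] pays for
    the extra 1 in the exponent of [Ek]: [S D / 8 - (1 + S) D / 16 >= (D^2 - D) / 16 >= - 1 /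
    64]. *)
Lemma gauss_le_Ek x y q : (`|x| + `|y|) * `|x - y| / 8 <= q ->
  (1 + `|x|) * expR (- q) <= expR (1 / 64) * Ek x y.
Proof.
move=> h; rewrite /Ek mulrCA ler_wpM2l ?addr_ge0 // -expRD ler_expR.
have d := ler_normB x y; have := normr_ge0 (x - y).
move: h d; set S := `|x| + `|y|; set D := `|x - y|; rewrite -addrA -/S => h d D0.
have e1 : D ^+ 2 <= S * D by rewrite expr2 ler_wpM2r.
have := sqr_ge0 (D - 1 / 2); nra.
Qed.

Lemma Q0_even (k eps : R) (z : R[i]) t : Q k eps z 0 (- t) = Q k eps z 0 t.
Proof. by rewrite /Q /Ff /Sf sqrrN. Qed.

Lemma cpw_real (k s : R) : 0 < s -> cpw k s%:C = (s `^ (- (k / 2)))%:C.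
Proof.
move=> s0; rewrite /cpw ImC ReC mul0r atan0 mulr0 cis0 mulr1 ncC gtr0_norm //.
rewrite lnXn // /powR gt_eqF //; congr (expR _)%:C.
by rewrite -mulr_natl; field.
Qed.

Lemma Q0E (k eps : R) (z : R[i]) t :
  Q k eps z 0 t = (t ^+ 2)%:C + 'i / eps%:C * (1 / (1 + t ^+ 2) `^ (k / 2))%:C - z.
Proof.
have s0 : 0 < 1 + t ^+ 2 by have := sqr_ge0 t; lra.
rewrite /Q /Ff /Sf mulr0 cis0 !mul1r mulr1.
have -> : 1 + (t ^+ 2)%:C = (1 + t ^+ 2)%:C by rewrite realCD.
by rewrite cpw_real // powRN.
Qed.

Lemma cd_reflect (u u1 : R -> R[i]) : (forall t, cd u t (u1 t)) ->
  forall t, cd (fun t => u (- t)) t (- u1 (- t)).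
Proof.
move=> h t; apply: cd_eq (cd_comp (rd_opp t) (h (- t))) _.
by apply: ceq; rewrite !cE; ring.
Qed.

Variables (k eps : R) (z : R[i]).
Hypotheses (k0 : 0 < k) (eps0 : 0 < eps).
Let V := Q k eps z 0.

Variables (X C : R) (phi phi1 psi psi1 : R -> R[i]).
Hypotheses (X1 : 1 <= X) (C0 : 0 < C)
  (dphi : forall t, cd phi t (phi1 t)) (dphi1 : forall t, cd phi1 t (V t * phi t))
  (dpsi : forall t, cd psi t (psi1 t)) (dpsi1 : forall t, cd psi1 t (V t * psi t))
  (W : forall t, phi t * psi1 t - phi1 t * psi t = 1) (phiX : nc (phi X) = 1)
  (phig : forall s t, X <= s -> s <= t ->
       nc (phi s) * expR ((t ^+ 2 - s ^+ 2) / 4) <= nc (phi t))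
  (bnd : forall t, X <= t -> [/\ 0 < nc (phi t), nc (phi1 t) <= C * t ^+ 2 * nc (phi t),
      nc (psi t) <= C / (t * nc (phi t)) & nc (psi1 t) <= C * t / nc (phi t)]).

(** An amplitude that is positive on the whole half-line: [|phi|] beyond [X], and the constant
    [|phi X| = 1] before [X], where [phi] might vanish. *)
Let P x := nc (phi (Num.max x X)).

Lemma P_ge1 x : 1 <= P x.
Proof.
rewrite /P -phiX; set y := Num.max x X.
have Xy : X <= y by rewrite /y le_max lexx orbT.
have := phig (lexx X) Xy; rewrite phiX mul1r; apply: le_trans.
rewrite -expR0 ler_expR divr_ge0 // subr_ge0 ler_pXn2r ?nnegrE //; have := X1; lra.
Qed.

Lemma P_growth s t : 0 <= s -> s <= t ->
  P s * expR ((t ^+ 2 - s ^+ 2) / 4) <= expR (X ^+ 2 / 4) * P t.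
Proof.
move=> s0 st; rewrite /P; set s' := Num.max s X; set t' := Num.max t X.
have Xs : X <= s' by rewrite /s' le_max lexx orbT.
have st' : s' <= t' by rewrite /s' /t' ge_max !le_max st lexx orbT.
apply: (@le_trans _ _ (expR (X ^+ 2 / 4) * (nc (phi s') * expR ((t' ^+ 2 - s' ^+ 2) / 4)))).
  rewrite mulrCA ler_wpM2l ?nc_ge0 // -expRD ler_expR.
  have X0 : 0 <= X by have := X1; lra.
  have h1 : t ^+ 2 <= t' ^+ 2.
    by rewrite ler_pXn2r ?nnegrE // ?le_max ?lexx ?(le_trans s0 st).
  have h2 : s' ^+ 2 <= X ^+ 2 + s ^+ 2.
    by rewrite /s'; case: (leP s X) => _; rewrite ?lerDl ?lerDr sqr_ge0.
  lra.
by rewrite ler_wpM2l ?expR_ge0 // phig.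
Qed.

(** On [[0, X]] stability of the equation bounds everything and [P = 1]. Beyond [X] the bounds on
    [psi] are those of [bnd]; [psi (- x)] solves the same equation by evenness, hence is
    [al phi + be psi] with Wronskians as coefficients, at worst of size [P]. *)
Lemma psi_bounds : exists2 B : R, 0 < B & forall x, 0 <= x ->
  [/\ nc (psi x) <= B / ((1 + x) * P x), nc (psi1 x) <= B * (1 + x) / P x,
      nc (psi (- x)) <= B * P x & nc (psi1 (- x)) <= B * (1 + x) ^+ 2 * P x].
Proof.
have z0 := nc_ge0 z; have ei : 0 < 1 / eps by rewrite divr_gt0.
have o4 : `|0 : R| <= 1 / 4 by rewrite normr0; lra.
have XX1 := X1.
pose K := X ^+ 2 + (1 / eps + nc z + 1).
have K0 : 0 <= K by rewrite /K; have := sqr_ge0 X; lra.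
have hV t : 0 <= t <= X -> nc (V t) <= K.
  move=> /andP[t0 tX]; apply: le_trans (nc_Q z k0 eps0 t o4) _.
  by rewrite /K lerD2r ler_pXn2r ?nnegrE //; lra.
have compact (f f1 : R -> R[i]) : (forall t, cd f t (f1 t)) ->
    (forall t, cd f1 t (V t * f t)) ->
    exists2 B : R, 0 <= B & forall x, 0 <= x -> x <= X -> nc (f x) <= B /\ nc (f1 x) <= B.
  move=> df df1; pose d := nc (f 0) + nc (f1 0).
  have d0 : 0 <= d by rewrite addr_ge0 ?nc_ge0.
  exists (2 * d * expR ((2 + K) * X)) => [|x x0 xX].
    by rewrite !mulr_ge0 ?expR_ge0.
  have [] := @ode_stability _ f f1 V (fun=> 0) K d x K0 d0 x0.
  - by move=> t _.
  - by move=> t _; rewrite addr0.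
  - by move=> t /andP[t0 tx]; apply: hV; rewrite t0 (le_trans tx).
  - by move=> t _; rewrite nc0.
  - by rewrite lerDl nc_ge0.
  - by rewrite lerDr nc_ge0.
  have h : 2 * d * expR ((2 + K) * x) <= 2 * d * expR ((2 + K) * X).
    by rewrite ler_wpM2l ?mulr_ge0 // ler_expR ler_wpM2l // addr_ge0.
  by move=> h1 h2; split; [apply: le_trans h1 h|apply: le_trans h2 h].
pose v t := psi (- t); pose v1 t := - psi1 (- t).
have dv : forall t, cd v t (v1 t) by exact: cd_reflect.
have dv1 t : cd v1 t (V t * v t).
  apply: cd_eq (cdN (cd_reflect dpsi1 t)) _.
  by rewrite opprK /V Q0_even.
have [B1 B10 hB1] := compact _ _ dpsi dpsi1.
have [B2 B20 hB2] := compact _ _ dv dv1.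
pose al := v 0 * psi1 0 - v1 0 * psi 0.
pose be := phi 0 * v1 0 - phi1 0 * v 0.
have Wal t : v t * psi1 t - v1 t * psi t = al.
  by rewrite (wronskian_cst dv dv1 dpsi dpsi1 t 0).
have Wbe t : phi t * v1 t - phi1 t * v t = be.
  by rewrite (wronskian_cst dphi dphi1 dv dv1 t 0).
have vE t : v t = al * phi t + be * psi t.
  by rewrite -[LHS]mulr1 -(W t) -(Wal t) -(Wbe t); ring.
have v1E t : v1 t = al * phi1 t + be * psi1 t.
  by rewrite -[LHS]mulr1 -(W t) -(Wal t) -(Wbe t); ring.
have a0 := nc_ge0 al; have b0 := nc_ge0 be.
pose B := (B1 + B2) * (1 + X) + 2 * C + (nc al + nc be * C) * (1 + C).
have q1 : 0 <= (B1 + B2) * (1 + X) by rewrite mulr_ge0 ?addr_ge0 //; lra.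
have q2 : 0 <= (nc al + nc be * C) * (1 + C).
  by rewrite mulr_ge0 // addr_ge0 // ?mulr_ge0 // ltW.
have q3 : B1 <= (B1 + B2) * (1 + X) by nra.
have q4 : B2 <= (B1 + B2) * (1 + X) by nra.
have q5 : B1 * (1 + X) <= (B1 + B2) * (1 + X) by nra.
exists B; first by rewrite /B; have := C0; lra.
move=> x x0; have P1 := P_ge1 x.
have P0 : 0 < P x by lra.
have s1 : 0 < 1 + x by lra.
have [xX|Xx] := leP x X.
  have Px : P x = 1 by rewrite /P (max_idPr xX) phiX.
  have [h1 h2] := hB1 x x0 xX; have [h3 h4] := hB2 x x0 xX.
  rewrite Px !mulr1 divr1; rewrite /v1 ncN in h4; have CC := C0; split.
  - rewrite ler_pdivlMr //.
    have : nc (psi x) * (1 + x) <= B1 * (1 + X) by apply: ler_pM; rewrite ?nc_ge0 //; lra.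
    rewrite /B; lra.
  - apply: le_trans h2 _; rewrite -[leLHS]mulr1; apply: ler_pM => //; rewrite /B; lra.
  - apply: le_trans h3 _; rewrite /B; lra.
  - have e : 1 <= (1 + x) ^+ 2 by rewrite exprn_ege1; lra.
    apply: le_trans h4 _; rewrite -[leLHS]mulr1; apply: ler_pM => //; rewrite /B; lra.
have Px : P x = nc (phi x) by rewrite /P (max_idPl (ltW Xx)).
have [p0 h1 h2 h3] := bnd (ltW Xx); rewrite Px; rewrite Px in P1.
have xx : 1 <= x by lra.
have x0' : 0 < x by lra.
have CC := C0.
have ip : (nc (phi x))^-1 <= nc (phi x).
  by apply: (@le_trans _ _ 1); rewrite ?invf_le1.
have h2' : nc (psi x) <= C * nc (phi x).
  apply: le_trans h2 _; rewrite ler_wpM2l ?(ltW CC) //; apply: le_trans ip.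
  by rewrite lef_pV2 ?posrE ?mulr_gt0 // ler_peMl // ltW.
have h3' : nc (psi1 x) <= C * (1 + x) ^+ 2 * nc (phi x).
  apply: le_trans h3 _; apply: ler_pM => //; rewrite ?mulr_ge0 ?invr_ge0 ?(ltW CC) ?(ltW p0) //.
  rewrite ler_pM2l //; nra.
split.
- apply: le_trans h2 _; rewrite ler_pdivlMr ?mulr_gt0 //.
  have -> : C / (x * nc (phi x)) * ((1 + x) * nc (phi x)) = C * ((1 + x) / x).
    by field; rewrite !gt_eqF.
  have : C * ((1 + x) / x) <= C * 2 by rewrite ler_pM2l // ler_pdivrMr //; lra.
  rewrite /B; lra.
- apply: le_trans h3 _; rewrite ler_pM2r ?invr_gt0 //; apply: ler_pM; rewrite ?(ltW CC) //.
    rewrite /B; lra.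
  lra.
- rewrite -/(v x) vE; apply: le_trans (ncD _ _) _; rewrite !ncM.
  have : nc be * nc (psi x) <= nc be * (C * nc (phi x)) by rewrite ler_wpM2l.
  have : (nc al + nc be * C) * nc (phi x) <= B * nc (phi x).
    rewrite ler_pM2r // /B; have : 0 <= (nc al + nc be * C) * C.
      by rewrite mulr_ge0 ?addr_ge0 ?mulr_ge0 // ltW.
    lra.
  lra.
- rewrite -ncN -/(v1 x) v1E; apply: le_trans (ncD _ _) _; rewrite !ncM.
  have f1 : nc be * nc (psi1 x) <= nc be * (C * (1 + x) ^+ 2 * nc (phi x)) by rewrite ler_wpM2l.
  have f2 : nc al * nc (phi1 x) <= nc al * (C * (1 + x) ^+ 2 * nc (phi x)).
    rewrite ler_wpM2l //; apply: le_trans h1 _; rewrite ler_pM2r // ler_pM2l //.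
    by rewrite ler_pXn2r ?nnegrE //; lra.
  have f3 : 0 <= (1 + x) ^+ 2 * nc (phi x) by rewrite mulr_ge0 ?sqr_ge0 ?ltW.
  have f4 : (nc al * C + nc be * C) * ((1 + x) ^+ 2 * nc (phi x)) <= B * ((1 + x) ^+ 2 * nc (phi x)).
    rewrite ler_wpM2r // /B.
    have : 0 <= nc be * C * C by rewrite !mulr_ge0 // ltW.
    have : 0 <= nc be * C by rewrite !mulr_ge0 // ltW.
    lra.
  rewrite -mulrA; lra.
Qed.

(** Up to powers of [1 + |x|] the product is a ratio of amplitudes: [P y / P x] for [0 <= y <= x],
    [1 / (P x P (- y))] for [y <= 0 <= x], and [P (- x) / P (- y)] for [y <= x <= 0]. In each case
    the Gaussian growth of [P] makes it decay in the distance from [x] to [y]. *)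
Lemma psi_kernel : exists2 B : R, 0 < B & forall x y, y <= x ->
  (1 + `|x|) ^+ 2 * nc (psi x) * nc (psi (- y)) <= B * Ek x y /\
  nc (psi1 x) * nc (psi (- y)) <= B * Ek x y.
Proof.
have [B B0 hB] := psi_bounds.
pose E := expR (X ^+ 2 / 4).
have E0 : 0 < E by exact: expR_gt0.
have E1 : 1 <= E by rewrite /E -expR0 ler_expR divr_ge0 ?sqr_ge0.
pose D := B ^+ 2 * E ^+ 2 * expR (1 / 64).
have D0 : 0 < D by rewrite /D !mulr_gt0 ?exprn_gt0 ?expR_gt0.
have BE : 0 <= B ^+ 2 * E ^+ 2 by rewrite mulr_ge0 ?sqr_ge0.
have EE : E <= E ^+ 2 by rewrite expr2 ler_peMr // ltW.
(* [r] stands for the ratio of the amplitudes at [x] and [y]. *)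
have fin x y a b r q : 0 <= a -> 0 <= b -> a * b <= B ^+ 2 * (1 + `|x|) * r ->
    r <= E ^+ 2 * expR (- q) -> (`|x| + `|y|) * `|x - y| / 8 <= q -> a * b <= D * Ek x y.
  move=> a0 b0 ab rE hq; apply: le_trans ab _.
  have h := gauss_le_Ek hq.
  have m0 : 0 <= B ^+ 2 * (1 + `|x|) by rewrite mulr_ge0 ?sqr_ge0 // addr_ge0.
  apply: le_trans (ler_wpM2l m0 rE) _.
  have -> : B ^+ 2 * (1 + `|x|) * (E ^+ 2 * expR (- q)) =
    B ^+ 2 * E ^+ 2 * ((1 + `|x|) * expR (- q)) by ring.
  by rewrite /D -(mulrA (B ^+ 2 * E ^+ 2)) ler_wpM2l.
have Pp x : 0 < P x by apply: lt_le_trans (P_ge1 x).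
have ratio s t : 0 <= s -> s <= t -> P s / P t <= E ^+ 2 * expR (- ((t ^+ 2 - s ^+ 2) / 4)).
  move=> s0 st; rewrite ler_pdivrMr // expRN mulrAC ler_pdivlMr ?expR_gt0 //.
  apply: le_trans (P_growth s0 st) _; by rewrite ler_pM2r.
have ratio0 t : 0 <= t -> (P t)^-1 <= E * expR (- (t ^+ 2 / 4)).
  move=> t0; have := P_growth (lexx 0) t0; rewrite expr0n subr0 => h.
  rewrite expRN -div1r ler_pdivrMr // mulrAC ler_pdivlMr ?expR_gt0 // mul1r.
  by apply: le_trans h; rewrite ler_peMl ?expR_ge0 ?P_ge1.
exists D => // x y yx.
have m0 : 0 < 1 + `|x| by rewrite ltr_pwDl.
have n1 := nc_ge0 (psi x); have n2 := nc_ge0 (psi (- y)); have n3 := nc_ge0 (psi1 x).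
have n4 : 0 <= (1 + `|x|) ^+ 2 * nc (psi x) by rewrite mulr_ge0 ?sqr_ge0.
have [y0|/ltW y0] := leP 0 y.
  have x0 : 0 <= x by exact: le_trans yx.
  have [h1 h2 _ _] := hB x x0; have [_ _ h3 _] := hB y y0.
  have hq : (`|x| + `|y|) * `|x - y| / 8 <= (x ^+ 2 - y ^+ 2) / 4.
    rewrite !ger0_norm ?subr_ge0 //.
    have : 0 <= (x - y) * (x + y) by rewrite mulr_ge0 ?subr_ge0 ?addr_ge0.
    nra.
  rewrite ger0_norm // in n4 m0 *.
  split.
    apply: (fin x y _ _ _ _ n4 n2 _ (ratio _ _ y0 yx) hq); rewrite (ger0_norm x0).
    have := ler_pM n1 n2 h1 h3 => h; rewrite -[leLHS]mulrA.
    apply: le_trans (ler_wpM2l (sqr_ge0 _) h) _; apply: le_of_eq; field.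
    by rewrite !gt_eqF.
  apply: (fin x y _ _ _ _ n3 n2 _ (ratio _ _ y0 yx) hq); rewrite (ger0_norm x0).
  apply: le_trans (ler_pM n3 n2 h2 h3) _; apply: le_of_eq; field.
  by rewrite !gt_eqF.
have ny0 : 0 <= - y by lra.
have [h3 _ _ _] := hB _ ny0.
have [x0|/ltW x0] := leP 0 x.
  have [h1 h2 _ _] := hB x x0.
  have hq : (`|x| + `|y|) * `|x - y| / 8 <= x ^+ 2 / 4 + (- y) ^+ 2 / 4.
    rewrite (ger0_norm x0) (ler0_norm y0) ger0_norm; last by lra.
    by have := sqr_ge0 (x + y); nra.
  have rat : (P x)^-1 * (P (- y))^-1 <= E ^+ 2 * expR (- (x ^+ 2 / 4 + (- y) ^+ 2 / 4)).
    rewrite opprD expRD expr2 mulrACA; apply: ler_pM; rewrite ?invr_ge0 ?(ltW (Pp _)) //; exact: ratio0.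
  have h3' : nc (psi (- y)) <= B / P (- y).
    have m2 : 0 < 1 - y by lra.
    apply: le_trans h3 _; rewrite ler_pM2l // lef_pV2 ?posrE ?mulr_gt0 //.
    by rewrite ler_peMl ?(ltW (Pp _)) //; lra.
  rewrite ger0_norm // in n4 m0 *.
  split.
    apply: (fin x y _ _ _ _ n4 n2 _ rat hq); rewrite (ger0_norm x0).
    have := ler_pM n1 n2 h1 h3' => h; rewrite -[leLHS]mulrA.
    apply: le_trans (ler_wpM2l (sqr_ge0 _) h) _; apply: le_of_eq; field.
    by rewrite !gt_eqF.
  apply: (fin x y _ _ _ _ n3 n2 _ rat hq); rewrite (ger0_norm x0).
  apply: le_trans (ler_pM n3 n2 h2 h3') _; apply: le_of_eq; field.
  by rewrite !gt_eqF.
have nx0 : 0 <= - x by lra.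
have nyx : - x <= - y by lra.
have [_ _ h1 h2] := hB _ nx0; rewrite opprK in h1 h2.
have hq : (`|x| + `|y|) * `|x - y| / 8 <= ((- y) ^+ 2 - (- x) ^+ 2) / 4.
  rewrite (ler0_norm x0) (ler0_norm y0) ger0_norm; last by lra.
  have : 0 <= (x - y) * (- x - y) by rewrite mulr_ge0; lra.
  nra.
have h3' : nc (psi (- y)) <= B / ((1 - x) * P (- y)).
  apply: le_trans h3 _; rewrite ler_pM2l // lef_pV2 ?posrE ?mulr_gt0 // ?ler_pM2r //; lra.
have m1 : 0 < 1 - x by lra.
rewrite (ler0_norm x0) in n4 m0 *.
split.
  apply: (fin x y _ _ _ _ n4 n2 _ (ratio _ _ nx0 nyx) hq); rewrite (ler0_norm x0).
  have := ler_pM n1 n2 h1 h3' => h; rewrite -[leLHS]mulrA.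
  apply: le_trans (ler_wpM2l (sqr_ge0 _) h) _; apply: le_of_eq; field.
  by rewrite !gt_eqF.
apply: (fin x y _ _ _ _ n3 n2 _ (ratio _ _ nx0 nyx) hq); rewrite (ler0_norm x0).
apply: le_trans (ler_pM n3 n2 h2 h3') _; apply: le_of_eq; field.
by rewrite !gt_eqF.
Qed.

Lemma psi_exp_decay : exists2 B : R, 0 < B & forall x, 0 <= x ->
  nc (psi x) <= B * expR (- x) /\ nc (psi1 x) <= B * expR (- x).
Proof.
have [B B0 hB] := psi_bounds.
pose E := expR (X ^+ 2 / 4).
have E0 : 0 < E by exact: expR_gt0.
exists (B * (E * expR 4)); first by rewrite !mulr_gt0 ?expR_gt0.
move=> x x0; have [h1 h2 _ _] := hB x x0.
have Pp : 0 < P x by apply: lt_le_trans (P_ge1 x).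
have s1 : 0 < 1 + x by lra.
have hP : (P x)^-1 <= E * expR (- (x ^+ 2 / 4)).
  have := P_growth (lexx 0) x0; rewrite expr0n subr0 => h.
  rewrite expRN -div1r ler_pdivrMr // mulrAC ler_pdivlMr ?expR_gt0 // mul1r.
  by apply: le_trans h; rewrite ler_peMl ?expR_ge0 ?P_ge1.
(* [x^2 / 4 >= 2 x - 4]: one factor [e^{-x}] absorbs [1 + x] and the other remains. *)
have e : (1 + x) / P x <= E * expR 4 * expR (- x).
  apply: (@le_trans _ _ (expR x * (E * expR (- (x ^+ 2 / 4))))).
    apply: ler_pM => //; [lra|by rewrite invr_ge0 ltW|exact: expR_ge1Dx].
  rewrite mulrCA -mulrA ler_pM2l // -!expRD ler_expR.
  by have := sqr_ge0 (x - 4); lra.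
split.
  apply: le_trans h1 _; rewrite -mulrA ler_pM2l //; apply: le_trans e.
  rewrite invfM ler_wpM2r ?invr_ge0 ?(ltW Pp) //.
  by apply: (@le_trans _ _ 1); [rewrite invf_le1 //; lra|lra].
by apply: le_trans h2 _; rewrite -!mulrA ler_pM2l // mulrA.
Qed.

End GreenKernel.

Section GreenPair.
Context {R : realType}.
Implicit Types (x y t s T : R).

(** Collects what the resolvent construction takes from the differential equation. The bound on
    [Re z] acts through the nonvanishing at 0 alone; the decay and kernel estimates come from the
    asymptotics at infinity. [B] may depend on [eps] and [z], since the resolvent only has to be
    bounded, whereas [M] depends on [k] only. *)
Lemma green_pair (k : R) : 0 < k -> exists2 M : R, 0 < M &
  forall eps (z : R[i]), 0 < eps -> eps <= 1 ->
  Re z < M / eps `^ (Num.min (1 / 2) (2 / (k + 2))) ->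
  exists (psi psi1 : R -> R[i]) (B : R),
  [/\ forall t, cd psi t (psi1 t), forall t, cd psi1 t (Q k eps z 0 t * psi t),
      psi 0 != 0 /\ psi1 0 != 0,
      0 < B /\ (forall x, 0 <= x -> nc (psi x) <= B * expR (- x) /\ nc (psi1 x) <= B * expR (- x)) &
      forall x y, y <= x -> (1 + `|x|) ^+ 2 * nc (psi x) * nc (psi (- y)) <= B * Ek x y /\
        nc (psi1 x) * nc (psi (- y)) <= B * Ek x y].
Proof.
move=> k0; have [th [M [th0 th1 M0 hM]]] := scaled_potential_bound k0.
exists M => // eps z e0 e1 hz.
have o4 : `|0 : R| <= 1 / 4 by rewrite normr0; lra.
have z0 := nc_ge0 z; have ei : 0 < 1 / eps by rewrite divr_gt0.
have cV : cc (Q k eps z 0) by apply: cd_cc => t; exact: cd_Q_t.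
have ReV t : Re (Q k eps z 0 t) = t ^+ 2 - Re z.
  rewrite Q0E; have -> : 'i / eps%:C = (0 +i* eps^-1) :> R[i].
    rewrite -fmorphV; apply: ceq; rewrite !cE; ring.
  by rewrite !cE; ring.
have [||X [C [phi [phi1 [psi [psi1 [[X1 C0] [d1 d2 d3 d4] W [pX pg] bnd]]]]]]] :=
  @growing_recessive_pair _ (Q k eps z 0) (1 / eps + nc z + 1) (Re z) _ cV _ ReV.
- by lra.
- by move=> t; exact: nc_Q.
have [h [dh [H [h0 hd hH hP]]]] := hM eps e0 e1.
have [B1 B10 hB1] := psi_kernel k0 e0 X1 C0 d1 d2 d3 d4 W pX pg bnd.
have [B2 B20 hB2] := psi_exp_decay k0 e0 X1 C0 d1 d2 d3 d4 W pX pg bnd.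
exists psi, psi1, (B1 + B2); split => //.
- have [||w [w1 [D [w0 w10 dw dw1 dec]]]] := rotated_decay k0 e0 X1 C0 th0 th1 d3 d4 pX pg.
  + by move=> t /bnd [].
  + by move=> t /bnd [].
  have eta0 : 0 < M / eps `^ (Num.min (1 / 2) (2 / (k + 2))) - Re z by rewrite subr_gt0.
  have H0 : 0 <= H by have /andP[a b] := hH 1 ler01; rewrite mulr1 in b; exact: le_trans b.
  have D0 : 0 <= D.
    have := dec X (lexx X); have : 0 <= X ^+ 2 * nc (w X) ^+ 2 + nc (w1 X) ^+ 2.
      by apply: addr_ge0; [apply: mulr_ge0; exact: sqr_ge0|exact: sqr_ge0].
    move=> a b; have := le_trans a b; rewrite pmulr_lge0 // invr_gt0; lra.
  have key := @rotated_energy_zero _ k eps z k0 e0 w w1 th _ H X D h dh eta0 th0 th1 X1 H0 D0 h0 hd hH.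
  have nz : ~ (psi 0 = 0 /\ psi1 0 = 0).
    move=> [a b]; have := W 0; rewrite a b !mulr0 subr0 => /eqP.
    by rewrite eq_sym oner_eq0.
  (* This product is the boundary term of the energy at 0, up to a unimodular factor and a real
     part; it covers both a zero of [psi] and a zero of [psi1]. Both cannot vanish together, because
     the Wronskian with [phi] is 1. *)
  have {}key : (psi 0)^* * psi1 0 = 0 -> False.
    move=> e; apply: nz.
    have [||a b] := key _ dw dw1 dec.
    + by move=> t t0; rewrite addrC subrK; exact: hP.
    + by rewrite w0 w10 mulrCA e mulr0.
    rewrite w0 in a; rewrite w10 in b; split => //.
    by move/eqP: b; rewrite mulf_eq0 (negbTE (cis_neq0 _)) => /eqP.
  split; apply/eqP => e; apply: key; rewrite e ?mulr0 //.
  by apply: ceq; rewrite !cE; ring.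
- split; first by rewrite addr_gt0.
  move=> x x0; have [a b] := hB2 x x0.
  have : 0 <= B1 * expR (- x) by rewrite mulr_ge0 ?expR_ge0 // ltW.
  by rewrite mulrDl; lra.
- move=> x y yx; have [a b] := hB1 x y yx.
  have : 0 <= B2 * Ek x y by rewrite mulr_ge0 ?Ek_ge0 // ltW.
  by rewrite mulrDl; lra.
Qed.

End GreenPair.

(** * Absolutely continuous functions *)

Section Primitives.
Context {R : realType}.
Notation mu := (@lebesgue_measure R).
Implicit Types (F f G g : R -> R) (a b c x y t s : R).

(* Integral form of [F' = f], i.e. local absolute continuity of [F]. *)
Definition is_prim F f := measurable_fun [set: R] f /\
  forall a b, a <= b -> mu.-integrable `[a, b] (EFin \o f) /\
    F b - F a = \int[mu]_(x in `[a, b]) f x.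

Lemma integrable_scale (D : set R) f c : measurable D ->
  mu.-integrable D (EFin \o f) -> mu.-integrable D (EFin \o (fun x => c * f x)).
Proof.
move=> mD fi; rewrite (_ : EFin \o _ = (fun x => c%:E * (EFin \o f) x)%E) //.
exact: integrableZl.
Qed.

Lemma integrable_add (D : set R) f g : measurable D ->
  mu.-integrable D (EFin \o f) -> mu.-integrable D (EFin \o g) ->
  mu.-integrable D (EFin \o (fun x => f x + g x)).
Proof.
move=> mD fi gi; rewrite (_ : EFin \o _ = (EFin \o f) \+ (EFin \o g))%E //.
exact: integrableD.
Qed.

Lemma ae_imp (P Q : R -> Prop) : (forall x, P x -> Q x) ->
  {ae mu, forall x, P x} -> {ae mu, forall x, Q x}.
Proof.
by move=> h; apply: filterS => //; exact: (ae_filter_ringOfSetsType mu).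
Qed.

Lemma integrable_patch (D : set R) f : measurable D ->
  mu.-integrable D (EFin \o f) -> mu.-integrable [set: R] (EFin \o (f \_ D)).
Proof.
by move=> mD fi; rewrite -restrict_EFin; apply: (integrable_mkcond _ _).1.
Qed.

Lemma EFin_Rint (D : set R) f : measurable D -> mu.-integrable D (EFin \o f) ->
  (\int[mu]_(x in D) (f x)%:E)%E = (\int[mu]_(x in D) f x)%:E.
Proof. by move=> mD fi; rewrite /Rintegral fineK // integrable_fin_num. Qed.

Lemma Rint_split f a b c : mu.-integrable `[a, c] (EFin \o f) -> a <= b -> b <= c ->
  \int[mu]_(x in `[a, c]) f x = \int[mu]_(x in `[a, b]) f x + \int[mu]_(x in `[b, c]) f x.
Proof.
move=> fi ab bc; have := @Rintegral_itvB R f (BLeft a) (BRight c) b fi.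
rewrite !bnd_simp => /(_ ab bc) e.
have mf : mu.-integrable `]b, c] (EFin \o f).
  by apply: integrableS fi => //; apply: subset_itv; rewrite bnd_simp.
by rewrite -(Rintegral_itv_obnd_cbnd mf) -e addrC subrK.
Qed.

Lemma Rint_point f a : \int[mu]_(x in `[a, a]) f x = 0.
Proof. by rewrite set_itv1 Rintegral_set1. Qed.

Lemma prim_exists f : measurable_fun [set: R] f ->
  (forall a b, a <= b -> mu.-integrable `[a, b] (EFin \o f)) ->
  exists2 F : R -> R, F 0 = 0 & is_prim F f.
Proof.
move=> mf fi.
exists (fun x => if 0 <= x then \int[mu]_(t in `[0, x]) f t else - \int[mu]_(t in `[x, 0]) f t).
  by rewrite lexx Rint_point.
split=> // a b ab; split; first exact: fi.
have [a0|a0] := leP 0 a.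
  have b0 := le_trans a0 ab; rewrite b0.
  by rewrite (Rint_split (fi _ _ b0) a0 ab) addrC addKr.
have [b0|b0] := leP 0 b.
  by rewrite opprK addrC (Rint_split (fi _ _ ab) (ltW a0) b0).
rewrite opprK addrC (Rint_split (fi _ _ (ltW a0)) ab (ltW b0)).
by rewrite addrK.
Qed.

Lemma prim_cont F f : is_prim F f -> continuous F.
Proof.
move=> [mf h] x; pose a := x - 1; pose b := x + 1.
have ab : a < b by rewrite /a /b; lra.
have [fi _] := h a b (ltW ab).
have cP := parameterized_integral_continuous (ltW ab) fi.
have xab : x \in `]a, b[%R by rewrite in_itv /= /a /b; apply/andP; split; lra.
have FE y : y \in `[a, b]%R -> F y = F a + parameterized_integral mu a y f.
  rewrite in_itv /= => /andP[ay yb]; have [_ e] := h a y ay.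
  by rewrite /parameterized_integral -e addrC subrK.
have : {within `[a, b], continuous F}.
  apply: (@subspace_eq_continuous _ _ _ (fun y => F a + parameterized_integral mu a y f)).
    by move=> y; rewrite inE /= => yab; rewrite -FE.
  by move=> y; apply: cvgD; [exact: cvg_cst|exact: cP].
by move=> /(continuous_within_itvP _ ab) [+ _ _]; apply.
Qed.

Lemma cont_meas f : continuous f -> measurable_fun [set: R] f.
Proof. by move=> cf; exact: measurable_realfun.continuous_measurable_fun. Qed.

Lemma cont_bounded f a b : continuous f -> exists2 M : R, 0 <= M &
  forall x, a <= x <= b -> `|f x| <= M.
Proof.
move=> cf; have [ab|ba] := leP a b; last first.
  by exists 0 => // x /andP[ax xb]; have := le_lt_trans (le_trans ax xb) ba; rewrite ltxx.
have cn : {within `[a, b], continuous (fun x => `|f x|)}.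
  by apply: continuous_subspaceT => x; apply: cvg_norm; exact: cf.
have [c _ hc] := EVT_max ab cn; by exists `|f c| => // x xab; apply: hc; rewrite in_itv.
Qed.

Lemma integrable_mul_cont f g a b : measurable_fun [set: R] f -> continuous g ->
  mu.-integrable `[a, b] (EFin \o f) ->
  mu.-integrable `[a, b] (EFin \o (fun x => f x * g x)).
Proof.
move=> mf cg fi; have [M M0 hM] := cont_bounded a b cg.
apply: (@le_integrable _ _ R mu `[a, b] (measurable_itv _) _ (EFin \o (fun x => M * f x))).
- apply/measurable_EFinP; apply: measurable_funTS; apply: measurable_funM => //.
  exact: cont_meas.
- move=> x /=; rewrite in_itv /= => /hM h; rewrite lee_fin !normrM mulrC ler_wpM2r //.
  by rewrite (ger0_norm M0).
- exact: integrable_scale.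
Qed.

(* Fubini on the triangle [a <= y <= x <= b]. *)
Lemma prim_mul_aux F f G g a b : is_prim F f -> is_prim G g -> a <= b ->
  \int[mu]_(x in `[a, b]) (f x * (G x - G a)) = \int[mu]_(x in `[a, b]) (g x * (F b - F x)).
Proof.
move=> pF pG ab; have cF := prim_cont pF; have cG := prim_cont pG.
have [mf hF] := pF; have [mg hG] := pG.
have [fi _] := hF a b ab; have [gi _] := hG a b ab.
have mI : measurable `[a, b] by exact: measurable_itv.
pose f1 := f \_ `[a, b]; pose g1 := g \_ `[a, b].
have mf1 : measurable_fun [set: R] f1.
  by apply/(measurable_restrictT _ _).1 => //; exact: measurable_funTS.
have mg1 : measurable_fun [set: R] g1.
  by apply/(measurable_restrictT _ _).1 => //; exact: measurable_funTS.
have f1i : mu.-integrable [set: R] (EFin \o f1).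
  exact: integrable_patch.
have g1i : mu.-integrable [set: R] (EFin \o g1).
  exact: integrable_patch.
pose k (p : R * R) : R := if p.2 <= p.1 then f1 p.1 * g1 p.2 else 0.
have mk : measurable_fun [set: R * R] k.
  apply: measurable_fun_ifT.
  - by apply: measurable_realfun.measurable_fun_ler; [exact: measurable_snd|exact: measurable_fst].
  - apply: measurable_funM; first exact: measurableT_comp mf1 (@measurable_fst _ _ _ _).
    exact: measurableT_comp mg1 (@measurable_snd _ _ _ _).
  - exact: measurable_cst.
have kle p : `|k p| <= `|f1 p.1| * `|g1 p.2|.
  by rewrite /k; case: ifP => _; rewrite ?normrM // normr0 mulr_ge0.
have ki : (mu \x mu)%E.-integrable [set: R * R] (EFin \o k).
  apply/integrable12ltyP; first exact/measurable_EFinP.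
  pose Ng := (\int[mu]_y `|(g1 y)%:E|)%E.
  have Ngf : Ng \is a fin_num.
    by apply: integrable_fin_num => //; exact: integrable_abse.
  apply: (@le_lt_trans _ _ (\int[mu]_x (`|(f1 x)%:E| * Ng))%E).
    apply: ge0_le_integral => //.
    - by move=> x _; apply: integral_ge0.
    - have := @measurable_fun_fubini_tonelli_F _ _ _ _ _ mu (fun p => `|(k p)%:E|%E).
      apply => //; apply: measurableT_comp => //; exact/measurable_EFinP.
    - apply: emeasurable_funM => //; apply: measurableT_comp => //; exact/measurable_EFinP.
    - move=> x _; rewrite /Ng -ge0_integralZl //.
      + apply: ge0_le_integral => //.
        * apply: measurableT_comp => //; apply/measurable_EFinP.
          exact: (measurableT_comp mk (measurable_pair1 x)).
        * apply: emeasurable_funM => //; apply: measurableT_comp => //; exact/measurable_EFinP.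
        * by move=> y _ /=; rewrite -EFinM lee_fin; exact: (kle (x, y)).
      + by apply: measurableT_comp => //; exact/measurable_EFinP.
  rewrite -(fineK Ngf) ge0_integralZr //.
  - rewrite muleC; apply: lte_mul_pinfty => //.
      by rewrite lee_fin; apply: fine_ge0; exact: integral_ge0.
    by case/integrableP: f1i.
  - by apply: measurableT_comp => //; exact/measurable_EFinP.
  - by apply: fine_ge0; exact: integral_ge0.
have := Fubini ki.
have EL s : (\int[mu]_y (k (s, y))%:E)%E = ((fun x => f x * (G x - G a)) \_ `[a, b] s)%:E.
  rewrite patchE; case: ifPn => [|sab]; last first.
    apply: integral0_eq => y _; rewrite /k /= /f1 patchE (negbTE sab) mul0r.
    by case: ifP.
  rewrite inE /= in_itv /= => /andP[a_s sb].
  have [gsi e] := hG a s a_s; rewrite e.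
  transitivity (\int[mu]_y ((f s)%:E * ((EFin \o g) \_ `[a, s] y)))%E.
    apply: eq_integral => y _; rewrite /k /= /f1 /g1 !patchE.
    rewrite (_ : s \in `[a, b]%classic) ?inE /= ?in_itv /= ?a_s ?sb //.
    case: ifP => ys.
      case: ifPn; rewrite !mem_setE in_itv /= => h.
        have ay : a <= y by case/andP: h.
        by rewrite in_itv /= ay ys.
      case: ifPn; rewrite ?mulr0 ?mule0 // in_itv /= => /andP[ay _].
      by move: h; rewrite ay /= (le_trans ys sb).
    by case: ifPn; rewrite ?mule0 // mem_setE in_itv /= ys andbF.
  rewrite integralZl //; last by rewrite restrict_EFin; exact: integrable_patch.
  by rewrite -integral_mkcond EFin_Rint // EFinM.
have ER t : (\int[mu]_x (k (x, t))%:E)%E = ((fun x => g x * (F b - F x)) \_ `[a, b] t)%:E.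
  rewrite patchE; case: ifPn => [|tab]; last first.
    have g0 : g1 t = 0 by rewrite /g1 patchE (negbTE tab).
    apply: integral0_eq => y _; rewrite /k /= g0 mulr0.
    by case: ifP.
  rewrite inE /= in_itv /= => /andP[a_t tb].
  have [fti e] := hF t b tb; rewrite e.
  transitivity (\int[mu]_y ((g t)%:E * ((EFin \o f) \_ `[t, b] y)))%E.
    have g0 : g1 t = g t by rewrite /g1 patchE mem_setE in_itv /= a_t tb.
    apply: eq_integral => y _; rewrite /k /= g0 /f1 !patchE.
    case: ifP => ys.
      case: ifPn; rewrite !mem_setE in_itv /= => h.
        have yb : y <= b by case/andP: h.
        by rewrite in_itv /= yb ys -EFinM mulrC.
      case: ifPn; rewrite ?mul0r ?mule0 // in_itv /= => /andP[_ yb].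
      by move: h; rewrite yb /= (le_trans a_t ys).
    by case: ifPn; rewrite ?mule0 // mem_setE in_itv /= ys.
  rewrite integralZl //; last by rewrite restrict_EFin; exact: integrable_patch.
  by rewrite -integral_mkcond EFin_Rint // EFinM.
move=> /=; under eq_integral do rewrite EL; under [in RHS]eq_integral do rewrite ER.
by move=> e; rewrite [in LHS]Rintegral_mkcond [in RHS]Rintegral_mkcond /Rintegral e.
Qed.

(** The product rule for absolutely continuous functions, in integrated form: expanding both sides
    of the identity on the triangle gives integration by parts. *)
Lemma prim_mul F f G g : is_prim F f -> is_prim G g ->
  is_prim (fun x => F x * G x) (fun x => f x * G x + F x * g x).
Proof.
move=> pF pG; have cF := prim_cont pF; have cG := prim_cont pG.
have [mf hF] := pF; have [mg hG] := pG; split.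
  by apply: measurable_funD; apply: measurable_funM => //; exact: cont_meas.
move=> a b ab; have [fi e1] := hF a b ab; have [gi e2] := hG a b ab.
have mI : measurable `[a, b] by exact: measurable_itv.
have fGi : mu.-integrable `[a, b] (EFin \o (fun x => f x * G x)).
  exact: integrable_mul_cont.
have gFi : mu.-integrable `[a, b] (EFin \o (fun x => g x * F x)).
  exact: integrable_mul_cont.
have eF : (fun x => f x * G x + F x * g x) = (fun x => f x * G x + g x * F x).
  by apply/funext => x; rewrite [F x * _]mulrC.
rewrite eF; split.
  exact: integrable_add.
rewrite RintegralD //.
have := prim_mul_aux pF pG ab.
have -> : \int[mu]_(x in `[a, b]) (f x * (G x - G a)) =
    \int[mu]_(x in `[a, b]) (f x * G x) - G a * (F b - F a).
  rewrite e1 -RintegralZl // -RintegralB //; last exact: integrable_scale.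
  by apply: eq_Rintegral => x _; ring.
have -> : \int[mu]_(x in `[a, b]) (g x * (F b - F x)) =
    F b * (G b - G a) - \int[mu]_(x in `[a, b]) (g x * F x).
  rewrite e2 -RintegralZl // -RintegralB //; last exact: integrable_scale.
  by apply: eq_Rintegral => x _; ring.
move=> h; apply/eqP; rewrite -subr_eq0; apply/eqP.
move: h; set u := Rintegral _ _ _; set v := Rintegral _ _ _ => h.
have -> : u = F b * (G b - G a) - v + G a * (F b - F a) by rewrite -h; ring.
by ring.
Qed.

Lemma prim_add F f G g : is_prim F f -> is_prim G g ->
  is_prim (fun x => F x + G x) (fun x => f x + g x).
Proof.
move=> [mf hF] [mg hG]; split; first exact: measurable_funD.
move=> a b ab; have [fi e1] := hF a b ab; have [gi e2] := hG a b ab.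
have mI : measurable `[a, b] by exact: measurable_itv.
split; first exact: integrable_add.
by rewrite RintegralD // -e1 -e2; ring.
Qed.

Lemma prim_scale F f c : is_prim F f -> is_prim (fun x => c * F x) (fun x => c * f x).
Proof.
move=> [mf hF]; split; first by apply: measurable_funM => //; exact: measurable_cst.
move=> a b ab; have [fi e1] := hF a b ab.
have mI : measurable `[a, b] by exact: measurable_itv.
split; first exact: integrable_scale.
by rewrite RintegralZl // -e1; ring.
Qed.

Lemma prim_of_rd F f : (forall x, rd F x (f x)) -> continuous f -> is_prim F f.
Proof.
move=> h cf; split; first exact: cont_meas.
move=> a b ab; split.
  by apply: continuous_compact_integrable; [exact: segment_compact|exact: continuous_subspaceT].
move: ab; rewrite le_eqVlt => /predU1P[<-|ab]; first by rewrite Rint_point subrr.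
rewrite /Rintegral (@continuous_FTC2 R f F a b ab) //.
- exact: continuous_subspaceT.
- split.
  + by move=> x _; have [] := h x.
  + by apply: cvg_at_right_filter; exact: rd_cont (h a).
  + by apply: cvg_at_left_filter; exact: rd_cont (h b).
- by move=> x _; have [] := h x.
Qed.

Lemma prim_rd F f : is_prim F f -> continuous f -> forall x, rd F x (f x).
Proof.
move=> pF cf x; have [H H0 hH] := antiderivative cf.
have [_ h1] := pF; have [_ h2] := prim_of_rd hH cf.
have e y : F y = F 0 + H y.
  have [y0|/ltW y0] := leP 0 y.
    have [_ a1] := h1 _ _ y0; have [_ a2] := h2 _ _ y0.
    by rewrite H0 in a2; lra.
  have [_ a1] := h1 _ _ y0; have [_ a2] := h2 _ _ y0.
  by rewrite H0 in a2; lra.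
have -> : F = (fun y => F 0 + H y) by apply/funext.
by apply: rd_eq (rdD (rd_cst (F 0) x) (hH x)) _; rewrite add0r.
Qed.

Lemma ae_eq_Rint (D : set R) f g : measurable D -> measurable_fun [set: R] f ->
  measurable_fun [set: R] g -> {ae mu, forall x, f x = g x} ->
  \int[mu]_(x in D) f x = \int[mu]_(x in D) g x.
Proof.
move=> mD mf mg h; rewrite /Rintegral; congr fine; apply: ae_eq_integral => //.
- by apply/measurable_EFinP; exact: measurable_funTS.
- by apply/measurable_EFinP; exact: measurable_funTS.
- by apply: ae_imp h => x /= -> _.
Qed.

Lemma ae_integrable (D : set R) f g : measurable D -> measurable_fun [set: R] f ->
  measurable_fun [set: R] g -> {ae mu, forall x, f x = g x} ->
  mu.-integrable D (EFin \o f) -> mu.-integrable D (EFin \o g).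
Proof.
move=> mD mf mg h /integrableP [m1 m2]; apply/integrableP; split.
  by apply/measurable_EFinP; exact: measurable_funTS.
rewrite (_ : (\int[mu]_(x in D) `|(EFin \o g) x|)%E = (\int[mu]_(x in D) `|(EFin \o f) x|)%E) //.
apply: ge0_ae_eq_integral => //.
- by apply: measurableT_comp => //; apply/measurable_EFinP; exact: measurable_funTS.
- by apply: measurableT_comp => //; apply/measurable_EFinP; exact: measurable_funTS.
- by apply: ae_imp h => x /= -> _.
Qed.

Lemma prim_cst c : is_prim (fun=> c) (fun=> 0).
Proof. by apply: prim_of_rd => x; [exact: rd_cst|exact: cvg_cst]. Qed.

Lemma prim_ae F f g : is_prim F f -> measurable_fun [set: R] g ->
  {ae mu, forall x, f x = g x} -> is_prim F g.
Proof.
move=> [mf hF] mg h; split => // a b ab; have [fi e] := hF a b ab; split.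
  by apply: ae_integrable h fi.
by rewrite e; apply: ae_eq_Rint.
Qed.

End Primitives.

(** * Almost everywhere derivatives and integrals over half-lines *)

Section AePrimitives.
Context {R : realType}.
Notation mu := (@lebesgue_measure R).
Implicit Types (F f G g : R -> R) (a b c x y t s : R).

Lemma rd_near F G x l (e : R) : 0 < e -> (forall y, `|y - x| < e -> F y = G y) ->
  rd F x l -> rd G x l.
Proof.
move=> e0 h /rdP d; apply/rdP; apply: (@near_eq_is_derive R R R F) d.
by near=> t; apply: h; rewrite distrC; near: t; exact: cvgr_dist_lt.
Unshelve. all: by end_near. Qed.

(** Lebesgue differentiation is applied to the truncation of [f] to [[-n, n]], which is integrable
    on the whole line and whose integral from [-n] differs from [F] by a constant inside; countably
    many [n] cover all points. *)
Lemma prim_ae_rd F f : is_prim F f -> {ae mu, forall x, rd F x (f x)}.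
Proof.
move=> [mf hF].
suff : {ae mu, forall x, forall n : nat, - n%:R < x < n%:R -> rd F x (f x)}.
  apply: ae_imp => x h; apply: (h (Num.Def.archi_bound x)).
  by rewrite -ltr_norml; exact: unstable.ltr_norm_bound.
apply: ae_foralln => n; pose I : set R := `[- n%:R, n%:R]%classic.
have mI : measurable I by exact: measurable_itv.
have fi : mu.-integrable I (EFin \o f) by apply: (hF _ _ _).1; rewrite ge0_cp.
pose g := f \_ I.
have gi : mu.-integrable [set: R] (EFin \o g) by exact: integrable_patch.
have lg : locally_integrable [set: R] g by exact: integrable_locally_restrict.
have := @FTC1 R g (BLeft (- n%:R)) _ lg => /(_ _)/=.
have hgi y : mu.-integrable [set` Interval (BLeft (- n%:R)) (BRight y)] (EFin \o g).
  by apply: integrableS gi.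
move=> /(_ hgi); apply: ae_imp => x h /andP[nx xn].
have [|d1 d2] := h _; first by rewrite lte_fin.
pose e := Num.min (x + n%:R) (n%:R - x).
have e0 : 0 < e by rewrite lt_min; apply/andP; split; lra.
have gx : g x = f x.
  by rewrite /g patchE mem_setE in_itv /= !ltW.
have : rd (fun y => F (- n%:R) + \int[mu]_(t in `[- n%:R, y]) g t) x (f x).
  by apply: rd_eq (rdD (rd_cst _ _) (conj d1 d2)) _; rewrite add0r gx.
apply: rd_near e0 _ => y; rewrite lt_min !ltr_norml => /andP[/andP[y1 y2] /andP[y3 y4]].
have ny : - n%:R <= y by lra.
have [_ e1] := hF _ _ ny.
suff -> : \int[mu]_(t in `[- n%:R, y]) g t = \int[mu]_(t in `[- n%:R, y]) f t.
  by rewrite -e1; ring.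
apply: eq_Rintegral => t; rewrite inE /= in_itv /= => /andP[t1 t2].
by rewrite /g patchE mem_setE in_itv /= t1 /= (le_trans t2) //; lra.
Qed.

Lemma ae_exists (P : R -> Prop) : {ae mu, forall x, P x} -> exists x, P x.
Proof.
move=> h; apply: contrapT => /forallNP hn.
have : {ae mu, forall x, False} by apply: ae_imp h => x /hn.
move=> [N [mN N0 hN]].
have : (mu `[0%R, 1%R] <= mu N)%E.
  by apply: le_measure; rewrite ?inE // => x _; apply: hN.
by rewrite N0 lebesgue_measure_itv /= lte_fin ltr01 oppr0 adde0 lee_fin ler10.
Qed.

Lemma ae_and (P Q : R -> Prop) : {ae mu, forall x, P x} -> {ae mu, forall x, Q x} ->
  {ae mu, forall x, P x /\ Q x}.
Proof.
move=> h1 h2; apply: filterS2 h1 h2; first exact: (ae_filter_ringOfSetsType mu).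
by move=> x p q.
Qed.

Lemma ae_all (P : R -> Prop) : (forall x, P x) -> {ae mu, forall x, P x}.
Proof.
by move=> h; apply: filterE => //; exact: (ae_filter_ringOfSetsType mu).
Qed.

(* [F] is differentiable somewhere by Lebesgue's theorem, and the invariance
   carries the derivative to every other point. *)
Lemma prim_shift_invariant F f : is_prim F f ->
  (forall a b d, 0 < d -> F (a + d) - F a = F (b + d) - F b) ->
  exists c, {ae mu, forall x, f x = c}.
Proof.
move=> pF h; have hae := prim_ae_rd pF; have [x0 hx0] := ae_exists hae.
exists (f x0); apply: ae_imp hae => x hx.
have e y : F y = F x + (F (y + (x0 - x)) - F x0).
  have [xy|xy] := ltP x y.
    have := h x x0 (y - x); rewrite subr_gt0 => /(_ xy).
    have -> : x + (y - x) = y by ring.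
    have -> : x0 + (y - x) = y + (x0 - x) by ring.
    by move=> <-; ring.
  move: xy; rewrite le_eqVlt => /predU1P[->|xy].
    have -> : x + (x0 - x) = x0 by ring.
    by ring.
  have := h y (y + (x0 - x)) (x - y); rewrite subr_gt0 => /(_ xy).
  have -> : y + (x - y) = x by ring.
  have -> : y + (x0 - x) + (x - y) = x0 by ring.
  by move=> e; rewrite -[F y](subrK (F x)) -opprB e; ring.
have h2 : rd F x (f x0).
  have -> : F = (fun y => F x + (F (y + (x0 - x)) - F x0)) by apply/funext.
  have h3 : rd (fun y => y + (x0 - x)) x 1.
    by apply: rd_eq (rdD (rd_id x) (rd_cst (x0 - x) x)) _; rewrite addr0.
  have h4 : rd F ((fun y => y + (x0 - x)) x) (f x0).
    by rewrite /= (_ : x + (x0 - x) = x0) //; ring.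
  by apply: rd_eq (rdD (rd_cst _ _) (rdB (rd_comp h3 h4) (rd_cst _ _))) _; ring.
by case: hx => _ <-; case: h2.
Qed.

Lemma prim_right f : measurable_fun [set: R] f ->
  (forall x, mu.-integrable `[x, +oo[ (EFin \o f)) ->
  is_prim (fun x => \int[mu]_(t in `[x, +oo[) f t) (fun x => - f x).
Proof.
move=> mf fi; split; first exact: measurableT_comp.
move=> a b ab.
have fab : mu.-integrable `[a, b] (EFin \o f).
  by apply: integrableS (fi a) => //; apply: subset_itv; rewrite bnd_simp.
split.
  rewrite (_ : EFin \o _ = EFin \o (fun x => (-1) * f x)); last first.
    by apply/funext => x /=; rewrite mulN1r.
  exact: integrable_scale.
have := @Rintegral_itvB R f (BLeft a) (BInfty _ false) b (fi a).
rewrite !bnd_simp => /(_ ab isT).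
have fb : mu.-integrable `]b, +oo[ (EFin \o f).
  by apply: integrableS (fi b) => //; apply: subset_itv; rewrite bnd_simp.
rewrite (Rintegral_itv_obnd_cbnd fb) => <-.
have -> : (fun x => - f x) = (fun x => (-1) * f x) by apply/funext => x; rewrite mulN1r.
by rewrite RintegralZl //; ring.
Qed.

Lemma prim_left f : measurable_fun [set: R] f ->
  (forall x, mu.-integrable `]-oo, x] (EFin \o f)) ->
  is_prim (fun x => \int[mu]_(t in `]-oo, x]) f t) f.
Proof.
move=> mf fi; split => // a b ab.
have fab : mu.-integrable `[a, b] (EFin \o f).
  by apply: integrableS (fi b) => //; apply: subset_itv; rewrite bnd_simp.
split => //.
have := @Rintegral_itvB R f (BInfty _ true) (BRight b) a (fi b).
rewrite !bnd_simp => /(_ isT ab) ->.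
apply: Rintegral_itv_obnd_cbnd.
by apply: integrableS fab => //; apply: subset_itv; rewrite bnd_simp.
Qed.

(** Monotone convergence along the intervals [[-n, n]]: a bounded primitive, such as a multiple of
    the arctangent, bounds the integral over the line. *)
Lemma prim_growth F f A : (forall x, 0 <= f x) -> is_prim F f ->
  (forall a b, a <= b -> F b - F a <= A) -> (\int[mu]_x (f x)%:E <= A%:E)%E.
Proof.
move=> f0 [mf hF] hA; pose D (n : nat) : set R := `[- n%:R, n%:R]%classic.
have mD n : measurable (D n) by exact: measurable_itv.
have hD : {homo D : n m / (n <= m)%N >-> (n <= m)%O}.
  move=> n m nm; apply/subsetPset; apply: subset_itv; rewrite bnd_simp ?lerN2 ler_nat //.
have eD : \bigcup_i D i = [set: R].
  apply/seteqP; split => // x _; exists (Num.Def.archi_bound x) => //=.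
  rewrite /D /= in_itv /=; have := unstable.ltr_norm_bound x.
  by rewrite ltr_norml => /andP[/ltW -> /ltW ->].
have cv : ((fun n => \int[mu]_(x in D n) (f x)%:E) n @[n --> \oo] -->
    \int[mu]_(x in \bigcup_i D i) (f x)%:E)%E.
  apply: ge0_nondecreasing_set_cvg_integral => //.
  - by move=> n; apply/measurable_EFinP; exact: measurable_funTS.
  - by move=> n x _; rewrite lee_fin.
rewrite -eD; apply: (cvge_to_le cv).
apply: nearW => n; have nn : - n%:R <= n%:R :> R by rewrite ge0_cp.
have [fi e] := hF _ _ nn; have := hA _ _ nn; rewrite e => le.
by rewrite EFin_Rint.
Qed.

End AePrimitives.

(** * Square integrable functions *)

Section ComplexPrimitives.
Context {R : realType}.
Notation mu := (@lebesgue_measure R).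
Implicit Types (F f G g u v : R -> R[i]) (a b c x y t s : R).

Definition mC u := measurable_fun [set: R] (fun x => Re (u x)) /\
  measurable_fun [set: R] (fun x => Im (u x)).

Definition is_primC F f := is_prim (fun x => Re (F x)) (fun x => Re (f x)) /\
  is_prim (fun x => Im (F x)) (fun x => Im (f x)).

Lemma is_prim_ext (F f F' f' : R -> R) : is_prim F f -> F =1 F' -> f =1 f' -> is_prim F' f'.
Proof. by move=> h /funext <- /funext <-. Qed.

Lemma is_primC_ext F f F' f' : is_primC F f -> F =1 F' -> f =1 f' -> is_primC F' f'.
Proof. by move=> h /funext <- /funext <-. Qed.

Lemma prim_sub (F f G g : R -> R) : is_prim F f -> is_prim G g ->
  is_prim (fun x => F x - G x) (fun x => f x - g x).
Proof.
move=> h1 h2; apply: (is_prim_ext (prim_add h1 (prim_scale (-1) h2))) => x; ring.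
Qed.

Lemma primCD F f G g : is_primC F f -> is_primC G g ->
  is_primC (fun x => F x + G x) (fun x => f x + g x).
Proof.
move=> [f1 f2] [g1 g2]; split.
  by apply: (is_prim_ext (prim_add f1 g1)) => x; rewrite ReD.
by apply: (is_prim_ext (prim_add f2 g2)) => x; rewrite ImD.
Qed.

Lemma primCM F f G g : is_primC F f -> is_primC G g ->
  is_primC (fun x => F x * G x) (fun x => f x * G x + F x * g x).
Proof.
move=> [f1 f2] [g1 g2]; split.
  apply: (is_prim_ext (prim_sub (prim_mul f1 g1) (prim_mul f2 g2))) => x.
    by rewrite !cE.
  by rewrite !cE; ring.
apply: (is_prim_ext (prim_add (prim_mul f1 g2) (prim_mul f2 g1))) => x.
  by rewrite !cE; ring.
by rewrite !cE; ring.
Qed.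

Lemma mC_cc F : cc F -> mC F.
Proof. by move=> [h1 h2]; split; exact: cont_meas. Qed.

Lemma primC_cc F f : is_primC F f -> cc F.
Proof. by move=> [/prim_cont h1 /prim_cont h2]. Qed.

Lemma primC_of_cd F f : (forall x, cd F x (f x)) -> cc f -> is_primC F f.
Proof. by move=> h [c1 c2]; split; apply: prim_of_rd => // x; case: (h x). Qed.

Lemma primC_cd F f : is_primC F f -> cc f -> forall x, cd F x (f x).
Proof. by move=> [h1 h2] [c1 c2] x; split; [exact: prim_rd h1 c1 x|exact: prim_rd h2 c2 x]. Qed.

Lemma primC_cst (c : R[i]) : is_primC (fun=> c) (fun=> 0).
Proof. by split; exact: prim_cst. Qed.

Lemma primCZ (c : R[i]) F f : is_primC F f -> is_primC (fun x => c * F x) (fun x => c * f x).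
Proof.
by move=> h; apply: (is_primC_ext (primCM (primC_cst c) h)) => x //; rewrite mul0r add0r.
Qed.

Lemma primCB F f G g : is_primC F f -> is_primC G g ->
  is_primC (fun x => F x - G x) (fun x => f x - g x).
Proof.
by move=> h1 h2; apply: (is_primC_ext (primCD h1 (primCZ (-1) h2))) => x; rewrite mulN1r.
Qed.

Lemma mCM u v : mC u -> mC v -> mC (fun x => u x * v x).
Proof.
move=> [u1 u2] [v1 v2]; split.
  under eq_fun do rewrite cE.
  by apply: measurable_funB; apply: measurable_funM.
under eq_fun do rewrite cE.
by apply: measurable_funD; apply: measurable_funM.
Qed.

Lemma mCD u v : mC u -> mC v -> mC (fun x => u x + v x).
Proof.
move=> [u1 u2] [v1 v2]; split.
  by under eq_fun do rewrite ReD; exact: measurable_funD.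
by under eq_fun do rewrite ImD; exact: measurable_funD.
Qed.

Lemma mCN u : mC u -> mC (fun x => - u x).
Proof.
move=> [u1 u2]; split.
  by under eq_fun do rewrite ReN; exact: measurableT_comp.
by under eq_fun do rewrite ImN; exact: measurableT_comp.
Qed.

Lemma mCB u v : mC u -> mC v -> mC (fun x => u x - v x).
Proof. by move=> mu_ mv; apply: mCD mu_ (mCN mv). Qed.

Lemma primC_mC F f : is_primC F f -> mC f.
Proof. by move=> [[] ? _ []]. Qed.

Lemma primC_ae F f g : is_primC F f -> mC g -> {ae mu, forall x, f x = g x} -> is_primC F g.
Proof.
move=> [h1 h2] [m1 m2] h; split; [apply: prim_ae h1 m1 _|apply: prim_ae h2 m2 _];
  by apply: ae_imp h => x ->.
Qed.

(** The estimates are carried out on the squared norm, a plain integral; [L2normE] and [L2norm_le]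
    translate back to the norm with its power [1 / 2]. *)
Definition L2sq u := (\int[mu]_x (nc (u x) ^+ 2)%:E)%E.

Lemma meas_nc2 u : mC u -> measurable_fun [set: R] (fun x => nc (u x) ^+ 2).
Proof.
move=> [u1 u2]; under eq_fun do rewrite nc_sqr.
by apply: measurable_funD; exact: measurable_funX.
Qed.

Lemma meas_nc u : mC u -> measurable_fun [set: R] (fun x => nc (u x)).
Proof.
move=> m; have -> : (fun x => nc (u x)) = (@Num.sqrt R) \o (fun x => nc (u x) ^+ 2).
  by apply/funext => x /=; rewrite sqrtr_sqr ger0_norm // nc_ge0.
apply: measurableT_comp; last exact: meas_nc2.
by apply: cont_meas; exact: sqrt_continuous.
Qed.

Lemma L2sq_ge0 u : (0 <= L2sq u)%E.
Proof. by apply: integral_ge0 => x _; rewrite lee_fin sqr_ge0. Qed.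

Lemma L2normE u : L2norm u = (L2sq u `^ 2^-1)%E.
Proof.
rewrite /L2norm unlock; congr (_ `^ _)%E; apply: eq_integral => x _.
by rewrite /= ger0_norm ?nc_ge0 // powR_mulrn // nc_ge0.
Qed.

Lemma L2P u : L2 u <-> mC u /\ (L2sq u < +oo)%E.
Proof.
rewrite /L2 /mkset L2normE; split.
  move=> [m1 m2 h]; split => //; apply: lty_poweRy h.
  by rewrite invr_eq0.
move=> [[m1 m2] h]; split => //.
exact: poweR_lty.
Qed.

Lemma L2norm_le u v c : 0 <= c -> (L2sq u <= (c ^+ 2)%:E * L2sq v)%E ->
  (L2norm u <= c%:E * L2norm v)%E.
Proof.
move=> c0 h; rewrite !L2normE.
have -> : c%:E = ((c ^+ 2)%:E `^ 2^-1)%E.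
  by rewrite poweR_EFin powR12_sqrt ?sqr_ge0 // sqrtr_sqr ger0_norm.
rewrite -poweRM ?L2sq_ge0 ?lee_fin ?sqr_ge0 //.
apply: gt0_ler_poweR => //; rewrite in_itv /= leey andbT ?L2sq_ge0 //.
by rewrite mule_ge0 ?L2sq_ge0 // lee_fin sqr_ge0.
Qed.

Lemma L2sq_dom u v c : mC u -> mC v -> 0 <= c ->
  (forall x, nc (u x) ^+ 2 <= c * nc (v x) ^+ 2) -> (L2sq u <= c%:E * L2sq v)%E.
Proof.
move=> m1 m2 c0 h; rewrite /L2sq -ge0_integralZl_EFin //.
- apply: ge0_le_integral => //.
  + by move=> x _; rewrite lee_fin sqr_ge0.
  + by apply/measurable_EFinP; exact: meas_nc2.
  + by apply: emeasurable_funM => //; apply/measurable_EFinP; exact: meas_nc2.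
  + by move=> x _; rewrite -EFinM lee_fin.
- by move=> x _; rewrite lee_fin sqr_ge0.
- by apply/measurable_EFinP; exact: meas_nc2.
Qed.

Lemma L2_dom u v c : mC u -> L2 v -> 0 <= c -> (forall x, nc (u x) <= c * nc (v x)) -> L2 u.
Proof.
move=> m /L2P[mv h] c0 le; apply/L2P; split => //.
apply: le_lt_trans (L2sq_dom m mv (sqr_ge0 c) _) _.
  by move=> x; rewrite -exprMn; apply: lerXn2r => //; rewrite nnegrE ?mulr_ge0 ?nc_ge0.
by apply: lte_mul_pinfty => //; rewrite lee_fin sqr_ge0.
Qed.

Lemma L2_add u v : L2 u -> L2 v -> L2 (fun x => u x + v x).
Proof.
move=> /L2P[m1 h1] /L2P[m2 h2]; apply/L2P; split; first exact: mCD.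
have le : (L2sq (fun x => (u x + v x)%R) <= 2%:E * (L2sq u + L2sq v))%E.
  rewrite /L2sq -ge0_integralD //; last 4 first.
  - by move=> x _; rewrite lee_fin sqr_ge0.
  - by apply/measurable_EFinP; exact: meas_nc2.
  - by move=> x _; rewrite lee_fin sqr_ge0.
  - by apply/measurable_EFinP; exact: meas_nc2.
  rewrite -ge0_integralZl_EFin //; last 2 first.
  - by move=> x _; rewrite -EFinD lee_fin addr_ge0 ?sqr_ge0.
  - by apply: emeasurable_funD; apply/measurable_EFinP; exact: meas_nc2.
  apply: ge0_le_integral => //.
  - by move=> x _; rewrite lee_fin sqr_ge0.
  - by apply/measurable_EFinP; apply: meas_nc2; exact: mCD.
  - apply: emeasurable_funM => //.
    by apply: emeasurable_funD; apply/measurable_EFinP; exact: meas_nc2.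
  - move=> x _; rewrite -EFinD -EFinM lee_fin.
    have := ncD (u x) (v x); have := nc_ge0 (u x + v x).
    have := nc_ge0 (u x); have := nc_ge0 (v x).
    move: (nc (u x + v x)) (nc (u x)) (nc (v x)) => r p q q0 p0 r0 h.
    have := sqr_ge0 (p - q); have : r ^+ 2 <= (p + q) ^+ 2.
      by apply: lerXn2r => //; rewrite nnegrE addr_ge0.
    by rewrite !expr2; nra.
apply: le_lt_trans le _; apply: lte_mul_pinfty => //.
by rewrite lte_add_pinfty.
Qed.

Lemma L2N u : L2 u -> L2 (fun x => - u x).
Proof.
move=> h; apply: (@L2_dom _ u 1) => //; last by move=> x; rewrite ncN mul1r.
by apply: mCN; case/L2P: h.
Qed.

Lemma L2_sub u v : L2 u -> L2 v -> L2 (fun x => u x - v x).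
Proof. by move=> h1 h2; apply: L2_add h1 (L2N h2). Qed.

Lemma L2sq_ae u v : mC u -> mC v -> {ae mu, forall x, u x = v x} -> L2sq u = L2sq v.
Proof.
move=> m1 m2 h; apply: ge0_ae_eq_integral => //.
- by apply/measurable_EFinP; exact: meas_nc2.
- by apply/measurable_EFinP; exact: meas_nc2.
- by move=> x _; rewrite lee_fin sqr_ge0.
- by move=> x _; rewrite lee_fin sqr_ge0.
- by apply: ae_imp h => x -> _.
Qed.

Lemma L2_ae u v : L2 u -> mC v -> {ae mu, forall x, u x = v x} -> L2 v.
Proof.
by move=> /L2P[m1 h1] m2 h; apply/L2P; split => //; rewrite -(L2sq_ae m1 m2 h).
Qed.

Lemma integral_cst_itv c a b : a <= b ->
  (\int[mu]_(x in `[a, b]) c%:E)%E = (c * (b - a))%:E.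
Proof.
move=> ab; rewrite integral_cst // -[X in (_ * X)%E]/(mu `[a, b]).
rewrite lebesgue_measure_itv /= lte_fin; case: ltP => [_|ba].
  by rewrite -EFinB -EFinM.
by rewrite (le_anti (introT andP (conj ab ba))) subrr mulr0 mule0.
Qed.

(** [|u| <= 1 + |u|^2] takes the place of the Cauchy-Schwarz inequality on a bounded interval. *)
Lemma L2_locint (w : R -> R) u a b : measurable_fun [set: R] w -> L2 u ->
  (forall x, `|w x| <= nc (u x)) -> a <= b -> mu.-integrable `[a, b] (EFin \o w).
Proof.
move=> mw /L2P[m h] le ab; apply/integrableP; split.
  by apply/measurable_EFinP; exact: measurable_funTS.
have mI : measurable `[a, b] by exact: measurable_itv.
apply: (@le_lt_trans _ _ (\int[mu]_(x in `[a, b]) (1%:E + (nc (u x) ^+ 2)%:E))%E).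
  apply: ge0_le_integral => //.
  - by apply: measurableT_comp => //; apply/measurable_EFinP; exact: measurable_funTS.
  - by apply: measurable_funTS; apply: emeasurable_funD => //;
      apply/measurable_EFinP; exact: meas_nc2.
  - move=> x _ /=; rewrite -EFinD lee_fin; apply: le_trans (le x) _.
    have := sqr_ge0 (nc (u x) - 1); have := sqr_ge0 (nc (u x)); rewrite !expr2; nra.
rewrite ge0_integralD //; last 2 first.
- by move=> x _; rewrite lee_fin sqr_ge0.
- by apply: measurable_funTS; apply/measurable_EFinP; exact: meas_nc2.
apply: lte_add_pinfty.
  by rewrite integral_cst_itv // ltry.
apply: le_lt_trans h; apply: ge0_subset_integral => //.
  by apply/measurable_EFinP; exact: meas_nc2.
by move=> x _; rewrite lee_fin sqr_ge0.
Qed.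

Lemma L2_prim u : L2 u -> exists U, is_primC U u.
Proof.
move=> h; have [[m1 m2] _] := (L2P u).1 h.
have [|p _ hp] := prim_exists m1.
  by move=> a b ab; apply: (L2_locint m1 h) => // x; exact: Re_le_nc.
have [|q _ hq] := prim_exists m2.
  by move=> a b ab; apply: (L2_locint m2 h) => // x; exact: Im_le_nc.
by exists (fun x => (p x) +i* (q x)).
Qed.

Lemma itv_sqr_le u (a b c M : R) : a <= b -> mC u -> (L2sq u <= M%:E)%E ->
  (forall x, a <= x <= b -> c <= nc (u x) ^+ 2) -> 0 <= c -> c * (b - a) <= M.
Proof.
move=> ab m hM h c0; rewrite -lee_fin; apply: le_trans hM.
have mI : measurable `[a, b] by exact: measurable_itv.
rewrite -integral_cst_itv //.
apply: (@le_trans _ _ (\int[mu]_(x in `[a, b]) (nc (u x) ^+ 2)%:E)%E).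
  apply: ge0_le_integral => //.
    by apply: measurable_funTS; apply/measurable_EFinP; exact: meas_nc2.
apply: ge0_subset_integral => //.
  by apply/measurable_EFinP; exact: meas_nc2.
by move=> x _; rewrite lee_fin sqr_ge0.
Qed.

Lemma L2_cst0 u (c : R[i]) : L2 u -> {ae mu, forall x, u x = c} -> c = 0.
Proof.
move=> /L2P[m h] e; have mc : mC (fun=> c) by split; exact: measurable_cst.
have eE := L2sq_ae m mc e; rewrite eE in h.
have [M hM] : exists M : R, L2sq (fun=> c) = M%:E.
  by exists (fine (L2sq (fun=> c))); rewrite fineK // ge0_fin_numE // L2sq_ge0.
apply/eqP; rewrite -nc_eq0 -sqrf_eq0; apply/eqP; apply/le_anti; rewrite sqr_ge0 andbT.
rewrite leNgt; apply/negP => p.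
have M0 : 0 <= M by rewrite -lee_fin -hM L2sq_ge0.
(* Over an interval of this length the constant would already have squared norm [M + 1]. *)
pose b := (M + 1) / nc c ^+ 2.
have b0 : 0 <= b by rewrite divr_ge0 ?sqr_ge0 // addr_ge0.
have := @itv_sqr_le (fun=> c) 0 b (nc c ^+ 2) M b0 mc _ _ (sqr_ge0 _).
rewrite hM => /(_ (lexx _) (fun _ _ => lexx _)).
by rewrite subr0 /b mulrC divfK ?gt_eqF //; lra.
Qed.

End ComplexPrimitives.

(** * Schur's test *)

Section Schur.
Context {R : realType}.
Notation mu := (@lebesgue_measure R).
Implicit Types (a b c x y t s m : R).

Lemma meas_norm_sub x : measurable_fun [set: R] (fun y => `|x - y|).
Proof.
apply: measurableT_comp => //; apply: measurable_funB => //.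
Qed.

Lemma meas_exp_kernel m x : measurable_fun [set: R] (fun y => m * expR (- (m * `|x - y|))).
Proof.
apply: measurable_funM => //; apply: measurableT_comp; first exact: measurable_expR.
by apply: measurableT_comp => //; apply: measurable_funM => //; exact: meas_norm_sub.
Qed.

Lemma meas_Ek : measurable_fun [set: R * R] (fun p : R * R => Ek p.1 p.2).
Proof.
have m1 := @measurable_fst _ _ R R; have m2 := @measurable_snd _ _ R R.
have n1 : measurable_fun [set: R * R] (fun p : R * R => `|p.1|) by exact: measurableT_comp.
have n2 : measurable_fun [set: R * R] (fun p : R * R => `|p.2|) by exact: measurableT_comp.
have n3 : measurable_fun [set: R * R] (fun p : R * R => `|p.1 - p.2|).
  by apply: measurableT_comp => //; exact: measurable_funB.
rewrite /Ek; apply: measurable_funM; first exact: measurable_funD.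
apply: measurableT_comp; first exact: measurable_expR.
apply: measurable_funM => //; apply: measurable_funM => //.
by apply: measurable_funD => //; exact: measurable_funD.
Qed.

(* [e^-s <= 4 / (1 + s^2)], which has the primitive [4 atan s]. *)
Lemma exp_kernel_integral m x : 0 < m ->
  (\int[mu]_y (m * expR (- (m * `|x - y|)))%:E <= (4 * pi)%:E)%E.
Proof.
move=> m0; pose f y := 4 * (m / (1 + (m * (y - x)) ^+ 2)).
have d y : 0 < 1 + (m * (y - x)) ^+ 2 by rewrite ltr_pwDl // sqr_ge0.
have pf : is_prim (fun y => 4 * atan (m * (y - x))) f.
  apply: prim_of_rd => y.
    have h : rd (fun y => m * (y - x)) y m by apply: rd_eq; [rder|cbv beta; ring].
    apply: rd_eq (rdM (rd_cst 4 y) (rd_atan h)) _; rewrite /f; field; exact: lt0r_neq0.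
  have h : rd (fun y => 1 + (m * (y - x)) ^+ 2) y (2 * (m * (y - x)) * m).
    by apply: rd_eq; [rder|cbv beta; rewrite /=; ring].
  have hv := @rdV _ (fun y => 1 + (m * (y - x)) ^+ 2) _ _ (lt0r_neq0 (d y)) h.
  exact: rd_cont (rdM (rd_cst 4 y) (rdM (rd_cst m y) hv)).
have mf : measurable_fun [set: R] f by case: pf.
apply: (@le_trans _ _ (\int[mu]_y (f y)%:E)%E).
  apply: ge0_le_integral => //.
  - by move=> y _; rewrite lee_fin mulr_ge0 ?expR_ge0 // ltW.
  - by apply/measurable_EFinP; exact: meas_exp_kernel.
  - by apply/measurable_EFinP.
  - move=> y _; rewrite lee_fin /f mulrCA ler_wpM2l ?(ltW m0) //.
    have s0 : 0 <= m * `|x - y| by rewrite mulr_ge0 // ltW.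
    have -> : (m * (y - x)) ^+ 2 = (m * `|x - y|) ^+ 2.
      by rewrite !exprMn distrC real_normK ?num_real.
    move: s0; move: (m * `|x - y|) => s s0.
    rewrite ler_pdivlMr ?ltr_pwDl ?sqr_ge0 // expRN mulrC ler_pdivrMr ?expR_gt0 //.
    have := expR_ge_sqr s0; have := expR_ge1Dx s; lra.
apply: prim_growth pf _.
- by move=> y; rewrite /f mulr_ge0 // divr_ge0 // ltW.
- move=> a b ab.
  have := atan_ltpi2 (m * (b - x)); have := atan_gtNpi2 (m * (a - x)); lra.
Qed.

(** Dropping [|y|] from the exponent leaves the rate [m = (1 + |x|) / 16], and the prefactor of [Ek]
    is exactly [16 m], so the integral is bounded uniformly in [x]. *)
Lemma Ek_row x : (\int[mu]_y (Ek x y)%:E <= (64 * pi)%:E)%E.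
Proof.
pose m := (1 + `|x|) / 16; have m0 : 0 < m.
  by rewrite divr_gt0 // ltr_pwDl.
have mk := meas_exp_kernel m x.
apply: (@le_trans _ _ (\int[mu]_y (16%:E * (m * expR (- (m * `|x - y|)))%:E))%E).
  apply: ge0_le_integral => //.
  - by move=> y _; rewrite lee_fin Ek_ge0.
  - apply/measurable_EFinP; exact: (measurableT_comp meas_Ek (measurable_pair1 x)).
  - by apply: emeasurable_funM => //; apply/measurable_EFinP.
  - move=> y _; rewrite -EFinM lee_fin /Ek /m.
    rewrite [leRHS](_ : _ = (1 + `|x|) * expR (- ((1 + `|x|) / 16 * `|x - y|))); last by field.
    apply: ler_wpM2l; first by rewrite addr_ge0.
    rewrite ler_expR; have := normr_ge0 y; have := normr_ge0 (x - y); nra.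
rewrite ge0_integralZl_EFin //; last 2 first.
- by move=> y _; rewrite lee_fin mulr_ge0 ?expR_ge0 // ltW.
- by apply/measurable_EFinP.
have -> : (64 * pi)%:E = (16%:E * (4 * pi : R)%:E)%E by rewrite -EFinM; congr _%:E; ring.
by apply: lee_wpmul2l; rewrite ?lee_fin //; exact: exp_kernel_integral.
Qed.

(** In a column the prefactor [1 + p] depends on the integration variable. It is at most
    [1 + r + d], hence at most [32 (1 + r) e^q], while the exponential is at most [e^{-2 q}]: half
    of the decay pays for the prefactor. The constant 1250 only has to be at least [32 * 32]. *)
Lemma Ek_col_bound (r p d : R) : 0 <= r -> 0 <= p -> 0 <= d -> p <= r + d ->
  (1 + p) * expR (- (1 / 16) * ((1 + p + r) * d)) <=
  1250 * ((1 + r) / 32 * expR (- ((1 + r) / 32 * d))).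
Proof.
move=> r0 p0 d0 hp.
pose q := (1 + r) / 32 * d.
have q0 : 0 <= q by rewrite /q mulr_ge0 // divr_ge0 // addr_ge0.
have le1 : 1 + p <= (1 + r) * (32 * expR q).
  have e2 := expR_ge1Dx q; have : d <= 32 * q by rewrite /q; nra.
  have : 0 <= r * (expR q - 1) by rewrite mulr_ge0 //; lra.
  nra.
have le2 : expR (- (1 / 16) * ((1 + p + r) * d)) <= expR (- (2 * q)).
  by rewrite ler_expR /q; nra.
apply: (@le_trans _ _ ((1 + r) * (32 * expR q) * expR (- (2 * q)))).
  by apply: ler_pM => //; rewrite ?expR_ge0 ?addr_ge0.
have -> : - (2 * q) = - q + - q by ring.
have e3 : expR q * expR (- q) = 1 by rewrite -expRD subrr expR0.
rewrite expRD -/q.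
have -> : (1 + r) * (32 * expR q) * (expR (- q) * expR (- q)) =
   (1 + r) * 32 * expR (- q) * (expR q * expR (- q)) by ring.
rewrite e3 mulr1; have := expR_ge0 (- q); move: (expR (- q)) => E0 hE.
have : 0 <= (1 + r) * E0 by rewrite mulr_ge0 // addr_ge0.
by move=> h; nra.
Qed.

Lemma Ek_col : exists2 A : R, 0 < A & forall y, (\int[mu]_x (Ek x y)%:E <= A%:E)%E.
Proof.
have [C C0 hC] : exists2 C : R, 0 <= C & forall r p d, 0 <= r -> 0 <= p -> 0 <= d ->
    p <= r + d -> (1 + p) * expR (- (1 / 16) * ((1 + p + r) * d)) <=
    C * ((1 + r) / 32 * expR (- ((1 + r) / 32 * d))).
  by exists 1250; [exact: ler0n|exact: Ek_col_bound].
exists (C * (4 * pi) + 1); first by rewrite ltr_wpDl // !mulr_ge0 // pi_ge0.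
move=> y; pose m := (1 + `|y|) / 32; have m0 : 0 < m.
  by rewrite divr_gt0 // ltr_pwDl.
have mk := meas_exp_kernel m y.
apply: (@le_trans _ _ (\int[mu]_x (C%:E * (m * expR (- (m * `|y - x|)))%:E))%E).
  apply: ge0_le_integral => //.
  - by move=> x _; rewrite lee_fin Ek_ge0.
  - apply/measurable_EFinP; exact: (measurableT_comp meas_Ek (measurable_pair2 y)).
  - by apply: emeasurable_funM => //; apply/measurable_EFinP.
  - move=> x _; rewrite -EFinM lee_fin /Ek distrC.
    have hx : `|x| <= `|y| + `|y - x|.
      by have := ler_normB y (y - x); rewrite opprB addrC subrK.
    exact: hC.
rewrite ge0_integralZl_EFin //; last 2 first.
- by move=> x _; rewrite lee_fin mulr_ge0 ?expR_ge0 // ltW.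
- by apply/measurable_EFinP.
apply: (@le_trans _ _ (C%:E * (4 * pi : R)%:E)%E); last by rewrite -EFinM lee_fin lerDl.
by apply: lee_wpmul2l; rewrite ?lee_fin //; exact: exp_kernel_integral.
Qed.

(* Optimising [K h <= K (t + h^2 / t) / 2] over [t] replaces Hoelder's inequality. *)
Lemma schur (K : R * R -> R) (A : R) (h v : R -> R) : measurable_fun [set: R * R] K ->
  (forall p, 0 <= K p) -> 0 < A ->
  (forall x, (\int[mu]_y (K (x, y))%:E <= A%:E)%E) ->
  (forall y, (\int[mu]_x (K (x, y))%:E <= A%:E)%E) ->
  measurable_fun [set: R] h -> measurable_fun [set: R] v ->
  (forall y, 0 <= h y) -> (forall x, 0 <= v x) ->
  (forall x, ((v x)%:E <= \int[mu]_y (K (x, y) * h y)%:E)%E) ->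
  (\int[mu]_x (v x ^+ 2)%:E <= (A ^+ 2)%:E * \int[mu]_y (h y ^+ 2)%:E)%E.
Proof.
move=> mK K0 A0 hrow hcol mh mv h0 v0 hv.
pose K2 (p : R * R) := K p * h p.2 ^+ 2.
have mK2 : measurable_fun [set: R * R] K2.
  apply: measurable_funM => //; apply: measurable_funX.
  exact: (measurableT_comp mh (@measurable_snd _ _ _ _)).
have K20 p : 0 <= K2 p by rewrite mulr_ge0 ?sqr_ge0.
have mKx x : measurable_fun [set: R] (fun y => K (x, y)).
  exact: (measurableT_comp mK (measurable_pair1 x)).
have mK2x x : measurable_fun [set: R] (fun y => K2 (x, y)).
  exact: (measurableT_comp mK2 (measurable_pair1 x)).
have mKh x : measurable_fun [set: R] (fun y => K (x, y) * h y).
  exact: measurable_funM.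
have mKy y : measurable_fun [set: R] (fun x => K (x, y)).
  exact: (measurableT_comp mK (measurable_pair2 y)).
have eK x : measurable_fun [set: R] (fun y => (K (x, y))%:E) by apply/measurable_EFinP; exact: mKx.
have eK2 x : measurable_fun [set: R] (fun y => (K2 (x, y))%:E) by apply/measurable_EFinP; exact: mK2x.
have eKh x : measurable_fun [set: R] (fun y => (K (x, y) * h y)%:E) by apply/measurable_EFinP; exact: mKh.
have eKy y : measurable_fun [set: R] (fun x => (K (x, y))%:E) by apply/measurable_EFinP; exact: mKy.
have mJ : measurable_fun [set: R] (fun x => (\int[mu]_y (K2 (x, y))%:E)%E).
  have := @measurable_fun_fubini_tonelli_F _ _ _ _ _ mu (fun p => (K2 p)%:E).
  by apply => //; exact/measurable_EFinP.
have pt x : ((v x ^+ 2)%:E <= A%:E * \int[mu]_y (K2 (x, y))%:E)%E.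
  have [vx|vx] := eqVneq (v x) 0.
    rewrite vx expr2 mul0r; apply: mule_ge0; first by rewrite lee_fin ltW.
    by apply: integral_ge0 => y _; rewrite lee_fin.
  have vp : 0 < v x by rewrite lt_neqAle eq_sym vx v0.
  set J := (\int[mu]_y (K2 (x, y))%:E)%E.
  have J0 : (0 <= J)%E by apply: integral_ge0 => y _; rewrite lee_fin.
  (* With this [t] the inequality [v <= t A / 2 + J / (2 t)] reads [v <= v / 2 + A J / (2 v)], that
     is [v^2 <= A J]. Positivity of [t] is why the case [v x = 0] is treated apart. *)
  have [t t0 te] : exists2 t : R, 0 < t & t = v x / A by exists (v x / A) => //; rewrite divr_gt0.
  have le1 : ((v x)%:E <= (t / 2)%:E * A%:E + (1 / (2 * t))%:E * J)%E.
    apply: le_trans (hv x) _.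
    apply: (@le_trans _ _ (\int[mu]_y ((t / 2)%:E * (K (x, y))%:E + (1 / (2 * t))%:E * (K2 (x, y))%:E))%E).
      apply: ge0_le_integral => //.
      - by move=> y _; rewrite lee_fin mulr_ge0.
      - exact: eKh.
      - by apply: emeasurable_funD; apply: emeasurable_funM => //; solve [exact: eK|exact: eK2].
      - move=> y _; rewrite -!EFinM -EFinD lee_fin /K2 /=.
        have -> : t / 2 * K (x, y) + 1 / (2 * t) * (K (x, y) * h y ^+ 2) =
          K (x, y) * ((t ^+ 2 + h y ^+ 2) / (2 * t)) by field; exact: lt0r_neq0.
        apply: ler_wpM2l => //; rewrite ler_pdivlMr ?mulr_gt0 //.
        have := sqr_ge0 (t - h y); rewrite !expr2; nra.
    rewrite ge0_integralD //; last 4 first.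
    - by move=> y _; rewrite -EFinM lee_fin mulr_ge0 // divr_ge0 // ltW.
    - by apply: emeasurable_funM => //; solve [exact: eK|exact: eK2].
    - by move=> y _; rewrite -EFinM lee_fin mulr_ge0 // divr_ge0 // mulr_ge0 // ltW.
    - by apply: emeasurable_funM => //; solve [exact: eK|exact: eK2].
    rewrite !ge0_integralZl_EFin //; last 6 first.
    - by move=> y _; rewrite lee_fin.
    - solve [exact: eK|exact: eK2].
    - by rewrite divr_ge0 // mulr_ge0 // ltW.
    - by move=> y _; rewrite lee_fin.
    - solve [exact: eK|exact: eK2].
    - by rewrite divr_ge0 // ltW.
    apply: leeD => //; apply: lee_wpmul2l; first by rewrite lee_fin divr_ge0 // ltW.
    exact: hrow.
  have [Jf|] := boolP (J \is a fin_num); last first.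
    rewrite ge0_fin_numE // -leNgt leye_eq => /eqP ->.
    by rewrite gt0_muley ?leey // lte_fin.
  rewrite -(fineK Jf) -EFinM lee_fin; move: le1; rewrite -(fineK Jf) -!EFinM -EFinD lee_fin.
  move: (fine J) => j.
  have -> : t / 2 * A + 1 / (2 * t) * j = (v x ^+ 2 + A * j) / (2 * v x).
    by rewrite te; field; rewrite !lt0r_neq0.
  by rewrite ler_pdivlMr ?mulr_gt0 // !expr2 /= => le2; nra.
apply: (@le_trans _ _ (\int[mu]_x (A%:E * \int[mu]_y (K2 (x, y))%:E))%E).
  apply: ge0_le_integral => //.
  - by move=> x _; rewrite lee_fin sqr_ge0.
  - by apply/measurable_EFinP; exact: measurable_funX.
  - exact: emeasurable_funM.
rewrite ge0_integralZl_EFin //; last 2 first.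
- by move=> x _; apply: integral_ge0 => y _; rewrite lee_fin.
- exact: ltW.
have eF : (\int[mu]_x \int[mu]_y (K2 (x, y))%:E = \int[mu]_y \int[mu]_x (K2 (x, y))%:E)%E.
  apply: (@fubini_tonelli _ _ (measurableTypeR R) (measurableTypeR R) R mu mu
    (fun p => (K2 p)%:E)) => //.
  exact/measurable_EFinP.
rewrite [X in (_ * X)%E]eF; clear hv hrow pt eKh mKh eF.
rewrite expr2 EFinM -muleA; apply: lee_wpmul2l; first by rewrite lee_fin ltW.
rewrite -ge0_integralZl_EFin //; last 3 first.
- by move=> x _; rewrite lee_fin sqr_ge0.
- by apply/measurable_EFinP; exact: measurable_funX.
- exact: ltW.
apply: ge0_le_integral => //.
- by move=> y _; apply: integral_ge0 => x _; rewrite lee_fin.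
- have := @measurable_fun_fubini_tonelli_G _ _ _ _ _ mu (fun p => (K2 p)%:E).
  by apply => //; exact/measurable_EFinP.
- by apply: emeasurable_funM => //; apply/measurable_EFinP; exact: measurable_funX.
- move=> y _; rewrite /K2 /=; under eq_integral do rewrite EFinM muleC.
  rewrite ge0_integralZl_EFin //; last 3 first.
  + by move=> x _; rewrite lee_fin.
  + exact: eKy.
  + exact: sqr_ge0.
  by rewrite muleC; apply: lee_wpmul2r => //; rewrite lee_fin sqr_ge0.
Qed.

End Schur.

(** * Test functions *)

Section TestFunctions.
Context {R : realType}.
Notation mu := (@lebesgue_measure R).
Implicit Types (a b c d x y t s : R) (f g w phi : R -> R) (j n m : nat).

(** The functions [x^{-j} e^{-1/x}], extended by 0, are the family generated by differentiating
    [e^{-1/x}]: the derivative of each is a combination of the ones with indices [j + 1] and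
    [j + 2]. *)
Definition bump j x : R := if 0 < x then x ^- j * expR (- x^-1) else 0.

Lemma bump_le0 j x : x <= 0 -> bump j x = 0.
Proof. by rewrite /bump ltNge => ->. Qed.

Lemma expR_ge_pow m y : 0 <= y -> (y / m.+1%:R) ^+ m.+1 <= expR y.
Proof.
move=> y0; have -> : y = m.+1%:R * (y / m.+1%:R) by rewrite mulrC divfK // pnatr_eq0.
have q0 : 0 <= y / m.+1%:R by rewrite divr_ge0.
rewrite [X in X / _]mulrC mulfK ?pnatr_eq0 // expRM_natl.
apply: lerXn2r; rewrite ?nnegrE ?expR_ge0 //.
by apply: le_trans (expR_ge1Dx _); rewrite lerDr.
Qed.

(** [e^{1/x}] dominates [x^{-(j+2)}]. Vanishing to second order is all that differentiability at the
    junction 0 requires. *)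
Lemma bump_le_sqr j : exists2 c, 0 <= c & forall x, `|bump j x| <= c * x ^+ 2.
Proof.
exists (j.+2%:R ^+ j.+2); first by rewrite exprn_ge0.
move=> x; rewrite /bump; case: ltP => x0; last by rewrite normr0 mulr_ge0 ?sqr_ge0 // exprn_ge0.
rewrite ger0_norm; last by rewrite mulr_ge0 ?expR_ge0 // invr_ge0 exprn_ge0 // ltW.
have y0 : 0 <= x^-1 by rewrite invr_ge0 ltW.
have := expR_ge_pow j.+1 y0; rewrite expr_div_n ler_pdivrMr ?exprn_gt0 // => h.
rewrite expRN -exprVn ler_pdivrMr ?expR_gt0 //.
have -> : x^-1 ^+ j = x^-1 ^+ j.+2 * x ^+ 2.
  by rewrite -addn2 exprD -mulrA -exprMn mulVf ?gt_eqF // expr1n mulr1.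
by rewrite [leRHS]mulrAC; apply: ler_wpM2r; rewrite ?sqr_ge0 // mulrC.
Qed.

Lemma rd_flat f c : (forall x, `|f x| <= c * x ^+ 2) -> rd f 0 0.
Proof.
move=> h; have f0 : f 0 = 0.
  by apply/eqP; rewrite -normr_le0; have := h 0; rewrite expr2 mul0r mulr0.
have cv : (fun t => t^-1 *: ((f \o shift 0) (t *: 1) - f 0)) x @[x --> 0^'] --> (0 : R).
  apply/cvgr0Pnorm_lt => e e0; near=> t.
  have t0 : t != 0 by near: t; exact: nbhs_dnbhs_neq.
  have tp : 0 < `|t| by rewrite normr_gt0.
  have te : `|t| < e / (`|c| + 1).
    by near: t; apply: dnbhs0_lt; rewrite divr_gt0 // ltr_wpDl.
  rewrite /= f0 subr0 addr0 /GRing.scale /= mulr1 normrM normfV.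
  rewrite mulrC ltr_pdivrMr //; apply: le_lt_trans (h t) _.
  move: te; rewrite ltr_pdivlMr ?ltr_wpDl // => te.
  have -> : t ^+ 2 = `|t| * `|t| by rewrite -expr2 real_normK ?num_real.
  have := ler_norm c; have := normr_ge0 c; nra.
apply/rdP; apply: DeriveDef; first by apply/cvg_ex; exists 0.
exact: cvg_lim cv.
Unshelve. all: by end_near. Qed.

Lemma rd_bump j x : rd (bump j) x (- j%:R * bump j.+1 x + bump j.+2 x).
Proof.
have [x0|x0|x0] := ltgtP x 0.
- have b i y : y < 0 -> bump i y = 0 by move=> y0; rewrite /bump ltNge ltW.
  rewrite !b // mulr0 addr0; apply: (@rd_near _ (fun=> 0) _ _ _ (- x)) (rd_cst 0 x); first by rewrite oppr_gt0.
  by move=> y; rewrite ltr_norml => /andP[_ h]; rewrite b //; lra.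
- have b i y : 0 < y -> bump i y = y ^- i * expR (- y^-1) by move=> y0; rewrite /bump y0.
  rewrite !b //; apply: (@rd_near _ (fun y => (y ^+ j)^-1 * expR (- y^-1)) _ _ _ _ x0).
    by move=> y; rewrite ltr_norml => /andP[h _]; rewrite b //; lra.
  have xn0 : x != 0 by rewrite gt_eqF.
  have h1 : rd (fun y => y ^+ j) x (j%:R * x ^+ j.-1 * 1) by exact: rdX (rd_id x).
  have h2 := @rdV _ (fun y => y ^+ j) _ _ (expf_neq0 j xn0) h1.
  have h3 := @rdV _ (fun y => y) _ _ xn0 (rd_id x).
  apply: rd_eq (rdM h2 (rd_expR (rdN h3))) _; rewrite /=.
  case: j {b h1 h2} => [|j] /=; first by rewrite expr0; field.
  by rewrite !exprS; field; rewrite xn0 expf_neq0.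
- have b i : bump i 0 = 0 by rewrite /bump ltxx.
  rewrite x0 !b mulr0 addr0; have [c _ h] := bump_le_sqr j.
  exact: rd_flat h.
Qed.

(* Contains the bumps and is closed under differentiation, hence consists of
   smooth functions. *)
Inductive smooth_alg : (R -> R) -> Prop :=
| sa_bump j a b : smooth_alg (fun x => bump j (a * x + b))
| sa_cst c : smooth_alg (fun=> c)
| sa_mul f g : smooth_alg f -> smooth_alg g -> smooth_alg (fun x => f x * g x)
| sa_add f g : smooth_alg f -> smooth_alg g -> smooth_alg (fun x => f x + g x).

Lemma smooth_alg_rd f : smooth_alg f -> exists2 g, smooth_alg g & forall x, rd f x (g x).
Proof.
elim=> [j a b|c|{}f g sf [f1 sf1 hf] sg [g1 sg1 hg]|{}f g sf [f1 sf1 hf] sg [g1 sg1 hg]].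
- exists (fun x => (- j%:R * bump j.+1 (a * x + b) + bump j.+2 (a * x + b)) * a).
    apply: sa_mul (sa_cst a); apply: sa_add (sa_bump _ _ _).
    by apply: sa_mul (sa_cst _) (sa_bump _ _ _).
  move=> x; have h : rd (fun y => a * y + b) x a by apply: rd_eq; [rder|cbv beta; ring].
  exact: rd_comp h (rd_bump j _).
- by exists (fun=> 0); [exact: sa_cst|move=> x; exact: rd_cst].
- exists (fun x => f1 x * g x + f x * g1 x); last by move=> x; exact: rdM.
  by apply: sa_add; exact: sa_mul.
- by exists (fun x => f1 x + g1 x); [exact: sa_add|move=> x; exact: rdD].
Qed.

Lemma smooth_alg_derivable f n x : smooth_alg f -> derivable (f^`(n))%classic x 1.
Proof.
elim: n f => [|n IH] f sf; have [g sg h] := smooth_alg_rd sf.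
  by rewrite derive1n0; case: (h x).
have e : (f^`())%classic = g by apply/funext => y; case: (h y).
by rewrite derive1Sn e; exact: IH.
Qed.

(** Only the derivative has to lie in the algebra, so integrals of its members can serve as test
    functions. *)
Lemma test_antiderivative phi g A : smooth_alg g -> (forall x, rd phi x (g x)) ->
  (forall x, A < `|x| -> phi x = 0) -> test_function phi.
Proof.
move=> sg h hA; split; last by exists A.
case=> [|n] x; first by rewrite derive1n0; case: (h x).
have e : (phi^`())%classic = g by apply/funext => y; case: (h y).
by rewrite derive1Sn e; exact: smooth_alg_derivable.
Qed.

Lemma test_rd phi : test_function phi -> forall x, rd phi x (phi^`()%classic x).
Proof. by move=> [h _] x; split => //; have := h 0%N x. Qed.

Lemma test_cont phi : test_function phi -> continuous phi.
Proof. by move=> h x; exact: rd_cont (test_rd h x). Qed.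

Lemma test_derive phi : test_function phi -> test_function (phi^`())%classic.
Proof.
move=> [h [A hA]]; split; first by move=> n x; rewrite -derive1Sn.
exists A => x Ax; apply: (rd_near0 (x := x) (e := `|x| - A) _ _ (test_rd (conj h (ex_intro _ A hA)) x)).
  by rewrite subr_gt0.
move=> t ht; apply: hA; have := ler_normD t (x - t); rewrite addrC subrK; lra.
Qed.

Lemma Rint_supp g A : (forall x, A < `|x| -> g x = 0) ->
  \int[mu]_x g x = \int[mu]_(x in `[- A, A]) g x.
Proof.
move=> h; rewrite [RHS]Rintegral_mkcond; apply: eq_Rintegral => x _.
rewrite patchE; case: ifPn => //; rewrite mem_setE in_itv /= -ler_norml -ltNge => /h ->.
by [].
Qed.

Lemma test_ibp phi F f : test_function phi -> is_prim F f ->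
  \int[mu]_x (phi^`()%classic x * F x) = - \int[mu]_x (phi x * f x).
Proof.
move=> tp pF; have [A A0 [hA hA1]] : exists2 A, 0 <= A & (forall x, A <= `|x| -> phi x = 0) /\
    forall x, A <= `|x| -> phi^`()%classic x = 0.
  have [_ [A1 h1]] := tp; have [_ [A2 h2]] := test_derive tp.
  exists (1 + `|A1| + `|A2|); first by rewrite !addr_ge0.
  have := ler_norm A1; have := ler_norm A2; have := normr_ge0 A1; have := normr_ge0 A2 => p1 p2 p3 p4.
  by split=> x hx; [apply: h1|apply: h2]; lra.
rewrite (@Rint_supp _ A); last by move=> x /ltW /hA1 ->; rewrite mul0r.
rewrite (@Rint_supp (fun x => phi x * f x) A); last by move=> x /ltW /hA ->; rewrite mul0r.
have pp : is_prim phi (phi^`())%classic.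
  by apply: prim_of_rd; [exact: test_rd|exact: test_cont (test_derive tp)].
have [mf hF] := pF; have [mp hp] := pp.
have AA : - A <= A by lra.
have [_ e] := (prim_mul pp pF).2 _ _ AA.
have mI : measurable `[- A, A] by exact: measurable_itv.
have [fi _] := hF _ _ AA; have [pi _] := hp _ _ AA.
move: e; rewrite RintegralD //.
- by rewrite !hA ?normrN ?ger0_norm // !mul0r subrr => e; lra.
- by apply: integrable_mul_cont pi => //; exact: prim_cont pF.
- rewrite (_ : (fun x => phi x * f x) = (fun x => f x * phi x)); last first.
    by apply/funext => x; rewrite mulrC.
  by apply: integrable_mul_cont fi => //; exact: test_cont.
Qed.

Lemma integrable_test_mul phi w : test_function phi -> measurable_fun [set: R] w ->
  (forall a b, a <= b -> mu.-integrable `[a, b] (EFin \o w)) ->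
  mu.-integrable [set: R] (EFin \o (fun x => phi x * w x)).
Proof.
move=> tp mw iw; have [_ [A hA]] := tp; pose B := `|A|.
have BB : - B <= B by rewrite /B; have := normr_ge0 A; lra.
have mI : measurable `[- B, B] by exact: measurable_itv.
rewrite (_ : (fun x => phi x * w x) = (fun x => w x * phi x) \_ `[- B, B]).
  apply: integrable_patch => //.
  by apply: integrable_mul_cont (iw _ _ BB) => //; exact: test_cont.
apply/funext => x; rewrite patchE; case: ifPn; first by rewrite mulrC.
rewrite mem_setE in_itv /= -ler_norml -ltNge => h; rewrite hA ?mul0r //.
by apply: le_lt_trans h; exact: ler_norm.
Qed.

Lemma bump_ge0 j x : 0 <= bump j x.
Proof.
by rewrite /bump; case: ltP => // x0; rewrite mulr_ge0 ?expR_ge0 // invr_ge0 exprn_ge0 // ltW.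
Qed.

Lemma bump0_le1 x : bump 0 x <= 1.
Proof.
rewrite /bump; case: ltP => // x0.
by rewrite expr0 invr1 mul1r -expR0 ler_expR oppr_le0 invr_ge0 ltW.
Qed.

Lemma bump0_cvg s : 0 < s -> bump 0 (n.+1%:R * s) @[n --> \oo] --> (1 : R).
Proof.
move=> s0.
have -> : (fun n => bump 0 (n.+1%:R * s)) = (fun n => expR (- (harmonic n * s^-1))).
  by apply/funext => n; rewrite /bump mulr_gt0 // expr0 invr1 mul1r invfM.
have hc : - (harmonic n * s^-1) @[n --> \oo] --> (0 : R).
  rewrite -oppr0; apply: cvgN; rewrite -(mul0r s^-1).
  by apply: cvgMr_tmp; exact: cvg_harmonic.
have := cvg_comp _ _ hc (@continuous_expR R 0); rewrite expR0; apply.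
Qed.

(* The plateaus are bounded by [1] and converge to the indicator of [`]a, a + d[]. *)
Lemma plateau_cvg w a d : 0 < d -> measurable_fun [set: R] w ->
  (forall a b, a <= b -> mu.-integrable `[a, b] (EFin \o w)) ->
  (\int[mu]_x (bump 0 (n.+1%:R * (x - a)) * bump 0 (n.+1%:R * (d - (x - a))) * w x)) @[n --> \oo] -->
  \int[mu]_(x in `[a, (a + d)%R]) w x.
Proof.
move=> d0 mw iw; pose D := `]a, (a + d)%R[%classic.
pose h n x := bump 0 (n.+1%:R * (x - a)) * bump 0 (n.+1%:R * (d - (x - a))).
have mD : measurable D by exact: measurable_itv.
have ad : a <= a + d by rewrite lerDl ltW.
have wi : mu.-integrable D (EFin \o w).
  by apply: integrableS (iw _ _ ad) => //; apply: subset_itv; rewrite bnd_simp.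
have h0 n x : x \notin D -> h n x = 0.
  rewrite mem_setE in_itv /= negb_and -!leNgt => /orP[xa|xa]; rewrite /h.
    by rewrite bump_le0 ?mul0r // pmulr_rle0 // subr_le0.
  by rewrite [X in _ * X]bump_le0 ?mulr0 // pmulr_rle0 // subr_le0 lerBrDl.
have hle n x : `|h n x| <= 1.
  rewrite /h normrM !ger0_norm ?bump_ge0 //.
  by rewrite -[leRHS]mulr1; apply: ler_pM; rewrite ?bump_ge0 ?bump0_le1.
have mh n : measurable_fun [set: R] (h n).
  have cb : continuous (bump 0) by move=> x; exact: rd_cont (rd_bump 0 x).
  apply: measurable_funM; apply: measurableT_comp (cont_meas cb) _.
    by apply: measurable_funM => //; exact: measurable_funB.
  by apply: measurable_funM => //; apply: measurable_funB => //; exact: measurable_funB.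
have e1 n : \int[mu]_x (h n x * w x) = fine (\int[mu]_(x in D) (h n x * w x)%:E)%E.
  rewrite -/(Rintegral mu D (fun x => h n x * w x)) [RHS]Rintegral_mkcond.
  apply: eq_Rintegral => x _; rewrite patchE; case: ifPn => // /h0 ->.
  by rewrite mul0r.
have -> : (fun n => \int[mu]_x (bump 0 (n.+1%:R * (x - a)) * bump 0 (n.+1%:R * (d - (x - a))) * w x)) =
    (fun n => fine (\int[mu]_(x in D) (h n x * w x)%:E)%E) by apply/funext => n; rewrite -e1.
have wi2 : mu.-integrable `[a, (a + d)%R[ (EFin \o w).
  by apply: integrableS (iw _ _ ad) => //; apply: subset_itv; rewrite bnd_simp.
rewrite -(Rintegral_itv_bndo_bndc wi2) -(Rintegral_itv_obnd_cbnd wi).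
apply: fine_cvg; rewrite -(EFin_Rint mD wi).
have mhw n : measurable_fun [set: R] (fun x => h n x * w x) by exact: measurable_funM.
have [] := @dominated_convergence _ (measurableTypeR R) R mu D mD
  (fun n x => (h n x * w x)%:E) (EFin \o w) (fun x => `|(w x)%:E|%E).
- by move=> n; apply/measurable_EFinP; apply: measurable_funTS; exact: mhw.
- by apply/measurable_EFinP; exact: measurable_funTS.
- apply: ae_all => x; rewrite /D /= in_itv /= => /andP[xa xd].
  apply: cvg_EFin; first by apply: nearW.
  have c1 : h n x * w x @[n --> \oo] --> 1 * 1 * w x.
    by apply: cvgMr_tmp; apply: cvgM; apply: bump0_cvg; lra.
  by rewrite !mul1r in c1.
- exact: (integrable_abse wi).
- apply: ae_all => x n _; rewrite lee_fin normrM -[leRHS]mul1r.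
  by apply: ler_wpM2r.
- by [].
Qed.

(** The test function is the primitive of the difference of two translated plateaus, over []a, a +
    d[] and []b, b + d[]; it has bounded support because both have the same mass. As the plateaus
    sharpen, the integrals of [w] over the two intervals are seen to agree, so the increments of a
    primitive of [w] do not depend on the base point. *)
Lemma du_bois_reymond w : measurable_fun [set: R] w ->
  (forall a b, a <= b -> mu.-integrable `[a, b] (EFin \o w)) ->
  (forall phi, test_function phi -> \int[mu]_x (phi^`()%classic x * w x) = 0) ->
  exists c, {ae mu, forall x, w x = c}.
Proof.
move=> mw iw hw; have [P P0 hP] := prim_exists mw iw.
have [_ hP2] := hP.
apply: prim_shift_invariant hP _ => a b d d0.
have ad : a <= a + d by rewrite lerDl ltW.
have bd : b <= b + d by rewrite lerDl ltW.
have [_ ->] := hP2 _ _ ad; have [_ ->] := hP2 _ _ bd.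
have ca := @plateau_cvg w a d d0 mw iw; have cb := @plateau_cvg w b d d0 mw iw.
suff e n : \int[mu]_x (bump 0 (n.+1%:R * (x - a)) * bump 0 (n.+1%:R * (d - (x - a))) * w x) =
    \int[mu]_x (bump 0 (n.+1%:R * (x - b)) * bump 0 (n.+1%:R * (d - (x - b))) * w x).
  rewrite (funext e) in ca; exact: (cvg_unique _ ca cb).
move: (n.+1%:R : R) (ltr0Sn R n) => N N0.
pose g s := bump 0 (N * s) * bump 0 (N * (d - s)).
have sg c : smooth_alg (fun x => g (x - c)).
  rewrite (_ : (fun x => _) = (fun x => bump 0 (N * x + - N * c) * bump 0 (- N * x + N * (d + c)))).
    by apply: sa_mul; exact: sa_bump.
  by apply/funext => x; rewrite /g; congr (bump 0 _ * bump 0 _); ring.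
have cg0 : continuous g.
  have [g1 _ h1] := smooth_alg_rd (sg 0); rewrite (_ : g = fun x => g (x - 0)).
    by move=> x; exact: rd_cont (h1 x).
  by apply/funext => x; rewrite subr0.
have [H H0 hH] := antiderivative cg0.
have Hneg s : s <= 0 -> H s = 0.
  move=> s0; rewrite -H0; apply: rd_zero_cst s0 => t /andP[_ t0].
  by apply: rd_eq (hH t) _; rewrite /g bump_le0 ?mul0r // pmulr_rle0.
have Hbig s : d <= s -> H s = H d.
  move=> ds; apply/esym; apply: rd_zero_cst ds => t /andP[dt _].
  apply: rd_eq (hH t) _; rewrite /g [X in _ * X]bump_le0 ?mulr0 //.
  by rewrite pmulr_rle0 // subr_le0.
have hs c x : rd (fun y => H (y - c)) x (g (x - c)).
  have h1 : rd (fun y => y - c) x 1 by apply: rd_eq; [rder|cbv beta; ring].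
  by apply: rd_eq (rd_comp h1 (hH _)) _; rewrite mulr1.
pose phi x := H (x - a) - H (x - b).
have dphi x : rd phi x (g (x - a) + (- 1) * g (x - b)).
  by apply: rd_eq (rdB (hs a x) (hs b x)) _; rewrite mulN1r.
have tphi : test_function phi.
  apply: (@test_antiderivative _ (fun x => g (x - a) + (- 1) * g (x - b)) (`|a| + `|b| + d)) => //.
    by apply: sa_add (sg a) (sa_mul (sa_cst _) (sg b)).
  move=> x hx; have := ler_norm a; have := ler_norm b; have := ler_norm (- a); have := ler_norm (- b).
  rewrite !normrN; have := normr_ge0 a; have := normr_ge0 b => p1 p2 p3 p4 p5 p6.
  have [x0|x0] := leP 0 x.
    move: hx; rewrite (ger0_norm x0) => hx.
    have ea : H (x - a) = H d by apply: Hbig; lra.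
    have eb : H (x - b) = H d by apply: Hbig; lra.
    by apply/eqP; rewrite subr_eq0; apply/eqP; rewrite ea eb.
  move: hx; rewrite (ltr0_norm x0) => hx.
  have ea : H (x - a) = 0 by apply: Hneg; lra.
  have eb : H (x - b) = 0 by apply: Hneg; lra.
  by apply/eqP; rewrite subr_eq0; apply/eqP; rewrite ea eb.
have := hw _ tphi.
have tg c : exists2 psi, test_function psi & psi = (fun x => g (x - c)).
  exists (fun x => g (x - c)) => //; have [g1 sg1 hg1] := smooth_alg_rd (sg c).
  apply: (@test_antiderivative _ g1 (`|c| + d)) => // x hx.
  have := ler_norm c; have := ler_norm (- c); rewrite normrN => p1 p2.
  have [x0|x0] := leP 0 x; rewrite /g.
    rewrite (ger0_norm x0) in hx; rewrite [X in _ * X]bump_le0 ?mulr0 // pmulr_rle0 // subr_le0; lra.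
  rewrite (ltr0_norm x0) in hx; rewrite bump_le0 ?mul0r // pmulr_rle0 // subr_le0; lra.
have ig c : mu.-integrable [set: R] (EFin \o (fun x => g (x - c) * w x)).
  by have [psi tpsi epsi] := tg c; have := integrable_test_mul tpsi mw iw; rewrite epsi.
have -> : \int[mu]_x (phi^`()%classic x * w x) = \int[mu]_x (g (x - a) * w x - g (x - b) * w x).
  by apply: eq_Rintegral => x _; have [_ ->] := dphi x; ring.
rewrite RintegralB; last 3 first.
- exact: measurableT.
- exact: ig.
- exact: ig.
by move=> /eqP; rewrite subr_eq0 => /eqP.
Qed.

End TestFunctions.

(** * Weak derivatives *)

Section WeakDerivative.
Context {R : realType}.
Notation mu := (@lebesgue_measure R).
Implicit Types (u v U V : R -> R[i]) (phi w : R -> R).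

Lemma ReCM (a : R) (z : R[i]) : Re (a%:C * z) = a * Re z.
Proof. by rewrite !cE; ring. Qed.

Lemma ImCM (a : R) (z : R[i]) : Im (a%:C * z) = a * Im z.
Proof. by rewrite !cE; ring. Qed.

Lemma cintegral_real_mul phi u : cintegral (fun x => (phi x)%:C * u x) =
  (\int[mu]_x (phi x * Re (u x))) +i* (\int[mu]_x (phi x * Im (u x))).
Proof.
by congr (_ +i* _); apply: eq_Rintegral => x _; rewrite ?ReCM ?ImCM.
Qed.

Definition locint w := measurable_fun [set: R] w /\
  forall a b, a <= b -> mu.-integrable `[a, b] (EFin \o w).

Lemma locint_sub (w1 w2 : R -> R) : locint w1 -> locint w2 -> locint (fun x => w1 x - w2 x).
Proof.
move=> [m1 i1] [m2 i2]; split; first exact: measurable_funB.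
move=> a b ab; rewrite (_ : EFin \o _ = EFin \o (fun x => w1 x + (-1) * w2 x)).
  apply: integrable_add; [exact: measurable_itv|exact: i1|].
  by apply: integrable_scale; [exact: measurable_itv|exact: i2].
by apply/funext => x /=; rewrite mulN1r.
Qed.

Lemma L2_locintC u : L2 u -> locint (fun x => Re (u x)) /\ locint (fun x => Im (u x)).
Proof.
move=> h; have [[m1 m2] _] := (L2P u).1 h.
by split; split => // a b ab; [apply: (L2_locint m1 h) => // x; exact: Re_le_nc|
  apply: (L2_locint m2 h) => // x; exact: Im_le_nc].
Qed.

Lemma locint_cont w : continuous w -> locint w.
Proof.
move=> cw; split; first exact: cont_meas.
move=> a b ab; apply: continuous_compact_integrable; first exact: segment_compact.
exact: continuous_subspaceT.
Qed.

Lemma weak_const (w1 w2 : R -> R) : locint w1 -> locint w2 ->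
  (forall phi, test_function phi ->
    \int[mu]_x (phi^`()%classic x * w1 x) = \int[mu]_x (phi^`()%classic x * w2 x)) ->
  exists c, {ae mu, forall x, w1 x - w2 x = c}.
Proof.
move=> l1 l2 h; have [mw iw] := locint_sub l1 l2.
apply: du_bois_reymond => // phi tphi; have t1 := test_derive tphi.
have i1 := integrable_test_mul t1 l1.1 l1.2; have i2 := integrable_test_mul t1 l2.1 l2.2.
have -> : \int[mu]_x (phi^`()%classic x * (w1 x - w2 x)) =
    \int[mu]_x (phi^`()%classic x * w1 x - phi^`()%classic x * w2 x).
  by apply: eq_Rintegral => x _; ring.
by rewrite RintegralB // h // subrr.
Qed.

Lemma wd_prim U v : is_primC U v -> L2 v -> L2_weak_derivative U v.
Proof.
move=> [p1 p2] hv; split => // phi tphi.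
rewrite !cintegral_real_mul (test_ibp tphi p1) (test_ibp tphi p2).
by apply: ceq; rewrite !cE.
Qed.

Lemma wd_ae u u' v : mC u -> mC u' -> {ae mu, forall x, u x = u' x} ->
  L2_weak_derivative u v -> L2_weak_derivative u' v.
Proof.
move=> [m1 m2] [n1 n2] h [hv hphi]; split => // phi tphi; rewrite -hphi // !cintegral_real_mul.
have mt : measurable_fun [set: R] (phi^`())%classic by apply: cont_meas; exact: test_cont (test_derive tphi).
congr (_ +i* _); apply: ae_eq_Rint => //; try exact: measurable_funM.
  by apply: ae_imp h => x ->.
by apply: ae_imp h => x ->.
Qed.

(** Testing only against derivatives of test functions makes [v - v'] almost everywhere constant,
    and a square integrable constant is 0. Thus du Bois-Reymond's lemma serves here as well. *)
Lemma wd_unique u v v' : L2_weak_derivative u v -> L2_weak_derivative u v' ->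
  {ae mu, forall x, v x = v' x}.
Proof.
move=> [hv h] [hv' h'].
have e phi : test_function phi ->
    cintegral (fun x => (phi x)%:C * v x) = cintegral (fun x => (phi x)%:C * v' x).
  by move=> t; apply: oppr_inj; rewrite -h // -h'.
have [l1 l2] := L2_locintC hv; have [l1' l2'] := L2_locintC hv'.
have [|c1 e1] := weak_const l1 l1'.
  by move=> phi t; have := e _ (test_derive t); rewrite !cintegral_real_mul => -[].
have [|c2 e2] := weak_const l2 l2'.
  by move=> phi t; have := e _ (test_derive t); rewrite !cintegral_real_mul => -[].
have ec : {ae mu, forall x, v x - v' x = c1 +i* c2}.
  by apply: ae_imp (ae_and e1 e2) => x [h1 h2]; apply: ceq; rewrite !cE.
have c0 := L2_cst0 (L2_sub hv hv') ec.
by apply: ae_imp ec => x; rewrite c0 => /eqP; rewrite subr_eq0 => /eqP.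
Qed.

(** A primitive of [v] has weak derivative [v], so it differs from [u] almost everywhere by a
    constant, which is then added to it. *)
Lemma wd_repr u v : L2 u -> L2_weak_derivative u v ->
  exists2 U, is_primC U v & {ae mu, forall x, u x = U x}.
Proof.
move=> hu [hv h]; have [U pU] := L2_prim hv.
have [_ hU] := wd_prim pU hv.
have [l1 l2] := L2_locintC hu; have [c1 c2] := primC_cc pU.
have e phi : test_function phi ->
    cintegral (fun x => (phi^`()%classic x)%:C * u x) = cintegral (fun x => (phi^`()%classic x)%:C * U x).
  by move=> t; rewrite h // hU.
have [|a e1] := weak_const l1 (locint_cont c1).
  by move=> phi t; have := e _ t; rewrite !cintegral_real_mul => -[].
have [|b e2] := weak_const l2 (locint_cont c2).
  by move=> phi t; have := e _ t; rewrite !cintegral_real_mul => -[].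
exists (fun x => U x + (a +i* b)).
  by apply: (is_primC_ext (primCD pU (primC_cst (a +i* b)))) => x //; rewrite addr0.
by apply: ae_imp (ae_and e1 e2) => x [<- <-]; apply: ceq; rewrite !cE; ring.
Qed.

Lemma weak_deriveP u v : L2_weak_derivative u v -> L2_weak_derivative u (weak_derive u).
Proof.
by move=> h; rewrite /weak_derive; case: xgetP => [w -> //|hn]; case: (hn v).
Qed.

Lemma weak_derive_ae u v : L2_weak_derivative u v ->
  {ae mu, forall x, weak_derive u x = v x}.
Proof. by move=> h; exact: wd_unique (weak_deriveP h) h. Qed.

(** Each use of [weak_derive] picks its own representative, so the inner choice has to be exchanged
    for [u1], almost everywhere, before the outer one can be identified. *)
Lemma weak_derive2 u u1 u2 : L2_weak_derivative u u1 -> L2_weak_derivative u1 u2 ->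
  mC (weak_derive (weak_derive u)) /\
  {ae mu, forall x, weak_derive (weak_derive u) x = u2 x}.
Proof.
move=> h1 h2; have hw := weak_deriveP h1.
have m1 : mC u1 by case: h1 => /L2P[].
have m2 : mC (weak_derive u) by case: hw => /L2P[].
have h3 : L2_weak_derivative (weak_derive u) u2.
  by apply: wd_ae m1 m2 _ h2; apply: ae_imp (weak_derive_ae h1) => x ->.
split; last exact: weak_derive_ae h3.
by case: (weak_deriveP h3) => /L2P[].
Qed.

End WeakDerivative.

(** * The Green operator *)

Section Integrability.
Context {R : realType}.
Notation mu := (@lebesgue_measure R).
Implicit Types (h f : R -> R[i]) (w : R -> R) (x y t : R).

Lemma inv_sqr_integral (M : R) : 0 <= M ->
  (\int[mu]_t (M / (1 + t ^+ 2))%:E <= (M * pi)%:E)%E.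
Proof.
move=> M0; have d t : 0 < 1 + t ^+ 2 by rewrite ltr_pwDl // sqr_ge0.
have pf : is_prim (fun t => M * atan t) (fun t => M / (1 + t ^+ 2)).
  apply: prim_of_rd => t.
    by apply: rd_eq (rdM (rd_cst M t) (rd_atan (rd_id t))) _; field; exact: lt0r_neq0.
  have h : rd (fun y => 1 + y ^+ 2) t (2 * t).
    by apply: rd_eq; [rder|cbv beta; rewrite /=; ring].
  have hv := @rdV _ (fun y => 1 + y ^+ 2) _ _ (lt0r_neq0 (d t)) h.
  exact: rd_cont (rdM (rd_cst M t) hv).
apply: prim_growth pf _.
- by move=> y; rewrite divr_ge0 // ltW.
- move=> a b ab; have := atan_ltpi2 b; have := atan_gtNpi2 a => h1 h2.
  rewrite -mulrBr; apply: ler_wpM2l => //; lra.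
Qed.

(** The majorant is the one produced by [|psi h| <= |psi|^2 + |h|^2] when [psi] decays on [D]. *)
Lemma tail_integrable (D : set R) w h (M : R) : measurable D ->
  measurable_fun [set: R] w -> L2 h -> 0 <= M ->
  (forall t, D t -> `|w t| <= M / (1 + t ^+ 2) + nc (h t) ^+ 2) ->
  mu.-integrable D (EFin \o w).
Proof.
move=> mD mw /L2P[mh hE] M0 hw; apply/integrableP; split.
  by apply/measurable_EFinP; exact: measurable_funTS.
have mq : measurable_fun [set: R] (fun t : R => M / (1 + t ^+ 2)).
  apply: cont_meas => t.
  have d : 1 + t ^+ 2 != 0 by rewrite lt0r_neq0 // ltr_pwDl // sqr_ge0.
  have h1 : rd (fun y => 1 + y ^+ 2) t (2 * t).
    by apply: rd_eq; [rder|cbv beta; rewrite /=; ring].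
  have hv := @rdV _ (fun y => 1 + y ^+ 2) _ _ d h1.
  exact: rd_cont (rdM (rd_cst M t) hv).
have q0 t : 0 <= M / (1 + t ^+ 2) by rewrite divr_ge0 // addr_ge0 // sqr_ge0.
have mn := meas_nc2 mh.
apply: (@le_lt_trans _ _ (\int[mu]_(t in D) ((M / (1 + t ^+ 2))%:E + (nc (h t) ^+ 2)%:E))%E).
  apply: ge0_le_integral => //.
  - by apply: measurableT_comp => //; apply/measurable_EFinP; exact: measurable_funTS.
  - by apply: measurable_funTS; apply: emeasurable_funD; apply/measurable_EFinP.
apply: (@le_lt_trans _ _ (\int[mu]_t ((M / (1 + t ^+ 2))%:E + (nc (h t) ^+ 2)%:E))%E).
  apply: ge0_subset_integral => //.
    by apply: emeasurable_funD; apply/measurable_EFinP.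
  by move=> t _; rewrite -EFinD lee_fin addr_ge0 // sqr_ge0.
rewrite ge0_integralD //; last 4 first.
- by move=> t _; rewrite lee_fin.
- exact/measurable_EFinP.
- by move=> t _; rewrite lee_fin sqr_ge0.
- exact/measurable_EFinP.
apply: lte_add_pinfty => //.
by apply: le_lt_trans (inv_sqr_integral M0) _; exact: ltry.
Qed.

Lemma half_bound_real (D : set R) w (g : R -> R) (c : R) : measurable D ->
  mu.-integrable D (EFin \o w) -> measurable_fun [set: R] g -> 0 <= c ->
  (forall t, 0 <= g t) -> (forall t, D t -> c * `|w t| <= g t) ->
  ((c * `|\int[mu]_(t in D) w t|)%:E <= \int[mu]_t (g t)%:E)%E.
Proof.
move=> mD iw mg c0 g0 h.
have iaw : mu.-integrable D (EFin \o (fun t => `|w t|)) by exact: integrable_abse iw.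
have ic := integrable_scale c mD iaw.
apply: (@le_trans _ _ (c * \int[mu]_(t in D) `|w t|)%:E).
  by rewrite lee_fin; apply: ler_wpM2l => //; exact: le_normr_Rintegral.
rewrite -RintegralZl // -EFin_Rint //.
apply: (@le_trans _ _ (\int[mu]_(t in D) (g t)%:E)%E).
  apply: ge0_le_integral => //.
  - by move=> t _; rewrite lee_fin mulr_ge0.
  - by case/integrableP: ic.
  - by apply: measurable_funTS; exact/measurable_EFinP.
apply: ge0_subset_integral => //; first exact/measurable_EFinP.
by move=> t _; rewrite lee_fin.
Qed.

Definition cint_on (D : set R) f : R[i] :=
  (\int[mu]_(t in D) Re (f t)) +i* (\int[mu]_(t in D) Im (f t)).

(** Real and imaginary parts are estimated separately, whence the factor 2. The constant [c] will
    carry the part of the kernel that depends on the outer variable. *)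
Lemma half_bound (D : set R) f (g : R -> R) (c : R) : measurable D ->
  mu.-integrable D (EFin \o (fun t => Re (f t))) ->
  mu.-integrable D (EFin \o (fun t => Im (f t))) ->
  measurable_fun [set: R] g -> 0 <= c -> (forall t, 0 <= g t) ->
  (forall t, D t -> c * nc (f t) <= g t) ->
  ((c * nc (cint_on D f))%:E <= 2%:E * \int[mu]_t (g t)%:E)%E.
Proof.
move=> mD i1 i2 mg c0 g0 h.
have h1 := @half_bound_real D _ g c mD i1 mg c0 g0 _.
have h2 := @half_bound_real D _ g c mD i2 mg c0 g0 _.
have -> : (2%:E * \int[mu]_t (g t)%:E = \int[mu]_t (g t)%:E + \int[mu]_t (g t)%:E)%E.
  by rewrite (_ : 2%:E = 1%:E + 1%:E)%E // ge0_muleDl // !mul1e.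
apply: le_trans (leeD (h1 _) (h2 _)).
- rewrite -EFinD lee_fin -mulrDr; apply: ler_wpM2l => //; exact: nc_le_ReIm.
- move=> t Dt; apply: le_trans (h t Dt); apply: ler_wpM2l => //; exact: Re_le_nc.
- move=> t Dt; apply: le_trans (h t Dt); apply: ler_wpM2l => //; exact: Im_le_nc.
Qed.

End Integrability.

(** * Variation of constants with the two recessive solutions *)

Section Green.
Context {R : realType}.
Notation mu := (@lebesgue_measure R).
Variables (V psi psi1 : R -> R[i]) (B K : R).
Hypothesis hpsi : forall t, cd psi t (psi1 t).
Hypothesis hpsi1 : forall t, cd psi1 t (V t * psi t).
Hypothesis V_even : forall t, V (- t) = V t.
Hypothesis V_cc : cc V.
Hypothesis K_ge0 : 0 <= K.
Hypothesis V_le : forall t, nc (V t) <= K * (1 + `|t|) ^+ 2.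
Hypothesis psi0 : psi 0 != 0.
Hypothesis psi10 : psi1 0 != 0.
Hypothesis B_gt0 : 0 < B.
Hypothesis psi_decay : forall x, 0 <= x ->
  nc (psi x) <= B * expR (- x) /\ nc (psi1 x) <= B * expR (- x).
Hypothesis kernel_le : forall x y, y <= x ->
  (1 + `|x|) ^+ 2 * nc (psi x) * nc (psi (- y)) <= B * Ek x y /\
  nc (psi1 x) * nc (psi (- y)) <= B * Ek x y.
Implicit Types (h e : R -> R[i]) (x y t : R).

(* The solution recessive at [-oo]. *)
Definition rpsi x : R[i] := psi (- x).
Definition rpsi1 x : R[i] := - psi1 (- x).

Lemma rpsi_cd t : cd rpsi t (rpsi1 t).
Proof. exact: cd_reflect hpsi t. Qed.

Lemma rpsi1_cd t : cd rpsi1 t (V t * rpsi t).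
Proof.
apply: cd_eq (cdN (cd_reflect hpsi1 t)) _.
by rewrite opprK V_even.
Qed.

(** The Wronskian of [psi] and [rpsi], read off at 0, where the reflection only changes the sign of
    the slope. *)
Definition W0 : R[i] := - (psi 0 * psi1 0 *+ 2).

Lemma W0_neq0 : W0 != 0.
Proof. by rewrite oppr_eq0 mulrn_eq0 /= mulf_neq0. Qed.

Lemma W0E t : psi t * rpsi1 t - psi1 t * rpsi t = W0.
Proof.
rewrite (wronskian_cst hpsi hpsi1 rpsi_cd rpsi1_cd t 0) /rpsi /rpsi1 oppr0 /W0 mulr2n; ring.
Qed.

(** Towards [-oo] the solution may grow, so the constant depends on [x]: continuity covers [[x, 0]]
    and the exponential decay covers the rest. *)
Lemma psi_tail x : exists2 M : R, 0 <= M &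
  forall t, x <= t -> nc (psi t) ^+ 2 <= M / (1 + t ^+ 2).
Proof.
have cpsi : continuous (fun t => nc (psi t) ^+ 2 * (1 + t ^+ 2)).
  move=> t; have h2 : rd (fun y => 1 + y ^+ 2) t (2 * t).
    by apply: rd_eq; [rder|cbv beta; rewrite /=; ring].
  exact: rd_cont (rdM (cd_nc2 (hpsi t)) h2).
have [M M0 hM] := cont_bounded x 0 cpsi.
exists (M + B ^+ 2); first by rewrite addr_ge0 // sqr_ge0.
move=> t xt; rewrite ler_pdivlMr ?ltr_pwDl ?sqr_ge0 //.
have [t0|t0] := leP t 0.
  have := hM t; rewrite xt t0 => /(_ isT) le.
  apply: le_trans (ler_norm _) _; apply: le_trans le _.
  by rewrite lerDl sqr_ge0.
have [d1 _] := psi_decay (ltW t0).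
have e1 : (1 + t) * expR (- t) <= 1.
  by rewrite expRN ler_pdivrMr ?expR_gt0 // mul1r expR_ge1Dx.
have p0 := nc_ge0 (psi t).
have e2 : nc (psi t) * (1 + t) <= B.
  apply: le_trans (_ : B * expR (- t) * (1 + t) <= _).
    by apply: ler_wpM2r => //; lra.
  by rewrite -mulrA [expR _ * _]mulrC -[leRHS]mulr1; apply: ler_wpM2l => //; exact: ltW.
have e3 : (nc (psi t) * (1 + t)) ^+ 2 <= B ^+ 2.
  by apply: lerXn2r; rewrite ?nnegrE ?(ltW B_gt0) ?mulr_ge0 //; lra.
apply: le_trans (_ : (nc (psi t) * (1 + t)) ^+ 2 <= _); last by lra.
rewrite exprMn; apply: ler_wpM2l; first exact: sqr_ge0.
by rewrite sqrrD expr1n; lra.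
Qed.

Section Operator.
Variable h : R -> R[i].
Hypothesis hL2 : L2 h.

Let mh : mC h. Proof. by case/L2P: hL2. Qed.
Let mpsi : mC psi. Proof. by apply: mC_cc; exact: cd_cc hpsi. Qed.
Let mrpsi : mC rpsi. Proof. by apply: mC_cc; exact: cd_cc rpsi_cd. Qed.
Let mP : mC (fun t => psi t * h t). Proof. exact: mCM. Qed.
Let mN : mC (fun t => rpsi t * h t). Proof. exact: mCM. Qed.

Lemma amgm_nc (z w : R[i]) (m : R) : nc z ^+ 2 <= m -> nc (z * w) <= m + nc w ^+ 2.
Proof.
rewrite ncM; move: (nc z) (nc w) (nc_ge0 z) (nc_ge0 w) => p q p0 q0 hm.
by have := sqr_ge0 (p - q); have := sqr_ge0 p; have := sqr_ge0 q; rewrite !expr2 in hm *; nra.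
Qed.

Let iP x (w : R -> R) : measurable_fun [set: R] w ->
  (forall t, `|w t| <= nc (psi t * h t)) -> mu.-integrable `[x, +oo[ (EFin \o w).
Proof.
move=> mw hw; have [M M0 hM] := psi_tail x.
apply: (tail_integrable _ mw hL2 M0) => // t; rewrite /= in_itv /= andbT => xt.
by apply: le_trans (hw t) _; apply: amgm_nc; exact: hM.
Qed.

Let iN x (w : R -> R) : measurable_fun [set: R] w ->
  (forall t, `|w t| <= nc (rpsi t * h t)) -> mu.-integrable `]-oo, x] (EFin \o w).
Proof.
move=> mw hw; have [M M0 hM] := psi_tail (- x).
apply: (tail_integrable _ mw hL2 M0) => // t; rewrite /= in_itv /= => xt.
apply: le_trans (hw t) _; apply: amgm_nc.
by have := hM (- t); rewrite lerN2 sqrrN; apply.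
Qed.

Definition tail_right x := cint_on `[x, +oo[ (fun t => psi t * h t).
Definition tail_left x := cint_on `]-oo, x] (fun t => rpsi t * h t).

Lemma tail_right_prim : is_primC tail_right (fun t => - (psi t * h t)).
Proof.
have [m1 m2] := mP; split.
  apply: (is_prim_ext (prim_right m1 _)) => x //; last by rewrite ReN.
  by apply: iP => // t; exact: Re_le_nc.
apply: (is_prim_ext (prim_right m2 _)) => x //; last by rewrite ImN.
by apply: iP => // t; exact: Im_le_nc.
Qed.

Lemma tail_left_prim : is_primC tail_left (fun t => rpsi t * h t).
Proof.
have [m1 m2] := mN; split.
  by apply: prim_left => // x; apply: iN => // t; exact: Re_le_nc.
by apply: prim_left => // x; apply: iN => // t; exact: Im_le_nc.
Qed.

(** Variation of constants for [- w'' + V w = h]. In the first derivative the contributions of the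
    moving endpoints cancel, which is why [green_sol1] has the same shape. *)
Definition green_sol x := W0^-1 * (rpsi x * tail_right x + psi x * tail_left x).
Definition green_sol1 x := W0^-1 * (rpsi1 x * tail_right x + psi1 x * tail_left x).

Lemma green_sol_prim : is_primC green_sol green_sol1.
Proof.
have p1 : is_primC psi psi1.
  by apply: primC_of_cd => //; exact: cd_cc hpsi1.
have p2 : is_primC rpsi rpsi1.
  by apply: primC_of_cd; [exact: rpsi_cd|exact: cd_cc rpsi1_cd].
have := primCZ W0^-1 (primCD (primCM p2 tail_right_prim) (primCM p1 tail_left_prim)).
by move=> p; apply: (is_primC_ext p) => x //; rewrite /green_sol1; congr (_ * _); ring.
Qed.

(** At the second differentiation the endpoint contributions add up to the Wronskian times [- h],
    and the factor [W0^-1] normalises it. *)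
Lemma green_sol1_prim : is_primC green_sol1 (fun x => V x * green_sol x - h x).
Proof.
have p1 : is_primC psi1 (fun t => V t * psi t).
  by apply: primC_of_cd => //; apply: ccM V_cc _; exact: cd_cc hpsi.
have p2 : is_primC rpsi1 (fun t => V t * rpsi t).
  by apply: primC_of_cd; [exact: rpsi1_cd|apply: ccM V_cc _; exact: cd_cc rpsi_cd].
have := primCZ W0^-1 (primCD (primCM p2 tail_right_prim) (primCM p1 tail_left_prim)).
move=> p; apply: (is_primC_ext p) => x //.
have W1 : W0^-1 * (psi x * rpsi1 x - psi1 x * rpsi x) = 1.
  by rewrite W0E mulVf // W0_neq0.
transitivity (V x * green_sol x - W0^-1 * (psi x * rpsi1 x - psi1 x * rpsi x) * h x).
  rewrite /green_sol.
  move: (tail_right x) (tail_left x) (V x) (psi x) (psi1 x) (rpsi x) (rpsi1 x) (h x) (W0^-1).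
  by move=> a b c d1 d2 d3 d4 d5 d6; ring.
by rewrite W1 mul1r.
Qed.

Let mg x : measurable_fun [set: R] (fun y => B * Ek x y * nc (h y)).
Proof.
apply: measurable_funM; last exact: meas_nc.
apply: measurable_funM => //; exact: (measurableT_comp (@meas_Ek R) (measurable_pair1 x)).
Qed.

Let g0 x y : 0 <= B * Ek x y * nc (h y).
Proof. by rewrite !mulr_ge0 ?nc_ge0 ?Ek_ge0 // ltW. Qed.

Lemma tail_right_bound x c : 0 <= c -> (forall y, x <= y -> c * nc (psi y) <= B * Ek x y) ->
  ((c * nc (tail_right x))%:E <= 2%:E * \int[mu]_y (B * Ek x y * nc (h y))%:E)%E.
Proof.
move=> c0 hc; have [m1 m2] := mP; apply: half_bound => //.
- by apply: iP => // t; exact: Re_le_nc.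
- by apply: iP => // t; exact: Im_le_nc.
- move=> t; rewrite /= in_itv /= andbT => /hc le.
  by rewrite ncM mulrA; apply: ler_wpM2r => //; exact: nc_ge0.
Qed.

Lemma tail_left_bound x c : 0 <= c -> (forall y, y <= x -> c * nc (rpsi y) <= B * Ek x y) ->
  ((c * nc (tail_left x))%:E <= 2%:E * \int[mu]_y (B * Ek x y * nc (h y))%:E)%E.
Proof.
move=> c0 hc; have [m1 m2] := mN; apply: half_bound => //.
- by apply: iN => // t; exact: Re_le_nc.
- by apply: iN => // t; exact: Im_le_nc.
- move=> t; rewrite /= in_itv /= => /hc le.
  by rewrite ncM mulrA; apply: ler_wpM2r => //; exact: nc_ge0.
Qed.

(** The factor 4 comes from the two tails and the factor 2 that each loses to its real and imaginary
    parts. *)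
Definition green_majorant (p : R * R) : R := 4 * nc W0^-1 * B * Ek p.1 p.2.

Lemma kernel_combine (a b c : R[i]) x (p q : R) : 0 <= p -> 0 <= q ->
  nc c <= nc W0^-1 * (p * nc a + q * nc b) ->
  ((p * nc a)%:E <= 2%:E * \int[mu]_y (B * Ek x y * nc (h y))%:E)%E ->
  ((q * nc b)%:E <= 2%:E * \int[mu]_y (B * Ek x y * nc (h y))%:E)%E ->
  ((nc c)%:E <= \int[mu]_y (green_majorant (x, y) * nc (h y))%:E)%E.
Proof.
move=> p0 q0 hc h1 h2.
have w0 := nc_ge0 W0^-1.
have -> : (\int[mu]_y (green_majorant (x, y) * nc (h y))%:E =
   (4 * nc W0^-1)%:E * \int[mu]_y (B * Ek x y * nc (h y))%:E)%E.
  rewrite -ge0_integralZl_EFin //; last 3 first.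
  - by move=> y _; rewrite lee_fin.
  - by apply/measurable_EFinP; exact: mg.
  - by rewrite mulr_ge0.
  by apply: eq_integral => y _; rewrite -EFinM /green_majorant /=; congr _%:E; ring.
set J := (\int[mu]_y _)%E in h1 h2 *.
apply: (@le_trans _ _ ((nc W0^-1)%:E * ((p * nc a)%:E + (q * nc b)%:E))%E).
  by rewrite -EFinD -EFinM lee_fin.
have -> : ((4 * nc W0^-1)%:E * J = (nc W0^-1)%:E * (2%:E * J + 2%:E * J))%E.
  rewrite [(4 * _)]mulrC EFinM -muleA; congr (_ * _)%E.
  have J0 : (0 <= J)%E by apply: integral_ge0 => y _; rewrite lee_fin.
  by rewrite -ge0_muleDl // -EFinD; congr (_ * _)%E; congr _%:E; ring.
by apply: lee_wpmul2l; [rewrite lee_fin|exact: leeD].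
Qed.

(** The weight [(1 + |x|)^2] is what later puts [x^2 w] and [V w] into [L^2]. The tail over [y >= x]
    becomes the other one at the reflected points [- x], [- y], under which [Ek] is invariant, so
    [kernel_le] serves both. *)
Lemma green_sol_bound x :
  (((1 + `|x|) ^+ 2 * nc (green_sol x))%:E <= \int[mu]_y (green_majorant (x, y) * nc (h y))%:E)%E.
Proof.
have s0 : 0 <= (1 + `|x|) ^+ 2 by exact: sqr_ge0.
have -> : (1 + `|x|) ^+ 2 * nc (green_sol x) = nc (((1 + `|x|) ^+ 2)%:C * green_sol x).
  by rewrite ncM ncC (ger0_norm s0).
apply: (@kernel_combine (tail_right x) (tail_left x) _ x ((1 + `|x|) ^+ 2 * nc (rpsi x)) ((1 + `|x|) ^+ 2 * nc (psi x))).
- by rewrite mulr_ge0 ?nc_ge0.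
- by rewrite mulr_ge0 ?nc_ge0.
- rewrite ncM ncC (ger0_norm s0) /green_sol ncM mulrCA; apply: ler_wpM2l; first exact: nc_ge0.
  move: ((1 + `|x|) ^+ 2) s0 => s s0.
  rewrite -!mulrA -mulrDr; apply: ler_wpM2l => //.
  by apply: le_trans (ncD _ _) _; rewrite !ncM.
- apply: tail_right_bound; first by rewrite mulr_ge0 ?nc_ge0.
  move=> y xy; have nxy : - y <= - x by rewrite lerN2.
  by have [le _] := kernel_le nxy; move: le; rewrite normrN opprK EkN.
- apply: tail_left_bound; first by rewrite mulr_ge0 ?nc_ge0.
  by move=> y xy; have [le _] := kernel_le xy.
Qed.

Lemma green_sol1_bound x : ((nc (green_sol1 x))%:E <= \int[mu]_y (green_majorant (x, y) * nc (h y))%:E)%E.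
Proof.
apply: (@kernel_combine (tail_right x) (tail_left x) _ x (nc (rpsi1 x)) (nc (psi1 x))).
- exact: nc_ge0.
- exact: nc_ge0.
- rewrite /green_sol1 ncM; apply: ler_wpM2l; first exact: nc_ge0.
  by apply: le_trans (ncD _ _) _; rewrite !ncM.
- apply: tail_right_bound; first exact: nc_ge0.
  move=> y xy; have nxy : - y <= - x by rewrite lerN2.
  by have [_ le] := kernel_le nxy; rewrite /rpsi1 ncN; move: le; rewrite opprK EkN.
- apply: tail_left_bound; first exact: nc_ge0.
  by move=> y xy; have [_ le] := kernel_le xy.
Qed.

Lemma kernel_L2 (A : R) e : mC e -> 0 < A ->
  (forall x, (\int[mu]_y (green_majorant (x, y))%:E <= A%:E)%E) ->
  (forall y, (\int[mu]_x (green_majorant (x, y))%:E <= A%:E)%E) ->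
  (forall x, ((nc (e x))%:E <= \int[mu]_y (green_majorant (x, y) * nc (h y))%:E)%E) ->
  (L2sq e <= (A ^+ 2)%:E * L2sq h)%E.
Proof.
move=> me A0 h1 h2 h3; apply: (@schur _ green_majorant A (fun y => nc (h y)) (fun x => nc (e x))) => //.
- by apply: measurable_funM => //; exact: meas_Ek.
- by move=> p; rewrite /green_majorant !mulr_ge0 ?nc_ge0 ?Ek_ge0 // ltW.
- exact: meas_nc.
- exact: meas_nc.
- by move=> y; exact: nc_ge0.
- by move=> y; exact: nc_ge0.
Qed.

End Operator.

Lemma green_majorant_bounds : exists2 A : R, 0 < A &
  (forall x, (\int[mu]_y (green_majorant (x, y))%:E <= A%:E)%E) /\
  (forall y, (\int[mu]_x (green_majorant (x, y))%:E <= A%:E)%E).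
Proof.
have [A A0 hA] := @Ek_col R.
have [C C0 hC] : exists2 C : R, 0 <= C & forall p, green_majorant p = C * Ek p.1 p.2.
  by exists (4 * nc W0^-1 * B) => //; rewrite !mulr_ge0 ?nc_ge0 // ltW.
exists (C * (64 * pi + A) + 1).
  by rewrite ltr_wpDl // mulr_ge0 // addr_ge0 ?(ltW A0) // mulr_ge0 // pi_ge0.
have p0 := @pi_ge0 R.
split=> [x|y]; under eq_integral do rewrite hC EFinM.
- rewrite ge0_integralZl_EFin //; last 2 first.
  + by move=> y _; rewrite lee_fin Ek_ge0.
  + apply/measurable_EFinP; exact: (measurableT_comp (@meas_Ek R) (measurable_pair1 x)).
  apply: (@le_trans _ _ (C%:E * (64 * pi)%:E)%E).
    by apply: lee_wpmul2l; rewrite ?lee_fin //; exact: Ek_row.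
  rewrite -EFinM lee_fin; have := mulr_ge0 C0 (ltW A0); lra.
- rewrite ge0_integralZl_EFin //; last 2 first.
  + by move=> x _; rewrite lee_fin Ek_ge0.
  + apply/measurable_EFinP; exact: (measurableT_comp (@meas_Ek R) (measurable_pair2 y)).
  apply: (@le_trans _ _ (C%:E * A%:E)%E).
    by apply: lee_wpmul2l; rewrite ?lee_fin //; exact: hA.
  rewrite -EFinM lee_fin; have := mulr_ge0 C0 p0; lra.
Qed.

(** One weighted estimate, on [(1 + |x|)^2 w], controls [w], [x^2 w] and, by [V_le], also [V w]; a
    second one, without weight, controls [w1]. With the equation this places [w] in the domain of
    the operator. *)
Lemma green_operator : exists2 A : R, 0 < A & forall h, L2 h ->
  exists (w w1 : R -> R[i]), [/\ is_primC w w1, is_primC w1 (fun x => V x * w x - h x),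
    L2 w /\ L2 w1, L2 (fun x => (x ^+ 2)%:C * w x) /\ L2 (fun x => V x * w x) &
    (L2sq w <= (A ^+ 2)%:E * L2sq h)%E].
Proof.
have [A A0 [hA1 hA2]] := green_majorant_bounds; exists A => // h hL.
have p1 := green_sol_prim hL; have p2 := green_sol1_prim hL.
have mh : mC h by case/L2P: hL.
have hE : (L2sq h < +oo)%E by case/L2P: hL.
have mw : mC (green_sol h) by apply: mC_cc; exact: primC_cc p1.
have mw1 : mC (green_sol1 h) by apply: mC_cc; exact: primC_cc p2.
have mreal (q : R -> R) : measurable_fun [set: R] q -> mC (fun x => (q x)%:C).
  by move=> mq; split => //; exact: measurable_cst.
have ms : measurable_fun [set: R] (fun x : R => (1 + `|x|) ^+ 2).
  by apply: measurable_funX; apply: measurable_funD => //; exact: measurableT_comp.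
pose e x := ((1 + `|x|) ^+ 2)%:C * green_sol h x.
have me : mC e by apply: mCM mw; exact: mreal.
have ne x : nc (e x) = (1 + `|x|) ^+ 2 * nc (green_sol h x).
  by rewrite /e ncM ncC (ger0_norm (sqr_ge0 _)).
have be : (L2sq e <= (A ^+ 2)%:E * L2sq h)%E.
  by apply: kernel_L2 => // x; rewrite ne; exact: green_sol_bound.
have b1 : (L2sq (green_sol1 h) <= (A ^+ 2)%:E * L2sq h)%E.
  by apply: kernel_L2 => // x; exact: green_sol1_bound.
have Afin : ((A ^+ 2)%:E * L2sq h < +oo)%E.
  by apply: lte_mul_pinfty => //; rewrite lee_fin sqr_ge0.
have Le : L2 e by apply/L2P; split => //; exact: le_lt_trans be Afin.
have s1 x : 1 <= (1 + `|x|) ^+ 2.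
  by have := normr_ge0 x; rewrite !expr2; nra.
have le x : nc (green_sol h x) <= 1 * nc (e x).
  by rewrite mul1r ne; have := nc_ge0 (green_sol h x); have := s1 x; nra.
exists (green_sol h), (green_sol1 h); split; [exact: p1|exact: p2| | |].
- split; first exact: (L2_dom mw Le ler01 le).
  by apply/L2P; split => //; exact: le_lt_trans b1 Afin.
- split.
    apply: (L2_dom _ Le ler01).
      by apply: mCM mw; apply: mreal; exact: measurable_funX.
    move=> x; rewrite mul1r ne ncM ncC; apply: ler_wpM2r; first exact: nc_ge0.
    rewrite (ger0_norm (sqr_ge0 _)) -real_normK ?num_real //.
    by have := normr_ge0 x; rewrite !expr2; nra.
  apply: (L2_dom _ Le K_ge0); first by apply: mCM mw; exact: mC_cc.
  move=> x; rewrite ne ncM mulrA; apply: ler_wpM2r; first exact: nc_ge0.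
  exact: V_le.
- apply: le_trans be; rewrite -[leRHS]mul1e; apply: L2sq_dom => // x.
  by rewrite mul1r; apply: lerXn2r; rewrite ?nnegrE ?nc_ge0 // -[leRHS]mul1r.
Qed.

(** A positive lower bound on a half-line would give unbounded mass on long intervals, here one of
    length [(M + 1) / k^2]. *)
Lemma L2_half_const (q : R -> R[i]) (k : R) : L2 q -> 0 <= k ->
  (forall x, 0 <= x -> k <= nc (q x)) \/ (forall x, x <= 0 -> k <= nc (q x)) -> k = 0.
Proof.
move=> /L2P[m hf] k0 hk.
have [M hM] : exists M : R, L2sq q = M%:E.
  by exists (fine (L2sq q)); rewrite fineK // ge0_fin_numE // L2sq_ge0.
apply/eqP; rewrite eq_le k0 andbT leNgt; apply/negP => p.
have M0 : 0 <= M by rewrite -lee_fin -hM L2sq_ge0.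
have k2 : 0 < k ^+ 2 by exact: exprn_gt0.
pose b := (M + 1) / k ^+ 2.
have b0 : 0 <= b by rewrite divr_ge0 ?sqr_ge0 // addr_ge0.
have nb0 : - b <= 0 by rewrite oppr_le0.
have hq : (L2sq q <= M%:E)%E by rewrite hM.
have hs x : k <= nc (q x) -> k ^+ 2 <= nc (q x) ^+ 2.
  by move=> h; apply: lerXn2r; rewrite ?nnegrE ?nc_ge0.
have bE : k ^+ 2 * b = M + 1 by rewrite /b mulrC divfK ?gt_eqF.
suff : k ^+ 2 * b <= M by rewrite bE; lra.
case: hk => hk.
  have := @itv_sqr_le _ q 0 b (k ^+ 2) M b0 m hq _ (ltW k2); rewrite subr0; apply.
  by move=> x /andP[x0 _]; apply: hs; exact: hk.
have := @itv_sqr_le _ q (- b) 0 (k ^+ 2) M nb0 m hq _ (ltW k2); rewrite sub0r opprK; apply.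
by move=> x /andP[_ x0]; apply: hs; exact: hk.
Qed.

(* The Wronskians of [e] with the two recessive solutions are constant and
   square integrable on a half-line, hence zero. *)
Lemma homogeneous_L2_zero e (e' : R -> R[i]) : is_primC e e' ->
  is_primC e' (fun x => V x * e x) -> L2 e -> L2 e' -> forall x, e x = 0.
Proof.
move=> p1 p2 L1 L2'.
have de := primC_cd p1 (primC_cc p2).
have de' := primC_cd p2 (ccM V_cc (primC_cc p1)).
have me : mC e by case/L2P: L1.
have me' : mC e' by case/L2P: L2'.
(* One square integrable function which, multiplied by [B], dominates each Wronskian on the
   half-line where the corresponding recessive solution is bounded by [B]. *)
pose q x := (nc (e x))%:C + (nc (e' x))%:C.
have nq x : nc (q x) = nc (e x) + nc (e' x).
  by rewrite /q -realCD ncC ger0_norm // addr_ge0 ?nc_ge0.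
have mreal (w : R -> R[i]) : mC w -> mC (fun x => (nc (w x))%:C).
  by move=> mw; split; [exact: meas_nc|exact: measurable_cst].
have Lreal (w : R -> R[i]) : L2 w -> L2 (fun x => (nc (w x))%:C).
  move=> Lw; apply: (@L2_dom _ _ w 1) => //; first by apply: mreal; case/L2P: Lw.
  by move=> x; rewrite mul1r ncC ger0_norm // nc_ge0.
have Lq : L2 q by apply: L2_add; exact: Lreal.
have bound (a b : R[i]) x : nc a <= B -> nc b <= B ->
    nc (a * e' x - b * e x) / B <= nc (q x).
  move=> ha hb; rewrite ler_pdivrMr // nq [leRHS]mulrC mulrDr [leRHS]addrC.
  apply: le_trans (ncB _ _) _; rewrite !ncM.
  by apply: lerD; apply: ler_wpM2r => //; exact: nc_ge0.
have decay x : 0 <= x -> nc (psi x) <= B /\ nc (psi1 x) <= B.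
  move=> x0; have [d1 d2] := psi_decay x0.
  have : B * expR (- x) <= B.
    rewrite -[leRHS]mulr1; apply: ler_wpM2l; first exact: ltW.
    by rewrite -expR0 ler_expR oppr_le0.
  by move=> le; split; apply: le_trans le.
have zero (c : R[i]) : nc c / B = 0 -> c = 0.
  move=> /eqP; rewrite mulf_eq0 invr_eq0 (gt_eqF B_gt0) orbF nc_eq0.
  by move=> /eqP.
have c1 x : psi x * e' x - psi1 x * e x = 0.
  apply: zero; apply: L2_half_const Lq _ _; first by rewrite divr_ge0 ?nc_ge0 // ltW.
  left=> y y0; rewrite (wronskian_cst hpsi hpsi1 de de' x y).
  by have [d1 d2] := decay _ y0; exact: bound.
have c2 x : rpsi x * e' x - rpsi1 x * e x = 0.
  apply: zero; apply: L2_half_const Lq _ _; first by rewrite divr_ge0 ?nc_ge0 // ltW.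
  right=> y y0; rewrite (wronskian_cst rpsi_cd rpsi1_cd de de' x y).
  have ny : 0 <= - y by rewrite oppr_ge0.
  by have [d1 d2] := decay _ ny; apply: bound => //; rewrite ncN.
move=> x; have : W0 * e x = 0.
  rewrite -(W0E x).
  have -> : (psi x * rpsi1 x - psi1 x * rpsi x) * e x =
    rpsi x * (psi x * e' x - psi1 x * e x) - psi x * (rpsi x * e' x - rpsi1 x * e x).
    move: (psi x) (psi1 x) (rpsi x) (rpsi1 x) (e x) (e' x).
    by move=> a b c d f g; ring.
  by rewrite c1 c2 !mulr0 subr0.
by move=> /eqP; rewrite mulf_eq0 (negbTE W0_neq0) => /eqP.
Qed.

End Green.

(** * The resolvent *)

Section Resolvent.
Context {R : realType}.
Notation mu := (@lebesgue_measure R).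
Variables (f : R -> R) (eps : R) (z : R[i]) (V : R -> R[i]).
Hypothesis VE : forall x, V x = (x ^+ 2)%:C + 'i / eps%:C * (f x)%:C - z.
Hypothesis V_cc : cc V.
Implicit Types (u v w g : R -> R[i]).

Definition shifted u x : R[i] := opH f eps u x - z * u x.

Lemma shiftedE u x : shifted u x = - weak_derive (weak_derive u) x + V x * u x.
Proof. by rewrite /shifted /opH VE -complexiE; ring. Qed.

(** Passes from a class modulo null sets, with chosen weak derivatives, to absolutely continuous
    representatives, on which Wronskians and the equation make sense pointwise. *)
Lemma domH_repr u : domH u -> exists (U U1 u2 : R -> R[i]),
  [/\ is_primC U U1, is_primC U1 u2, L2 U /\ L2 U1, {ae mu, forall x, u x = U x} &
      mC (shifted u) /\ {ae mu, forall x, shifted u x = - u2 x + V x * U x}].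
Proof.
move=> [[Lu [u1 [u2 [h1 h2]]]] _].
have [U pU eU] := wd_repr Lu h1.
have Lu1 : L2 u1 by case: h1.
have [U1 pU1 eU1] := wd_repr Lu1 h2.
have mU : mC U by apply: mC_cc; exact: primC_cc pU.
have mU1 : mC U1 by apply: mC_cc; exact: primC_cc pU1.
have mu_ : mC u by case/L2P: Lu.
have [mw ew] := weak_derive2 h1 h2.
exists U, U1, u2; split => //.
- exact: primC_ae pU mU1 eU1.
- by split; [exact: L2_ae Lu mU eU|exact: L2_ae Lu1 mU1 eU1].
- split.
    rewrite (_ : shifted u = (fun x => - weak_derive (weak_derive u) x + V x * u x)).
      by apply: mCD; [exact: mCN|apply: mCM => //; exact: mC_cc].
    by apply/funext => x; exact: shiftedE.
  by apply: ae_imp (ae_and eU ew) => x [e1 e2]; rewrite shiftedE e1 e2.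
Qed.

Hypothesis green : exists2 A : R, 0 < A & forall h, L2 h ->
  exists (w w1 : R -> R[i]), [/\ is_primC w w1, is_primC w1 (fun x => V x * w x - h x),
    L2 w /\ L2 w1, L2 (fun x => (x ^+ 2)%:C * w x) /\ L2 (fun x => V x * w x) &
    (L2sq w <= (A ^+ 2)%:E * L2sq h)%E].

Hypothesis homog : forall e (e' : R -> R[i]), is_primC e e' ->
  is_primC e' (fun x => V x * e x) -> L2 e -> L2 e' -> forall x, e x = 0.

Lemma resolvent_point : resolvent_set domH (opH f eps) z.
Proof.
have [A A0 hA] := green; split.
- move=> g Lg; have [w [w1 [p1 p2 [Lw Lw1] [Lx LV] _]]] := hA g Lg.
  have L2' : L2 (fun x => V x * w x - g x) by exact: L2_sub.
  have d1 := wd_prim p1 Lw1; have d2 := wd_prim p2 L2'.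
  exists w; first by split => //; split => //; exists w1, (fun x => V x * w x - g x).
  have [_ ew] := weak_derive2 d1 d2.
  apply: ae_imp ew => x e _; rewrite -/(shifted w x) shiftedE e; ring.
- move=> u v du dv euv.
  have [U [U1 [u2 [p1 p2 [LU LU1] eu [_ su]]]]] := domH_repr du.
  have [W [W1 [v2 [q1 q2 [LW LW1] ev [_ sv]]]]] := domH_repr dv.
  have mUW : mC (fun x => V x * (U x - W x)).
    apply: mCM; first exact: mC_cc.
    by apply: mCB; apply: mC_cc; [exact: primC_cc p1|exact: primC_cc q1].
  have h0 : forall x, U x - W x = 0.
    apply: (homog (primCB p1 q1)); last exact: L2_sub.
    - apply: primC_ae (primCB p2 q2) mUW _.
      apply: ae_imp (ae_and (ae_and su sv) euv) => x [[e1 e2] e3].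
      have e4 : - u2 x + V x * U x = - v2 x + V x * W x by rewrite -e1 -e2; exact: e3.
      have -> : u2 x - v2 x = V x * U x - V x * W x - ((- u2 x + V x * U x) - (- v2 x + V x * W x)).
        by ring.
      by rewrite e4 subrr subr0 mulrBr.
    - exact: L2_sub.
  apply: ae_imp (ae_and eu ev) => x [-> ->] _.
  by apply/eqP; rewrite -subr_eq0 h0.
- exists A => u du.
  have [U [U1 [u2 [p1 p2 [LU LU1] eu [ms su]]]]] := domH_repr du.
  have mU : mC U by apply: mC_cc; exact: primC_cc p1.
  have mu_ : mC u by case: du => [[/L2P[]]].
  apply: L2norm_le; first exact: ltW.
  rewrite (L2sq_ae mu_ mU eu) -/(shifted u).
  have mg : mC (fun x => - u2 x + V x * U x).
    apply: mCD; first by apply: mCN; exact: primC_mC p2.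
    by apply: mCM => //; exact: mC_cc.
  rewrite (L2sq_ae ms mg su).
  (* If the image is not square integrable its norm is [+oo] and the bound is trivial, [A] being
     positive. *)
  have [Lg|nLg] := pselect (L2 (fun x => - u2 x + V x * U x)); last first.
    have -> : L2sq (fun x => - u2 x + V x * U x) = +oo%E.
      apply/eqP; rewrite -leye_eq leNgt; apply/negP => h.
      by apply: nLg; apply/L2P.
    by rewrite gt0_muley ?leey // lte_fin exprn_gt0.
  have [w [w1 [q1 q2 [Lw Lw1] _ bw]]] := hA _ Lg.
  (* [U] and the Green solution [w] solve the same inhomogeneous equation, so their difference is a
     square integrable homogeneous solution; the norm bound for [w] is then the one for [U]. *)
  suff eUw : U = w by rewrite {1}eUw.
  apply/funext => x; apply/eqP; rewrite -subr_eq0; apply/eqP; move: x.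
  apply: (homog (primCB p1 q1)); last exact: L2_sub.
  - by apply: (is_primC_ext (primCB p2 q2)) => x //; ring.
  - exact: L2_sub.
Qed.

End Resolvent.

Theorem proposition1p9 (R : realType) (k : R) (hk : 0 < k) :
  let f : R -> R := fun x => 1 / (1 + x ^+ 2) `^ (k / 2) in
  let nu' : R := Num.min (1 / 2) (2 / (k + 2)) in
  exists2 M5 : R, 0 < M5 &
    forall eps : R, 0 < eps -> eps <= 1 ->
      ((M5 / eps `^ nu')%:E <= Sigma f eps)%E.
Proof.
move=> f nu'; have [M M0 hM] := green_pair hk; exists M => // eps e0 e1.
(* A point of the spectrum strictly to the left of the bound would lie in the resolvent set. [M] was
   fixed before [eps], as the statement requires. *)
apply: le_ereal_inf_tmp => _ [z hz <-]; rewrite lee_fin leNgt; apply/negP => lt.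
apply: hz; have [psi [psi1 [B [h1 h2 [p0 p10] [B0 dec] ker]]]] := hM eps z e0 e1 lt.
pose V := Q k eps z 0.
have VE x : V x = (x ^+ 2)%:C + 'i / eps%:C * (f x)%:C - z by exact: Q0E.
have t0 : `|0 : R| <= 1 / 4 by rewrite normr0 divr_ge0.
have V_cc : cc V by apply: cd_cc => t; exact: cd_Q_t.
have V_even t : V (- t) = V t by exact: Q0_even.
pose K := 1 + (1 / eps + nc z + 1).
have c0 : 0 <= 1 / eps + nc z + 1 by rewrite !addr_ge0 ?nc_ge0 // divr_ge0 // ltW.
have K0 : 0 <= K by rewrite addr_ge0.
have V_le t : nc (V t) <= K * (1 + `|t|) ^+ 2.
  apply: le_trans (nc_Q z hk e0 t t0) _; rewrite /K -(real_normK (num_real t)).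
  move: c0; move: (1 / eps + nc z + 1) => c c0; have := normr_ge0 t; move: `|t| => s s0.
  rewrite !expr2; have := mulr_ge0 c0 s0; have := mulr_ge0 c0 (mulr_ge0 s0 s0); nra.
apply: (resolvent_point VE V_cc).
- exact: (green_operator h1 h2 V_even V_cc K0 V_le p0 p10 B0 dec ker).
- exact: (homogeneous_L2_zero h1 h2 V_even V_cc p0 p10 B0 dec).
Qed.
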